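(* Let $K$ be a regular compact set with $K\subset[-1,1]$ and $\pm1\in K$. Let $\alpha,\beta\in\mathbb N\cup\{0\}$ with $\alpha+\beta\geq1$, and let $$d\mu(x)=(1-x)^\alpha(1+x)^\beta\,d\mu_K(x).$$ Then for every $n\in\mathbb N$, $$[W_{2,n}(\mu)]^2\geq 2S(\mu).$$
   Context: $\mu_K$ is the equilibrium measure and $\mathrm{Cap}(K)$ the logarithmic capacity of $K$; regular means regular for the Dirichlet problem. For a finite positive Borel measure $\mu$ with support $K$, write the Lebesgue decomposition $d\mu=f\,d\mu_K+d\mu_s$ and set $S(\mu)=\exp\big[\int\log f(x)\,d\mu_K(x)\big]$. $P_n(\cdot;\mu)$ is the monic polynomial of degree $n$ minimizing $\|P_n\|_{L_2(\mu)}$, and $W_{2,n}(\mu)=\|P_n(\cdot;\mu)\|_{L_2(\mu)}/\mathrm{Cap}(\mathrm{supp}\,\mu)^n$. *)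

(* Defs.v *)
From HB Require Import structures.
From mathcomp Require Import all_boot all_order all_algebra.
From mathcomp Require Import all_classical all_reals all_analysis.
Set Implicit Arguments. Unset Strict Implicit. Unset Printing Implicit Defensive.
Import Order.TTheory GRing.Theory Num.Theory.
Import numFieldNormedType.Exports.
Local Open Scope classical_set_scope.
Local Open Scope ring_scope.

(* Points of the plane C are modelled as R * R. *)

Section Defs.
Variable R : realType.

Definition e1 : R * R := (1, 0).
Definition e2 : R * R := (0, 1).

Definition partial (v : R * R) (u : R * R -> R) : R * R -> R :=
  fun z => 'D_v u z.

Definition harmonic_on (U : set (R * R)) (u : R * R -> R) : Prop :=
  open U /\
  forall z, U z ->
    [/\ differentiable u z,
        differentiable (partial e1 u) z,
        differentiable (partial e2 u) z &
        partial e1 (partial e1 u) z + partial e2 (partial e2 u) z = 0].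

Definition embedR (K : set R) : set (R * R) := [set z | K z.1 /\ z.2 = 0].

(* K (a compact subset of the real line) is regular for the Dirichlet problem:
   the Dirichlet problem on Omega = (extended plane) \ K is solvable for every
   continuous boundary datum on the boundary of Omega, which is K.  Harmonicity
   at infinity is expressed by boundedness near infinity (removable singularity). *)
Definition dirichlet_regular (K : set R) : Prop :=
  forall f : R -> R, {within K, continuous f} ->
  exists h : R * R -> R,
    [/\ harmonic_on (~` embedR K) h,
        exists M : R, forall z, ~ embedR K z -> `|h z| <= M &
        forall x, K x -> h z @[z --> within (~` embedR K) (nbhs (x, 0))] --> f x].

Definition logkernel (x y : R) : \bar R :=
  if x == y then +oo%E else (- ln `|x - y|)%:E.

Definition energy (nu : {measure set R -> \bar R}) : \bar R :=
  (\int[nu]_x (\int[nu]_y logkernel x y))%E.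

Definition is_prob_on (E : set R) (nu : {measure set R -> \bar R}) : Prop :=
  nu setT = 1%E /\ nu (~` E) = 0%E.

Definition robin (E : set R) : \bar R :=
  ereal_inf [set energy nu | nu in [set nu | is_prob_on E nu]].

Definition expE (a : \bar R) : R :=
  match a with
  | r%:E => expR r
  | +oo%E => 0 (* never used: exp(+oo) does not occur below *)
  | -oo%E => 0
  end.

Definition capacity (E : set R) : R := expE (- robin E)%E.

Definition equilibrium_measure (K : set R) (nu : {measure set R -> \bar R}) : Prop :=
  is_prob_on K nu /\ energy nu = robin K.

Definition support (mu : {measure set R -> \bar R}) : set R :=
  [set x | forall e : R, 0 < e -> (0 < mu (ball x e))%E].

Definition eln (y : R) : \bar R := if 0 < y then (ln y)%:E else -oo%E.

(* S(mu) relative to muK: d mu = f d muK + d mu_s (Lebesgue decomposition),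
   S = exp( int log f d muK ). *)
Definition szego (muK mu : {measure set R -> \bar R}) (S : R) : Prop :=
  exists (f : R -> R) (mus : {measure set R -> \bar R}),
  [/\ measurable_fun setT f, (forall x, 0 <= f x),
      (exists2 N : set R, measurable N & muK N = 0%E /\ mus (~` N) = 0%E),
      (forall A, measurable A -> mu A = (\int[muK]_(x in A) (f x)%:E + mus A)%E) &
      S = expE (\int[muK]_x eln (f x))%E].

Definition L2min_sq (mu : {measure set R -> \bar R}) (n : nat) : \bar R :=
  ereal_inf [set (\int[mu]_x ((p.[x]) ^+ 2)%:E)%E |
             p in [set p : {poly R} | p \is monic /\ size p = n.+1]].

Definition widom2 (mu : {measure set R -> \bar R}) (n : nat) : R :=
  Num.sqrt (fine (L2min_sq mu n)) / capacity (support mu) ^+ n.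

End Defs.

(* Main.v *)
(* Let P be the equilibrium measure of K, I its energy and C = exp(-I) the capacity. By Frostman's
   theorem the potential of P is at most I on [-1,1]; regularity gives equality at the end points
   +-1, because a harmonic measure seen from a point a close to an end point is a measure of finite
   energy on K whose potential is, up to a small error, at most ln (1 / |a - y|). Hence
   S(mu) = C^(alpha+beta), and supp mu has capacity C.

   If p is monic of degree n, then Q = p^2 (1-x)^alpha (1+x)^beta is nonnegative on K and, up to
   sign, monic of degree N = 2n+alpha+beta >= 1, and it suffices to prove c >= 2 C^N for
   c = int Q dP. Evaluate the Laguerre polynomial L_m, which satisfies
   L_m(x)^2 <= (m+1) exp x for x >= 0, at s Q(x): as a polynomial of degree m N with leading
   coefficient s^m / m! in absolute value, it obeys
     ln (s^m / m!) + m N ln C <= int ln |L_m(s Q)| dP <= ln (m+1) / 2 + s c / 2.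
   With s = 2 m / c and Stirling's bound for m!, m -> oo yields 2 C^N <= c. *)
Require Import Defs.
From HB Require Import structures.
From mathcomp Require Import all_boot all_order all_algebra.
From mathcomp Require Import all_classical all_reals all_analysis.
From mathcomp Require Import measurable_realfun ring lra.
From mathcomp.real_closed Require complex.
Set Implicit Arguments. Unset Strict Implicit. Unset Printing Implicit Defensive.
Import Order.TTheory GRing.Theory Num.Theory.
Import numFieldNormedType.Exports.
Local Open Scope classical_set_scope.
Local Open Scope ring_scope.

(** * Superharmonicity through four-point averages *)

(** The factor 2 comes from Q >= 0: Jensen's inequality for ln Q alone gives only c >= C^N. Laguerre
    polynomials enter because they are orthogonal for exp (- x) on the half line that contains Q(K),
    and s = 2 m / c minimizes s c / 2 - m ln s.

    The obstacle is the end points. Frostman's theorem bounds the potential from above only, while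
    S(mu) needs its exact value at +-1, and regularity is given as mere solvability of the Dirichlet
    problem, without Green function or harmonic measure. Harmonic measure seen from a is recovered
    from the functional that sends a boundary datum to the value of its solution at a. Its potential
    at x0 in K would be the value at a of the solution with datum ln (1 / |x - x0|); this datum is
    unbounded, so x0 is replaced by points z = (x0, 1 / (n + 1)) off the line, and every estimate
    must be uniform in z. The estimates are comparisons by a minimum principle in the complement of
    K, a neighbourhood of infinity included.

    Frostman's bound is needed in the gaps of K as well, because the roots of L_m(s Q) are moved to
    arbitrary points of [-1, 1]. *)

Section FourPoint.
Variable R : realType.
Implicit Types (u v F : R * R -> R) (y z w : R * R) (t : R).

(** The norm of [R * R] is the maximum norm; the Euclidean distance enters through its square, a
    polynomial. *)
Definition dist2 y z : R := (y.1 - z.1) ^+ 2 + (y.2 - z.2) ^+ 2.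

Definition cross_sum u y t : R :=
  u (y.1 + t, y.2) + u (y.1 - t, y.2) + (u (y.1, y.2 + t) + u (y.1, y.2 - t)).

(* A pointwise substitute for [Delta u <= 0] that survives minima and needs no derivatives. *)
Definition superharmonic_at u y : Prop :=
  {for y, continuous u} /\
  forall eta : R, 0 < eta -> exists2 tau : R, 0 < tau &
    forall t, 0 < t < tau -> cross_sum u y t - 4 * u y <= eta * t ^+ 2.

Lemma dist2_ge0 y z : 0 <= dist2 y z.
Proof. by rewrite addr_ge0 ?sqr_ge0. Qed.

Lemma dist2_gt0 y z : y != z -> 0 < dist2 y z.
Proof.
move=> yz; rewrite lt_neqAle dist2_ge0 andbT eq_sym paddr_eq0 ?sqr_ge0//.
rewrite !expf_eq0/= !subr_eq0; apply: contra yz => /andP[/eqP e1 /eqP e2].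
by rewrite [y]surjective_pairing [z]surjective_pairing e1 e2.
Qed.

Lemma dist2C y z : dist2 y z = dist2 z y.
Proof. by rewrite /dist2; ring. Qed.

Lemma continuous_dist2 z y : {for y, continuous (dist2 ^~ z)}.
Proof.
have c1 : (fun x : R * R => x.1 - z.1) @ y --> y.1 - z.1.
  by apply: cvgB; [exact: cvg_fst|exact: cvg_cst].
have c2 : (fun x : R * R => x.2 - z.2) @ y --> y.2 - z.2.
  by apply: cvgB; [exact: cvg_snd|exact: cvg_cst].
rewrite /continuous_at /dist2 /=.
by apply: cvgD; rewrite expr2; under eq_fun do rewrite expr2; apply: cvgM.
Qed.

Lemma superharmonic_atD u v y :
  superharmonic_at u y -> superharmonic_at v y ->
  superharmonic_at (fun x => u x + v x) y.
Proof.
move=> [cu su] [cv sv]; split; first exact: cvgD cu cv.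
move=> eta eta0; have eta2 : 0 < eta / 2 by rewrite divr_gt0.
have [t1 t10 h1] := su _ eta2; have [t2 t20 h2] := sv _ eta2.
exists (Num.min t1 t2); first by rewrite lt_min t10.
move=> t; rewrite lt_min => /andP[t0 /andP[tt1 tt2]].
have := h1 t; have := h2 t; rewrite t0 tt1 tt2 /cross_sum => /(_ isT) a /(_ isT) b.
lra.
Qed.

Lemma superharmonic_atZ (c : R) u y : 0 <= c ->
  superharmonic_at u y -> superharmonic_at (fun x => c * u x) y.
Proof.
move=> c0 [cu su]; split; first by apply: cvgM => //; exact: cvg_cst.
move=> eta eta0; have e0 : 0 < eta / (c + 1) by rewrite divr_gt0 ?ltr_wpDl.
have [t1 t10 h1] := su _ e0; exists t1 => // t /h1 h.
have -> : cross_sum (fun x => c * u x) y t - 4 * (c * u y) =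
  c * (cross_sum u y t - 4 * u y) by rewrite /cross_sum; ring.
apply: (le_trans (ler_wpM2l c0 h)).
rewrite mulrA ler_wpM2r ?sqr_ge0// mulrA ler_pdivrMr ?ltr_wpDl//.
by rewrite [leRHS]mulrC ler_wpM2r ?lerDl// ltW.
Qed.

Lemma superharmonic_at_cst (c : R) y : superharmonic_at (fun=> c) y.
Proof.
split; first exact: cvg_cst.
move=> eta eta0; exists 1 => // t _; rewrite /cross_sum.
by have := mulr_ge0 (ltW eta0) (sqr_ge0 t); lra.
Qed.

Lemma nbhs_box y (P : R * R -> Prop) : (\forall x \near y, P x) ->
  exists2 r : R, 0 < r &
    forall x : R * R, `|x.1 - y.1| < r -> `|x.2 - y.2| < r -> P x.
Proof.
move=> /nbhs_ballP[r /= r0 h]; exists r => // x h1 h2; apply: h.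
by split; rewrite /ball /= distrC.
Qed.

Lemma near_cross y (P : R * R -> Prop) : (\forall x \near y, P x) ->
  exists2 tau : R, 0 < tau & forall t, 0 < t < tau ->
    [/\ P (y.1 + t, y.2), P (y.1 - t, y.2), P (y.1, y.2 + t) & P (y.1, y.2 - t)].
Proof.
move=> /nbhs_box[r r0 h]; exists r => // t /andP[t0 tr].
have e1 (a : R) : a + t - a = t by ring.
have e2 (a : R) : a - t - a = - t by ring.
by split; apply: h => /=; rewrite ?e1 ?e2 ?subrr ?normrN ?normr0// gtr0_norm.
Qed.

Lemma superharmonic_at_near u v y : (\forall x \near y, u x = v x) ->
  superharmonic_at u y -> superharmonic_at v y.
Proof.
move=> uv [cu su]; have uvy := nbhs_singleton uv; split.
  suff : v @ y --> u y by rewrite uvy.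
  by apply: cvg_trans cu; exact: near_eq_cvg uv.
move=> eta /su[t1 t10 h1]; have [t2 t20 h2] := near_cross uv.
exists (Num.min t1 t2); first by rewrite lt_min t10.
move=> t; rewrite lt_min => /andP[t0 /andP[tt1 tt2]].
have := h1 t; have := h2 t; rewrite t0 tt1 tt2 => /(_ isT)[a1 a2 a3 a4] /(_ isT).
by rewrite /cross_sum a1 a2 a3 a4 uvy.
Qed.

(** At [y] the minimum equals one of the two functions, and around [y] it lies below that one. *)
Lemma superharmonic_at_min u v y : superharmonic_at u y ->
  superharmonic_at v y -> superharmonic_at (fun x => Num.min (u x) (v x)) y.
Proof.
move=> [cu su] [cv sv]; split.
  by apply: (@continuous_min R _ u v y).
move=> eta eta0; have [t1 t10 h1] := su _ eta0; have [t2 t20 h2] := sv _ eta0.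
exists (Num.min t1 t2); first by rewrite lt_min t10.
move=> t; rewrite lt_min => /andP[t0 /andP[tt1 tt2]].
have := h1 t; have := h2 t; rewrite t0 tt1 tt2 => /(_ isT) a /(_ isT) b.
have [l|l] := leP (u y) (v y).
- apply: le_trans b; rewrite lerD2r /cross_sum.
  by rewrite !lerD// ge_min lexx.
- apply: le_trans a; rewrite lerD2r /cross_sum.
  by rewrite !lerD// ge_min lexx orbT.
Qed.

End FourPoint.

(** * Minimum principle on bounded domains *)

Section MinPrinciple.
Variable R : realType.
Implicit Types (u v F : R * R -> R) (y z w : R * R) (t : R).

(** Subtracting [e * dist2] makes superharmonicity strict: four times the value at the centre is
    exceeded by the cross sum of [dist2] by exactly [4 * t ^+ 2], more than the error [e * t ^+ 2]
    allowed for [F]. The perturbed function then cannot have a minimum inside [U]. *)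
Lemma min_principle_bounded (U : set (R * R)) F (m B : R) : open U ->
  (forall y, U y -> `|y.1| <= B /\ `|y.2| <= B) ->
  (forall y, U y -> superharmonic_at F y) ->
  (forall w, ~ U w -> forall eps : R, 0 < eps ->
    \forall y \near w, U y -> m - eps <= F y) ->
  forall y, U y -> m <= F y.
Proof.
move=> oU bU sF bdF y0 Uy0; rewrite leNgt; apply/negP => Fm.
pose g := m - F y0; have g0 : 0 < g by rewrite subr_gt0.
pose B2 := 8 * B ^+ 2.
have B20 : 0 <= B2 by rewrite mulr_ge0 ?sqr_ge0.
have dB y : U y -> dist2 y y0 <= B2.
  move=> Uy; have [a1 a2] := bU _ Uy; have [b1 b2] := bU _ Uy0.
  have h (a b : R) : `|a| <= B -> `|b| <= B -> (a - b) ^+ 2 <= 4 * B ^+ 2.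
    rewrite !ler_norml => /andP[? ?] /andP[? ?].
    rewrite -subr_ge0.
    have -> : 4 * B ^+ 2 - (a - b) ^+ 2 = (2 * B - (a - b)) * (2 * B + (a - b)).
      by ring.
    by apply: mulr_ge0; lra.
  by have := h _ _ a1 b1; have := h _ _ a2 b2; rewrite /dist2 /B2; lra.
(* Small enough for [e * dist2 y y0 <= g / 4] on [U]: together with the boundary condition at
   precision [g / 4], [G] stays above [c = m - g / 2] near the complement of [U]. *)
pose e := g / (4 * (B2 + 1)).
have e0 : 0 < e by rewrite divr_gt0// mulr_gt0// ltr_wpDl.
have eB : e * B2 <= g / 4.
  have -> : g / 4 = e * (B2 + 1) by rewrite /e; field; rewrite gt_eqF// ltr_wpDl.
  by rewrite ler_wpM2l ?lerDl// ltW.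
pose c := m - g / 2.
pose G y := F y - e * dist2 y y0.
(* Truncation at the level [c] extends [G] continuously to the whole plane, so the minimum can be
   taken over a box instead of the closure of [U]. *)
pose H y := if `[< U y >] then Num.min (G y) c else c.
have sG y : U y -> {for y, continuous G}.
  move=> /sF[cF _]; apply: cvgB => //; apply: cvgM; first exact: cvg_cst.
  exact: continuous_dist2.
have cH y : {for y, continuous H}.
  have [Uy|nUy] := pselect (U y).
    have : (fun x => Num.min (G x) c) @ y --> H y.
      rewrite /H asboolT//.
      exact: (@continuous_min R _ G (fun=> c) y (sG _ Uy) (cvg_cst _)).
    apply: cvg_trans; apply: near_eq_cvg; near=> x.
    rewrite /H asboolT//; near: x; exact: (open_nbhs_nbhs (conj oU Uy)).
  have : (fun=> c) @ y --> H y by rewrite /H asboolF//; exact: cvg_cst.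
  apply: cvg_trans; apply: near_eq_cvg.
  have g4 : 0 < g / 4 by rewrite divr_gt0.
  apply: filterS (bdF _ nUy _ g4) => x h.
  rewrite /H; case: asboolP => // Ux; apply/esym/min_idPr.
  have := h Ux; have := ler_wpM2l (ltW e0) (dB _ Ux); rewrite /G /c; lra.
pose box : set (R * R) := `[- B, B] `*` `[- B, B].
have box0 y : U y -> box y.
  by move=> Uy; have [a b] := bU _ Uy; split; rewrite /= in_itv/= -ler_norml.
have [] := @compact_EVT_min _ R H box.
- by exists y0; exact: box0.
- by apply: compact_setX; exact: segment_compact.
- exact: continuous_subspaceT.
move=> x _ xmin.
have Hx : H x <= F y0.
  have := xmin y0; rewrite inE => /(_ (box0 _ Uy0)) h; apply: (le_trans h).
  by rewrite /H asboolT// ge_min /G /dist2 !subrr expr0n/= addr0 mulr0 subr0 lexx.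
have Ux : U x.
  apply: contrapT => nUx; move: Hx; rewrite /H asboolF//; rewrite /c /g; lra.
have HG : H x = G x.
  move: Hx; rewrite /H asboolT// minEle; case: ifP => //; rewrite /c /g; lra.
have minG y : U y -> G x <= G y.
  move=> Uy; have := xmin y; rewrite inE => /(_ (box0 _ Uy)) h.
  by rewrite -HG (le_trans h)// /H asboolT// ge_min lexx.
have [_ sx] := sF _ Ux; have [t1 t10 h1] := sx _ e0.
have Unear : nbhs x U := open_nbhs_nbhs (conj oU Ux).
have [t2 t20 h2] := near_cross Unear.
pose t := Num.min t1 t2 / 2.
have tm : 0 < Num.min t1 t2 by rewrite lt_min t10.
have t0 : 0 < t by rewrite divr_gt0.
have tlt : t < Num.min t1 t2 by rewrite ltr_pdivrMr// ltr_pMr// ltr1n.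
have [a1 a2 a3 a4] : [/\ U (x.1 + t, x.2), U (x.1 - t, x.2),
    U (x.1, x.2 + t) & U (x.1, x.2 - t)].
  by apply: h2; rewrite t0/=; move: tlt; rewrite lt_min => /andP[].
have {}h1 : cross_sum F x t - 4 * F x <= e * t ^+ 2.
  by apply: h1; rewrite t0/=; move: tlt; rewrite lt_min => /andP[].
have t20' : 0 < e * t ^+ 2 by rewrite mulr_gt0// exprn_gt0.
have := minG _ a1; have := minG _ a2; have := minG _ a3; have := minG _ a4.
move: h1 t20'; rewrite /cross_sum /G /dist2 /=.
move: (F _) (F (x.1 - t, x.2)) (F (x.1, x.2 + t)) (F (x.1, x.2 - t)) (F x) => f1 f2 f3 f4 f0.
move: (x.1) (x.2) (y0.1) (y0.2) => p q p' q'; nra.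
Unshelve. all: by end_near. Qed.

End MinPrinciple.

(** * The logarithm of the distance, and the minimum principle on unbounded domains *)

Section LogKernel.
Variable R : realType.
Implicit Types (u v F : R * R -> R) (y z w : R * R) (t : R).

Definition logdist2 z y : R := ln (dist2 y z).

Lemma continuous_logdist2 z y : y != z -> {for y, continuous (logdist2 z)}.
Proof.
move=> yz; have cd : {for y, continuous (fun x : R * R => dist2 x z)} by exact: continuous_dist2.
by apply: continuous_cvg cd; exact/continuous_ln/dist2_gt0.
Qed.

Lemma abs_ln1D (x : R) : `|x| <= 1 / 2 -> `|ln (1 + x)| <= 2 * `|x|.
Proof.
move=> x2; have : - (1 / 2) <= x <= 1 / 2 by rewrite -ler_norml.
move=> /andP[xl xu].
have x1 : 0 < 1 + x by lra.
have h1 : ln (1 + x) <= x by apply: le_ln1Dx; lra.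
have h2 : x / (1 + x) <= ln (1 + x).
  rewrite -lerN2 -lnV ?posrE//.
  have e : (1 + x)^-1 = 1 + (- (x / (1 + x))) by field; rewrite gt_eqF.
  rewrite [X in ln X]e.
  apply: le_ln1Dx; rewrite ltrN2 ltr_pdivrMr//; lra.
have h3 : - (2 * `|x|) <= x / (1 + x).
  rewrite ler_pdivlMr//.
  case: (leP 0 x) => x0; first by rewrite ger0_norm//; nra.
  by rewrite ltr0_norm//; nra.
rewrite ler_norml (le_trans h3 h2)/= (le_trans h1)//.
by have := ler_norm x; have := normr_ge0 x; lra.
Qed.

(* The product of [w + t], [w - t], [w + it], [w - it] is [w^4 - t^4]. *)
Lemma cross_sum_logdist2 z y t : y != z -> 0 <= t ->
  4 * t ^+ 2 <= dist2 y z ->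
  `|cross_sum (logdist2 z) y t - 4 * logdist2 z y| <=
    6 * (t ^+ 2 / dist2 y z) ^+ 2.
Proof.
move=> yz t0 tD; have D0 := dist2_gt0 yz.
rewrite /cross_sum /logdist2.
move: tD D0; rewrite /dist2 /=.
set p := y.1 - z.1; set q := y.2 - z.2.
have -> : y.1 + t - z.1 = p + t by rewrite /p; ring.
have -> : y.1 - t - z.1 = p - t by rewrite /p; ring.
have -> : y.2 + t - z.2 = q + t by rewrite /q; ring.
have -> : y.2 - t - z.2 = q - t by rewrite /q; ring.
set D := p ^+ 2 + q ^+ 2 => tD D0.
have p1 : 0 < (p + t) ^+ 2 + q ^+ 2 by rewrite /D in tD D0; nra.
have p2 : 0 < (p - t) ^+ 2 + q ^+ 2 by rewrite /D in tD D0; nra.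
have p3 : 0 < p ^+ 2 + (q + t) ^+ 2 by rewrite /D in tD D0; nra.
have p4 : 0 < p ^+ 2 + (q - t) ^+ 2 by rewrite /D in tD D0; nra.
(* The real part of w^4 for w = p + i q. *)
set re := p ^+ 4 - 6 * p ^+ 2 * q ^+ 2 + q ^+ 4.
have reD : `|re| <= D ^+ 2.
  rewrite ler_norml /re /D; apply/andP; split.
    rewrite -subr_ge0.
    have -> : p ^+ 4 - 6 * p ^+ 2 * q ^+ 2 + q ^+ 4 - - (p ^+ 2 + q ^+ 2) ^+ 2
       = 2 * (p ^+ 2 - q ^+ 2) ^+ 2 by ring.
    by rewrite mulr_ge0// sqr_ge0.
  rewrite -subr_ge0.
  have -> : (p ^+ 2 + q ^+ 2) ^+ 2 - (p ^+ 4 - 6 * p ^+ 2 * q ^+ 2 + q ^+ 4)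
       = 8 * (p * q) ^+ 2 by ring.
  by rewrite mulr_ge0// sqr_ge0.
pose s := t ^+ 2 / D.
have s0 : 0 <= s by rewrite divr_ge0 ?sqr_ge0// ltW.
have s4 : s <= 1 / 4 by rewrite ler_pdivrMr//; lra.
(* Here 1 + x is the squared modulus of 1 - t^4 / w^4, and the whole difference is its logarithm. *)
pose x := s ^+ 4 - 2 * s ^+ 2 * (re / D ^+ 2).
have xs : `|x| <= 3 * s ^+ 2.
  have reD1 : `|re / D ^+ 2| <= 1.
    rewrite normrM normfV (ger0_norm (sqr_ge0 D)).
    by rewrite ler_pdivrMr ?exprn_gt0// mul1r.
  rewrite ler_norml in reD1; case/andP: reD1 => l1 l2.
  have s20 : 0 <= s ^+ 2 by exact: sqr_ge0.
  have s42 : s ^+ 4 <= s ^+ 2.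
    have -> : s ^+ 4 = s ^+ 2 * s ^+ 2 by ring.
    by rewrite ler_piMr//; nra.
  have s44 : 0 <= s ^+ 4 by exact: exprn_ge0.
  rewrite ler_norml /x; apply/andP; split; nra.
have x2 : `|x| <= 1 / 2 by apply: (le_trans xs); nra.
have prodE : ((p + t) ^+ 2 + q ^+ 2) * ((p - t) ^+ 2 + q ^+ 2) *
    ((p ^+ 2 + (q + t) ^+ 2) * (p ^+ 2 + (q - t) ^+ 2)) = D ^+ 4 * (1 + x).
  rewrite /x /s.
  have -> : D ^+ 4 * (1 + ((t ^+ 2 / D) ^+ 4 - 2 * (t ^+ 2 / D) ^+ 2 * (re / D ^+ 2)))
     = D ^+ 4 - 2 * t ^+ 4 * re + t ^+ 8.
    by field; rewrite gt_eqF.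
  by rewrite /re /D; ring.
have x1 : 0 < 1 + x by move: x2; rewrite ler_norml => /andP[? ?]; lra.
have -> : ln ((p + t) ^+ 2 + q ^+ 2) + ln ((p - t) ^+ 2 + q ^+ 2) +
   (ln (p ^+ 2 + (q + t) ^+ 2) + ln (p ^+ 2 + (q - t) ^+ 2)) - 4 * ln D
   = ln (1 + x).
  rewrite -!lnM ?posrE ?mulr_gt0// prodE lnM ?posrE ?exprn_gt0//.
  by rewrite lnXn// -mulr_natl; ring.
apply: le_trans (abs_ln1D x2) _.
by apply: le_trans (ler_wpM2l _ xs) _ => //; rewrite /s; lra.
Qed.

Lemma logdist2_both z y : y != z ->
  superharmonic_at (logdist2 z) y /\ superharmonic_at (fun x => - logdist2 z x) y.
Proof.
move=> yz; have D0 := dist2_gt0 yz.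
have key (eta : R) : 0 < eta -> exists2 tau : R, 0 < tau &
    forall t, 0 < t < tau ->
    `|cross_sum (logdist2 z) y t - 4 * logdist2 z y| <= eta * t ^+ 2.
  move=> eta0.
  set D := dist2 y z in D0 *.
  pose tau := Num.min 1 (Num.min (D / 4) (eta * D ^+ 2 / 6)).
  exists tau; first by rewrite !lt_min ltr01 !divr_gt0// mulr_gt0// exprn_gt0.
  move=> t /andP[t0]; rewrite !lt_min => /andP[t1 /andP[t4 t6]].
  have tt : t ^+ 2 <= t by rewrite expr2 ler_piMr ?ltW.
  apply: le_trans (cross_sum_logdist2 yz (ltW t0) _) _; first by rewrite -/D; lra.
  rewrite -/D expr_div_n mulrA ler_pdivrMr ?exprn_gt0//.
  have -> : 6 * (t ^+ 2) ^+ 2 = t ^+ 2 * (6 * t ^+ 2) by ring.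
  have -> : eta * t ^+ 2 * D ^+ 2 = t ^+ 2 * (eta * D ^+ 2) by ring.
  by rewrite ler_wpM2l ?sqr_ge0//; lra.
split; split; first exact: continuous_logdist2.
- move=> eta /key[tau tau0 h]; exists tau => // t /h.
  by apply: le_trans; exact: ler_norm.
- by apply: cvgN; exact: continuous_logdist2.
- move=> eta /key[tau tau0 h]; exists tau => // t /h; apply: le_trans.
  apply: le_trans (ler_norm _) _; rewrite -normrN /cross_sum.
  by rewrite le_eqVlt; apply/orP; left; apply/eqP; congr `|_|; ring.
Qed.

Lemma superharmonic_logdist2 z y : y != z -> superharmonic_at (logdist2 z) y.
Proof. by case/logdist2_both. Qed.

Lemma superharmonic_Nlogdist2 z y : y != z ->
  superharmonic_at (fun x => - logdist2 z x) y.
Proof. by case/logdist2_both. Qed.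

(* Unbounded domains: the slowly growing harmonic function [ln |y - x1|], with its pole at a
   point [x1] outside the domain, absorbs the lack of control at infinity. *)
Lemma min_principle (U : set (R * R)) F (m M : R) (x1 : R * R) : open U ->
  ~ U x1 ->
  (forall y, U y -> superharmonic_at F y) ->
  (forall w, ~ U w -> forall eps : R, 0 < eps ->
    \forall y \near w, U y -> m - eps <= F y) ->
  (exists r : R, forall y, U y -> r <= dist2 y x1 -> M <= F y) ->
  forall y, U y -> m <= F y.
Proof.
move=> oU nUx1 sF bdF [r0 infF] y0 Uy0.
apply/ler_addgt0Pr => eps eps0.
have e2 : 0 < eps / 2 by rewrite divr_gt0.
have [rho rho0 hrho] := nbhs_box (bdF _ nUx1 _ e2).
pose rr := rho ^+ 2 / 4.
have rr0 : 0 < rr by rewrite divr_gt0// exprn_gt0.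
have near1 y : U y -> dist2 y x1 < 2 * rr -> m - eps / 2 <= F y.
  move=> Uy; rewrite /dist2 /rr => h.
  have sm (a : R) : a ^+ 2 < rho ^+ 2 -> `|a| < rho.
    by move=> aa; rewrite ltr_norml; apply/andP; split; nra.
  have a0 := sqr_ge0 (y.1 - x1.1); have b0 := sqr_ge0 (y.2 - x1.2).
  have r2 : 0 < rho ^+ 2 by rewrite exprn_gt0.
  by apply: hrho => //; apply: sm; lra.
have [small|large] := ltP (dist2 y0 x1) (2 * rr).
  by have := near1 _ Uy0 small; lra.
pose L := ln (dist2 y0 x1) - ln rr.
have dy0 : 0 < dist2 y0 x1 by apply: lt_le_trans large; rewrite mulr_gt0.
have L0 : 0 < L.
  by rewrite subr_gt0 ltr_ln ?posrE// (lt_le_trans _ large)//; lra.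
(* With this factor the added logarithmic term is exactly [eps / 2] at [y0]. *)
pose e' := eps / 2 / L.
have e'0 : 0 < e' by rewrite divr_gt0.
(* Beyond this squared distance from [x1] the added term is at least [|m - M| + eps] and makes up
   for the weak bound [M]. *)
pose T := expR (ln rr + (`|m - M| + eps) / e').
pose RR := Num.max (T + 1) (Num.max (r0 + 1) (dist2 y0 x1 + 1)).
pose V : set (R * R) := U `&` [set y | rr < dist2 y x1] `&` [set y | dist2 y x1 < RR].
have cd y : {for y, continuous (fun x : R * R => dist2 x x1)} by exact: continuous_dist2.
have oV : open V.
  apply: openI; first apply: openI => //.
  - have -> : [set y | rr < dist2 y x1] = (fun x : R * R => dist2 x x1) @^-1` [set a | rr < a] by [].
    by apply: open_comp; [move=> y _; exact: cd|exact: open_gt].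
  - have -> : [set y | dist2 y x1 < RR] = (fun x : R * R => dist2 x x1) @^-1` [set a | a < RR] by [].
    by apply: open_comp; [move=> y _; exact: cd|exact: open_lt].
pose F' y := F y + e' * (logdist2 x1 y - ln rr).
have RR0 : 0 < RR by rewrite lt_max addr_gt0 ?expR_gt0.
have Vbd y : V y -> `|y.1| <= `|x1.1| + `|x1.2| + (RR + 1) /\
                    `|y.2| <= `|x1.1| + `|x1.2| + (RR + 1).
  move=> [_ /= h].
  have sm (a b : R) : a ^+ 2 + b ^+ 2 < RR -> `|a| <= RR + 1.
    move=> hab; rewrite leNgt; apply/negP => ha.
    have : (RR + 1) ^+ 2 < `|a| ^+ 2.
      by rewrite ltr_pXn2r ?nnegrE ?normr_ge0// addr_ge0 ?ltW.
    rewrite real_normK ?num_real//; have := sqr_ge0 b; nra.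
  have h1 := sm _ _ h; rewrite /dist2 addrC in h; have h2 := sm _ _ h.
  have t1 : `|y.1| <= `|x1.1| + `|y.1 - x1.1|.
    by have := ler_normD x1.1 (y.1 - x1.1); rewrite addrC subrK.
  have t2 : `|y.2| <= `|x1.2| + `|y.2 - x1.2|.
    by have := ler_normD x1.2 (y.2 - x1.2); rewrite addrC subrK.
  by have := normr_ge0 x1.1; have := normr_ge0 x1.2; split; lra.
have pos y : V y -> 0 <= logdist2 x1 y - ln rr.
  move=> [[_ /= h] _]; rewrite subr_ge0 ler_ln ?posrE ?ltW//.
  exact: lt_trans h.
have main : forall y, V y -> m - eps / 2 <= F' y.
  apply: (min_principle_bounded oV Vbd).
  - move=> y [[Uy /= h] _]; apply: superharmonic_atD; first exact: sF.
    apply: superharmonic_atZ; first exact: ltW.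
    apply: superharmonic_atD; last exact: superharmonic_at_cst.
    apply: superharmonic_logdist2; apply/eqP => yx.
    by move: h; rewrite yx /dist2 !subrr expr0n/= addr0 ltNge ltW.
  - move=> w nVw d d0.
    have [Uw|nUw] := pselect (U w); last first.
      apply: filterS (bdF _ nUw _ e2) => y hy Vy; have [[Uy _] _] := Vy.
      have := hy Uy; have := mulr_ge0 (ltW e'0) (pos _ Vy); rewrite /F'; lra.
    have [wr|wr] := ltP (dist2 w x1) (2 * rr).
      have : \forall y \near w, dist2 y x1 < 2 * rr.
        exact: (cvgr_lt _ (cd w)).
      apply: filterS => y hy Vy; have [[Uy _] _] := Vy.
      have := near1 _ Uy hy; have := mulr_ge0 (ltW e'0) (pos _ Vy).
      rewrite /F'; lra.
    have wR : RR <= dist2 w x1.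
      rewrite leNgt; apply/negP => wRR; apply: nVw; split => //; split => //=.
      by apply: lt_le_trans wr; lra.
    have : \forall y \near w, RR - 1 < dist2 y x1.
      by apply: (cvgr_gt _ (cd w)); lra.
    apply: filterS => y hy Vy; have [[Uy /= yrr] _] := Vy.
    have RT : T + 1 <= RR by rewrite le_max lexx.
    have Rr : r0 + 1 <= RR by rewrite !le_max lexx !orbT.
    have yT : T <= dist2 y x1 by lra.
    have FM : M <= F y by apply: infF => //; lra.
    have lT : ln rr + (`|m - M| + eps) / e' <= logdist2 x1 y.
      rewrite -[leLHS]expRK ler_ln ?posrE ?expR_gt0//.
      by apply: lt_le_trans yT; exact: expR_gt0.
    have : `|m - M| + eps <= e' * (logdist2 x1 y - ln rr).
      by rewrite mulrC -ler_pdivrMr//; lra.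
    rewrite /F'; have := ler_norm (m - M); lra.
have Vy0 : V y0.
  split; [split=> //=; lra|rewrite /= !lt_max]; apply/orP; right; apply/orP; right.
  by rewrite ltrDl.
have := main _ Vy0; rewrite /F' /logdist2 -/L.
have -> : e' * L = eps / 2 by rewrite /e' divfK// gt_eqF.
lra.
Qed.

End LogKernel.

(** * Harmonic functions in the four-point sense *)

Section SecondDifference.
Variable R : realType.

Lemma derive_first_order (g : R -> R) (L : R) : is_derive (0 : R) 1 g L ->
  forall eta : R, 0 < eta -> exists2 tau : R, 0 < tau &
    forall h : R, `|h| < tau -> `|g h - g 0 - L * h| <= eta * `|h|.
Proof.
move=> [dg gL] eta eta0.
have : (fun h : R => h^-1 *: (g (h *: 1 + 0) - g 0)) @ 0^' --> L.
  by rewrite -gL; exact: dg.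
move/cvgrPdist_le => /(_ _ eta0); rewrite near_withinE => /nbhs_ballP[tau /= tau0 hh].
exists tau => // h htau.
have [->|h0] := eqVneq h 0; first by rewrite mulr0 subr0 subrr !normr0 mulr0.
have : ball 0 tau h by rewrite /ball /= sub0r normrN.
move=> /hh /(_ h0); rewrite addr0 /GRing.scale/= mulr1 => le.
have -> : g h - g 0 - L * h = - ((L - h^-1 * (g h - g 0)) * h) by field.
by rewrite normrN normrM ler_wpM2r.
Qed.

(** The second derivative exists at 0 only, so Taylor's formula is replaced by the mean value
    theorem for f(s) + f(-s) - L s^2, whose derivative is controlled by the first-order expansion of
    [g] at 0. *)
Lemma second_difference (f g : R -> R) (L r : R) : 0 < r ->
  (forall s : R, `|s| < r -> is_derive s 1 f (g s)) ->
  is_derive (0 : R) 1 g L ->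
  forall eta : R, 0 < eta -> exists2 tau : R, 0 < tau &
    forall t : R, 0 < t < tau ->
      `|f t + f (- t) - 2 * f 0 - L * t ^+ 2| <= eta * t ^+ 2.
Proof.
move=> r0 df dg eta eta0.
have e2 : 0 < eta / 2 by rewrite divr_gt0.
have [t1 t10 h1] := derive_first_order dg e2.
exists (Num.min t1 r); first by rewrite lt_min t10.
move=> t /andP[t0]; rewrite lt_min => /andP[tt1 tr].
pose psi s := f s + f (- s) - L * s ^+ 2.
pose dpsi s := g s - g (- s) - L * (2 * s).
have dp (s : R) : `|s| < r -> is_derive s 1 psi (dpsi s).
  move=> sr; have d1 := df _ sr.
  have d2 : is_derive (- s) 1 f (g (- s)) by apply: df; rewrite normrN.
  have d3 : is_derive s 1 (fun s : R => f (- s)) (- g (- s)).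
    have := @is_derive1_comp R f (fun s : R => - s) s (g (- s)) (-1) d2.
    by rewrite mulrN1; apply; exact: is_deriveNid.
  rewrite /psi /dpsi.
  have d4 : is_derive s 1 (fun s : R => L * s ^+ 2) (L * (2 * s)).
    apply: is_derive_eq; rewrite /GRing.scale /=; ring.
  by have := is_deriveB (is_deriveD d1 d3) d4.
have cpsi : {within `[0, t], continuous psi}.
  apply: derivable_within_continuous => s; rewrite in_itv/= => /andP[s0 st].
  by apply: ex_derive; apply: dp; rewrite ger0_norm// (le_lt_trans st).
have [s|c] := @MVT _ psi dpsi 0 t t0 _ cpsi.
  rewrite in_itv/= => /andP[s0 st]; apply: dp.
  by rewrite gtr0_norm// (lt_trans st).
rewrite in_itv/= => /andP[c0 ct] E.
have ct1 : c < t1 by exact: lt_trans tt1.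
have a1 := h1 c; rewrite gtr0_norm// in a1; have {}a1 := a1 ct1.
have a2 := h1 (- c); rewrite normrN gtr0_norm// in a2; have {}a2 := a2 ct1.
have -> : f t + f (- t) - 2 * f 0 - L * t ^+ 2 = dpsi c * t.
  by move: E; rewrite subr0 => <-; rewrite /psi oppr0; ring.
have -> : eta * t ^+ 2 = (eta * t) * t by ring.
rewrite normrM (gtr0_norm t0) ler_pM2r//.
have -> : dpsi c = (g c - g 0 - L * c) - (g (- c) - g 0 - L * - c).
  by rewrite /dpsi; ring.
apply: (le_trans (ler_normB _ _)).
have := ler_wpM2l (ltW eta0) (ltW ct); lra.
Qed.

Lemma is_derive_line (u : R * R -> R) (v y : R * R) (s : R) :
  derivable u (y + s *: v) v ->
  is_derive s 1 (fun s => u (y + s *: v)) ('D_v u (y + s *: v)).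
Proof.
move=> d.
have E : (fun h : R => h^-1 *: ((fun s => u (y + s *: v)) (h *: 1 + s) - u (y + s *: v)))
   = (fun h : R => h^-1 *: (u (h *: v + (y + s *: v)) - u (y + s *: v))).
  apply/funext => h; congr (_ *: (u _ - _)).
  by rewrite [h *: 1]mulr1 scalerDl addrCA.
by split; [rewrite /derivable E|rewrite /derive E].
Qed.

(** The second differences along the two axes are t^2 times the second partial derivatives, up to
    o(t^2); their sum is o(t^2) because the Laplacian vanishes, which gives both signs. *)
Lemma harmonic_superharmonic (U : set (R * R)) (u : R * R -> R) y :
  harmonic_on U u -> U y ->
  superharmonic_at u y /\ superharmonic_at (fun x => - u x) y.
Proof.
move=> [oU hu] Uy; have [du d1 d2 lap] := hu _ Uy.
have cu : {for y, continuous u} by exact: differentiable_continuous.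
have [r r0 hr] := nbhs_box (open_nbhs_nbhs (conj oU Uy)).
have line (v : R * R) : `|v.1| <= 1 -> `|v.2| <= 1 ->
    differentiable (partial v u) y ->
    forall eta : R, 0 < eta -> exists2 tau : R, 0 < tau & forall t : R, 0 < t < tau ->
    `|u (y + t *: v) + u (y - t *: v) - 2 * u y - partial v (partial v u) y * t ^+ 2|
    <= eta * t ^+ 2.
  move=> v1 v2 dv eta eta0.
  have [||tau tau0 h] := @second_difference (fun s => u (y + s *: v))
     (fun s => partial v u (y + s *: v)) (partial v (partial v u) y) r r0 _ _ _ eta0.
  - move=> s sr; apply: is_derive_line; apply: diff_derivable.
    by have [] // := hu (y + s *: v); apply: hr;
      rewrite addrAC subrr add0r normrM (le_lt_trans _ sr)// ler_piMr.
  - have := @is_derive_line (partial v u) v y 0.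
    by rewrite scale0r addr0; apply; exact: diff_derivable.
  - by exists tau => // t /h; rewrite scaleNr scale0r addr0.
have e1n : `|(e1 R).1| <= 1 /\ `|(e1 R).2| <= 1 by rewrite /= normr1 normr0.
have e2n : `|(e2 R).1| <= 1 /\ `|(e2 R).2| <= 1 by rewrite /= normr1 normr0.
have key (eta : R) : 0 < eta -> exists2 tau : R, 0 < tau & forall t : R,
    0 < t < tau -> `|cross_sum u y t - 4 * u y| <= eta * t ^+ 2.
  move=> eta0; have e2 : 0 < eta / 2 by rewrite divr_gt0.
  have [t1 t10 h1] := line _ e1n.1 e1n.2 d1 _ e2.
  have [t2 t20 h2] := line _ e2n.1 e2n.2 d2 _ e2.
  move: (partial (e1 R) (partial (e1 R) u) y) lap h1 => A lap h1.
  move: (partial (Defs.e2 R) (partial (Defs.e2 R) u) y) lap h2 => B lap h2.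
  exists (Num.min t1 t2); first by rewrite lt_min t10.
  move=> t; rewrite lt_min => /andP[t0 /andP[tt1 tt2]].
  have E1 : y + t *: e1 R = (y.1 + t, y.2).
    by rewrite /e1 [LHS]surjective_pairing /= /GRing.scale/= mulr1 mulr0 addr0.
  have E2 : y - t *: e1 R = (y.1 - t, y.2).
    by rewrite /e1 [LHS]surjective_pairing /= /GRing.scale/= mulr1 mulr0 subr0.
  have E3 : y + t *: Defs.e2 R = (y.1, y.2 + t).
    by rewrite /Defs.e2 [LHS]surjective_pairing /= /GRing.scale/= mulr1 mulr0 addr0.
  have E4 : y - t *: Defs.e2 R = (y.1, y.2 - t).
    by rewrite /Defs.e2 [LHS]surjective_pairing /= /GRing.scale/= mulr1 mulr0 subr0.
  have := h1 t; have := h2 t; rewrite t0 tt1 tt2 E1 E2 E3 E4 => /(_ isT) a /(_ isT) b.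
  have := ler_normD (u (y.1, y.2 + t) + u (y.1, y.2 - t) - 2 * u y -
     B * t ^+ 2) (u (y.1 + t, y.2) + u (y.1 - t, y.2) - 2 * u y -
     A * t ^+ 2).
  set X := (X in `|X| <= _ -> _).
  have -> : X = cross_sum u y t - 4 * u y -
     (A + B) * t ^+ 2.
    by rewrite /X /cross_sum; ring.
  rewrite lap mul0r subr0; lra.
split; split => //.
- move=> eta /key[tau tau0 h]; exists tau => // t /h.
  by apply: le_trans; exact: ler_norm.
- exact: cvgN.
- move=> eta /key[tau tau0 h]; exists tau => // t /h; apply: le_trans.
  apply: le_trans (ler_norm _) _; rewrite -normrN /cross_sum.
  by rewrite le_eqVlt; apply/orP; left; apply/eqP; congr `|_|; ring.
Qed.

End SecondDifference.

(** * Solutions of the Dirichlet problem near an end point of K *)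

Section DirichletSolutions.
Variable R : realType.
Implicit Types (u v h k F : R * R -> R) (y z w : R * R) (f g : R -> R).

Definition harmonic_at u y : Prop :=
  superharmonic_at u y /\ superharmonic_at (fun x => - u x) y.

(** Keeps what the comparisons use and what is stable under linear combinations; the values of [h]
    on K are left free. *)
Definition dirichlet_solution (K : set R) f h : Prop :=
  [/\ forall y, ~ embedR K y -> harmonic_at h y,
      exists M : R, forall y, ~ embedR K y -> `|h y| <= M &
      forall x, K x -> forall eps : R, 0 < eps ->
        \forall y \near (x, 0 : R), ~ embedR K y -> `|h y - f x| <= eps].

Lemma harmonic_atD u v y : harmonic_at u y -> harmonic_at v y ->
  harmonic_at (fun x => u x + v x) y.
Proof.
move=> [a b] [c d]; split; first exact: superharmonic_atD.
by under eq_fun do rewrite opprD; exact: superharmonic_atD.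
Qed.

Lemma harmonic_atN u y : harmonic_at u y -> harmonic_at (fun x => - u x) y.
Proof.
by move=> [a b]; split => //; under eq_fun do rewrite opprK.
Qed.

Lemma harmonic_atZ (c : R) u y : harmonic_at u y -> harmonic_at (fun x => c * u x) y.
Proof.
have pos (d : R) v : 0 <= d -> harmonic_at v y -> harmonic_at (fun x => d * v x) y.
  move=> d0 [a b]; split; first exact: superharmonic_atZ.
  by under eq_fun do rewrite -mulrN; exact: superharmonic_atZ.
have [c0|c0] := leP 0 c; first exact: pos.
have -> : (fun x => c * u x) = (fun x => - ((- c) * u x)).
  by apply/funext => x; rewrite mulNr opprK.
by move=> hu; apply: harmonic_atN; apply: pos; rewrite // oppr_ge0 ltW.
Qed.

Lemma harmonic_at_continuous u y : harmonic_at u y -> {for y, continuous u}.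
Proof. by case=> -[]. Qed.

Lemma dirichlet_solutionZD (K : set R) (c : R) f g h k :
  dirichlet_solution K f h -> dirichlet_solution K g k ->
  dirichlet_solution K (fun x => f x + c * g x) (fun y => h y + c * k y).
Proof.
move=> [hh [M1 bh] lh] [hk [M2 bk] lk]; split.
- move=> y nKy; apply: harmonic_atD; first exact: hh.
  by apply: harmonic_atZ; exact: hk.
- exists (M1 + `|c| * M2) => y nKy; rewrite (le_trans (ler_normD _ _))//.
  by rewrite lerD ?bh// normrM ler_wpM2l// bk.
- move=> x Kx eps e0; have e1 : 0 < eps / 2 by rewrite divr_gt0.
  have e2 : 0 < eps / 2 / (`|c| + 1) by rewrite divr_gt0// ltr_wpDl.
  apply: filterS2 (lh _ Kx _ e1) (lk _ Kx _ e2) => y ha ka nKy.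
  have {ha} a1 := ha nKy; have {ka} a2 := ka nKy.
  have -> : h y + c * k y - (f x + c * g x) = (h y - f x) + c * (k y - g x) by ring.
  rewrite (le_trans (ler_normD _ _))// normrM.
  have : `|c| * `|k y - g x| <= (`|c| + 1) * (eps / 2 / (`|c| + 1)).
    by apply: ler_pM => //; rewrite lerDl.
  by rewrite [leRHS]mulrC divfK ?gt_eqF ?ltr_wpDl//; lra.
Qed.

Lemma closed_embedR (K : set R) : compact K -> closed (embedR K).
Proof.
move=> cK; have -> : embedR K = K `*` [set 0].
  by apply/seteqP; split => -[a b] /= [].
by apply: compact_closed; [exact: norm_hausdorff|apply: compact_setX => //; exact: compact_set1].
Qed.

Lemma open_compl_embedR (K : set R) : compact K -> open (~` embedR K).
Proof. by move=> cK; apply: closed_openC; exact: closed_embedR. Qed.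

(** The difference of the solutions is bounded, so no condition at infinity is needed; a point of K
    serves as the pole in the minimum principle. This is also the source of uniqueness. *)
Lemma dirichlet_solution_le (K : set R) f g h k : compact K -> K !=set0 ->
  dirichlet_solution K f h -> dirichlet_solution K g k ->
  (forall x, K x -> f x <= g x) ->
  forall y, ~ embedR K y -> h y <= k y.
Proof.
move=> cK [x0 Kx0] sf sg fg y nKy.
have [hd [M bd] ld] := dirichlet_solutionZD (-1) sg sf.
suff : 0 <= k y + -1 * h y by lra.
apply: (@min_principle R (~` embedR K) (fun y => k y + -1 * h y) 0 (- M) (x0, 0)) => //.
- exact: open_compl_embedR.
- by apply.
- by move=> w /hd[].
- move=> w /contrapT Kw eps e0; case: w Kw => a b [/= Ka ->].
  apply: filterS (ld _ Ka _ e0) => w hw nKw.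
  by have := hw nKw; rewrite ler_norml => /andP[+ _]; have := fg _ Ka; lra.
- by exists 0 => w nKw _; have := bd _ nKw; rewrite ler_norml => /andP[].
Qed.

Lemma dirichlet_solution_near_le (K : set R) f h x (c : R) :
  dirichlet_solution K f h -> K x -> f x < c ->
  \forall y \near (x, 0 : R), ~ embedR K y -> h y < c.
Proof.
move=> [_ _ lh] Kx fc; have e0 : 0 < (c - f x) / 2 by rewrite divr_gt0// subr_gt0.
apply: filterS (lh _ Kx _ e0) => y hy nKy.
by have := hy nKy; rewrite ler_norml => /andP[_]; lra.
Qed.

Lemma dirichlet_solutionN (K : set R) f h :
  dirichlet_solution K f h ->
  dirichlet_solution K (fun x => - f x) (fun y => - h y).
Proof.
move=> sf; have := dirichlet_solutionZD (-2) sf sf.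
by congr (dirichlet_solution K _ _); apply/funext => x; ring.
Qed.

Lemma dirichlet_solution_near_ge (K : set R) f h x (c : R) :
  dirichlet_solution K f h -> K x -> c < f x ->
  \forall y \near (x, 0 : R), ~ embedR K y -> c < h y.
Proof.
move=> /dirichlet_solutionN sf Kx fc.
have := @dirichlet_solution_near_le K _ _ x (- c) sf Kx; rewrite ltrN2 => /(_ fc).
by apply: filterS => y hy /hy; rewrite ltrN2.
Qed.

Lemma regular_dirichlet_solution (K : set R) f :
  compact K -> dirichlet_regular K -> continuous f ->
  exists h, dirichlet_solution K f h.
Proof.
move=> cK regK cf; have [h [hh bh lh]] := regK f (continuous_subspaceT cf).
exists h; split => //.
- by move=> y nKy; exact: (harmonic_superharmonic hh).
- move=> x Kx eps e0; have := lh _ Kx; move/cvgrPdist_le => /(_ _ e0).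
  by rewrite near_withinE; apply: filterS => y hy /hy; rewrite distrC.
Qed.

Lemma near_dist2 y (P : R * R -> Prop) : (\forall x \near y, P x) ->
  exists2 r : R, 0 < r & forall x, dist2 x y < r -> P x.
Proof.
move=> /nbhs_box[r r0 hr]; exists (r ^+ 2); first by rewrite exprn_gt0.
move=> x; rewrite /dist2 => h.
have a0 := sqr_ge0 (x.1 - y.1); have b0 := sqr_ge0 (x.2 - y.2).
by apply: hr; rewrite ltr_norml; apply/andP; split; nra.
Qed.

Lemma dist2_near y (P : R * R -> Prop) (r : R) : 0 < r ->
  (forall x, dist2 x y < r -> P x) -> \forall x \near y, P x.
Proof.
move=> r0 h.
have cd : (fun x : R * R => dist2 x y) @ y --> dist2 y y by exact: continuous_dist2.
apply: (filterS h).
by apply: (cvgr_lt _ cd); rewrite /dist2 !subrr expr0n/= addr0.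
Qed.

Lemma dist2_triangle y z w : dist2 y w <= 2 * dist2 y z + 2 * dist2 z w.
Proof.
rewrite /dist2 -subr_ge0.
set X := (X in 0 <= X).
have -> : X = ((y.1 - z.1) - (z.1 - w.1)) ^+ 2 + ((y.2 - z.2) - (z.2 - w.2)) ^+ 2.
  by rewrite /X; ring.
by rewrite addr_ge0 ?sqr_ge0.
Qed.

Lemma logdist2_diff y z w (m D : R) : 0 < m -> y != z -> m <= dist2 y w ->
  dist2 z w <= D -> logdist2 z y - logdist2 w y <= ln (2 + 2 * D / m).
Proof.
move=> m0 yz myw zwD; have y0 := dist2_gt0 yz.
have w0 : 0 < dist2 y w by exact: lt_le_trans myw.
have D0 : 0 <= D by apply: le_trans zwD; exact: dist2_ge0.
have c0 : 0 <= 2 * D / m by rewrite divr_ge0 ?mulr_ge0 ?(ltW m0).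
rewrite lerBlDl -lnM ?posrE//; last by lra.
rewrite ler_ln ?posrE ?mulr_gt0//; last by lra.
have := dist2_triangle y w z; rewrite (dist2C w z) => t.
have : 2 * D <= dist2 y w * (2 * D / m).
  have -> : dist2 y w * (2 * D / m) = 2 * D * (dist2 y w / m) by ring.
  rewrite -[leLHS]mulr1 ler_wpM2l ?mulr_ge0//.
  by rewrite ler_pdivlMr// mul1r.
rewrite mulrDr; lra.
Qed.

(** Compactness of [K0] makes the radius independent of the boundary point. *)
Lemma dirichlet_solution_uniform_ge (K K0 : set R) f h (c : R) :
  dirichlet_solution K f h -> K0 `<=` K -> compact K0 ->
  (forall x, K0 x -> c < f x) ->
  exists2 r : R, 0 < r & forall x y, K0 x -> ~ embedR K y ->
    dist2 y (x, 0) < r -> c < h y.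
Proof.
move=> sf K0K cK0 cf.
pose P (r x : R) := forall y, ~ embedR K y -> dist2 y (x, 0) < r -> c < h y.
have H : \forall r \near (0 : R)^'+, K0 `<=` P r.
  apply: (iffLR (compact_near_coveringP K0) cK0) => x K0x.
  have [rho rho0 hr] := near_dist2 (dirichlet_solution_near_ge sf (K0K _ K0x) (cf _ K0x)).
  have rho4 : 0 < rho / 4 by rewrite divr_gt0.
  have near1 : \forall x' \near x, (x' - x) ^+ 2 < rho / 4.
    have cs : (fun x' : R => (x' - x) ^+ 2) @ x --> (x - x) ^+ 2.
      rewrite expr2; under eq_fun do rewrite expr2.
      by apply: cvgM; (apply: cvgB; [exact: cvg_id|exact: cvg_cst]).
    by apply: (cvgr_lt _ cs); rewrite subrr expr0n.
  exists ([set x' | (x' - x) ^+ 2 < rho / 4], [set r | r < rho / 4]) => /=.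
    by split => //; exact: nbhs_right_lt.
  move=> [x' r] [/= hx hrr] y nKy yr; apply: hr => //.
  have := dist2_triangle y (x', 0) (x, 0).
  have : dist2 (x', 0) (x, 0) < rho / 4 by rewrite /dist2/= subrr expr0n/= addr0.
  lra.
near (0 : R)^'+ => e; exists e; first by near: e; exact: nbhs_right_gt.
move=> x y K0x nKy.
have HP : K0 `<=` P e by near: e; exact: H.
exact: (HP x K0x y nKy).
Unshelve. all: by end_near. Qed.

End DirichletSolutions.

(** * Lower bounds for logarithmic boundary data, uniform in the pole *)

Section LowerBound.
Variable R : realType.
Implicit Types (u v h k F : R * R -> R) (y z w : R * R) (f g : R -> R).

(* The comparison function is [F1] where [h] is large and [F2] where [h] is small; on the overlap
   it is their minimum, and the two hypotheses on the levels make the pieces fit. *)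
Lemma superharmonic_at_glue h F1 F2 (s t : R) y : s < t ->
  {for y, continuous h} -> superharmonic_at F1 y -> superharmonic_at F2 y ->
  (h y = t -> F1 y < F2 y) -> (h y = s -> F2 y < F1 y) ->
  superharmonic_at (fun x => if t <= h x then F1 x else
     if h x <= s then F2 x else Num.min (F1 x) (F2 x)) y.
Proof.
move=> st ch s1 s2 E1 E2; have [c1 _] := s1; have [c2 _] := s2.
have ngt (c : R) : c < h y -> \forall x \near y, c < h x by exact: (cvgr_gt _ ch).
have nlt (c : R) : h y < c -> \forall x \near y, h x < c by exact: (cvgr_lt _ ch).
have [hyt|hyt|hyt] := ltgtP t (h y).
- apply: superharmonic_at_near s1; apply: filterS (ngt _ hyt) => x hx.
  by rewrite ltW.
- have [hys|hys|hys] := ltgtP (h y) s.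
  + apply: superharmonic_at_near s2; apply: filterS (nlt _ hys) => x hx.
    by rewrite leNgt (lt_trans hx st)/= ltW.
  + apply: superharmonic_at_near (superharmonic_at_min s1 s2).
    apply: filterS2 (ngt _ hys) (nlt _ hyt) => x h1 h2.
    by rewrite leNgt h2/= leNgt h1.
  + have F21 := E2 hys.
    have c21 : \forall x \near y, 0 < F1 x - F2 x.
      by apply: (cvgr_gt _ (cvgB c1 c2)); rewrite subr_gt0.
    apply: superharmonic_at_near s2; apply: filterS2 (nlt _ hyt) c21 => x h1.
    rewrite subr_gt0 => h2; rewrite leNgt h1/=.
    by case: ifP => // _; apply/esym/min_idPr; exact: ltW.
- have F12 := E1 (esym hyt).
  have c12 : \forall x \near y, 0 < F2 x - F1 x.
    by apply: (cvgr_gt _ (cvgB c2 c1)); rewrite subr_gt0.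
  have sy : s < h y by rewrite -hyt.
  apply: superharmonic_at_near s1; apply: filterS2 (ngt _ sy) c12 => x h1.
  rewrite subr_gt0 => h2; case: ifP => // _; rewrite leNgt h1/=.
  by apply/esym/min_idPl; exact: ltW.
Qed.

Definition logdist_solution (K : set R) z u :=
  dirichlet_solution K (fun x => logdist2 z (x, 0)) u.

(** The point is that [m] and [C] do not depend on [z]. The function
    [F1 = u - ln |y - z|^2 + ln |y - x1|^2] is bounded at infinity and tends to plus infinity at
    [z], but it has a bad pole at [x1]; [F2 = u + A * h + B] has no pole, but its boundary values
    are low near [z]. Since [h] is above -1/3 near [z] and below -2/3 near [x1], gluing along the
    levels of [h] uses each function only where it is bounded below. *)
Lemma solution_lower_bound (K K0 : set R) f h x1 :
  compact K -> K `<=` `[-1, 1] -> dirichlet_solution K f h ->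
  K x1 -> f x1 <= -1 ->
  compact K0 -> K0 `<=` K -> (forall x, K0 x -> 0 <= f x) ->
  exists m C : R, 0 < m /\ forall z, ~ embedR K z ->
    (exists2 x, K0 x & dist2 z (x, 0) <= m) ->
    forall u, logdist_solution K z u ->
    forall y, ~ embedR K y -> y != z ->
    (- (2 / 3) < h y -> logdist2 z y - logdist2 (x1, 0) y - C <= u y) /\
    (h y < - (1 / 3) -> - C <= u y).
Proof.
move=> cK K11 sf Kx1 fx1 cK0 K0K f0.
have fx1' : f x1 < - (2 / 3) by lra.
have [m1 m10 hm1] := near_dist2 (dirichlet_solution_near_le sf Kx1 fx1').
have f0' x : K0 x -> - (1 / 3) < f x by move=> /f0; lra.
have [r2 r20 hr2] := dirichlet_solution_uniform_ge sf K0K cK0 f0'.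
have [hh [Mh0 bh0] _] := sf.
pose Mh := `|Mh0|.
have bh y : ~ embedR K y -> - Mh <= h y <= Mh.
  by move=> nKy; rewrite -ler_norml (le_trans (bh0 _ nKy))// ler_norm.
have Mh0' : 0 <= Mh by exact: normr_ge0.
pose m := Num.min m1 (Num.min (r2 / 4) 1).
have m0 : 0 < m by rewrite !lt_min m10 ltr01 andbT divr_gt0.
have mm1 : m <= m1 by rewrite ge_min lexx.
have mr2 : m <= r2 / 4 by rewrite !ge_min lexx orbT.
have m11 : m <= 1 by rewrite !ge_min lexx !orbT.
(* 10 = 2 * 1 + 2 * 4 bounds the squared distance from [z] to [x1], via a point of [K0] at squared
   distance at most 1 from [z]. Hence [L] bounds the difference of the two logarithms, in both
   directions, where -2/3 <= h <= -1/3. *)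
pose L := ln (2 + 2 * 10 / m).
have L0 : 0 <= L by rewrite ln_ge0//; have : 0 <= 2 * 10 / m :> R; [rewrite divr_ge0// ltW|lra].
(* [A * h + B] equals [- (L + 1)] at h = -2/3 and [L + 1] at h = -1/3, which beats [L] on both
   levels as gluing requires. *)
pose A := 6 * (L + 1); pose B := A / 2.
have A0 : 0 <= A by rewrite mulr_ge0// addr_ge0.
have lm0 : ln m <= 0 by rewrite ln_le0.
pose C := - ln m + A * Mh.
have AM0 : 0 <= A * Mh by exact: mulr_ge0.
exists m, (C + A * Mh + B); split => // z nKz [x0 K0x0 zx0] u su y0 nKy0 y0z.
have [hu [Mu bu] lu] := su.
have z10 : dist2 z (x1, 0) <= 10.
  have := dist2_triangle z (x0, 0) (x1, 0).
  have : dist2 (x0, 0) (x1, 0) <= 4.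
    rewrite /dist2/= subrr expr0n/= addr0.
    have := K11 _ (K0K _ K0x0); have := K11 _ Kx1; rewrite /= !in_itv/= => /andP[? ?] /andP[? ?].
    by rewrite -subr_ge0 (_ : 4 - _ = (2 - (x0 - x1)) * (2 + (x0 - x1))); [apply: mulr_ge0; lra|ring].
  lra.
have hx1 y : ~ embedR K y -> - (2 / 3) <= h y -> m <= dist2 y (x1, 0).
  move=> nKy hy; rewrite leNgt; apply/negP => ym.
  have := hm1 _ (lt_le_trans ym mm1) nKy; lra.
have hz y : ~ embedR K y -> h y <= - (1 / 3) -> m <= dist2 y z.
  move=> nKy hy; rewrite leNgt; apply/negP => ym.
  have : dist2 y (x0, 0) < r2 by have := dist2_triangle y z (x0, 0); lra.
  move=> /(hr2 _ _ K0x0 nKy); lra.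
pose lz := logdist2 z; pose l1 := logdist2 (x1, 0).
have yx1 y : ~ embedR K y -> y != (x1, 0).
  by move=> nKy; apply/eqP => yx; apply: nKy; rewrite yx.
have up y : ~ embedR K y -> y != z -> - (2 / 3) <= h y -> lz y - l1 y <= L.
  by move=> nKy yz hy; apply: logdist2_diff => //; exact: hx1.
have dn y : ~ embedR K y -> y != z -> h y <= - (1 / 3) -> l1 y - lz y <= L.
  move=> nKy yz hy; apply: logdist2_diff => //; first exact: yx1.
  - exact: hz.
  - by rewrite dist2C.
pose F1 y := u y - lz y + l1 y.
pose F2 y := u y + A * h y + B.
pose F y := if - (1 / 3) <= h y then F1 y else
   if h y <= - (2 / 3) then F2 y else Num.min (F1 y) (F2 y).
pose U : set (R * R) := ~` embedR K `&` ~` [set z].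
have oU : open U.
  apply: openI; first exact: open_compl_embedR.
  by apply: closed_openC; apply: compact_closed; [exact: norm_hausdorff|exact: compact_set1].
have F1E (c : R) y : (- (2 / 3) < h y -> c <= F1 y) ->
    (h y < - (1 / 3) -> c <= F2 y) -> c <= F y.
  move=> a1 a2; rewrite /F.
  case: (leP (- (1 / 3)) (h y)) => h1; first by apply: a1; lra.
  case: (leP (h y) (- (2 / 3))) => h2; first exact: a2.
  by rewrite le_min a1// a2.
have main y : U y -> - C <= F y.
  apply: (@min_principle R U F (- C) (Num.min (- Mu - L) (- Mu - A * Mh + B)) (x1, 0)) => //.
  - by case=> + _; apply.
  - move=> {}y [nKy /= /eqP yz].
    have sz : superharmonic_at (fun x => - lz x) y by exact: superharmonic_Nlogdist2.
    have s1 : superharmonic_at l1 y by exact/superharmonic_logdist2/yx1.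
    have [shu _] := hu _ nKy; have hhy := hh _ nKy; have [shh _] := hhy.
    have sF1 : superharmonic_at F1 y.
      by apply: superharmonic_atD => //; exact: superharmonic_atD.
    have sF2 : superharmonic_at F2 y.
      apply: superharmonic_atD; last exact: superharmonic_at_cst.
      by apply: superharmonic_atD => //; exact: superharmonic_atZ.
    apply: superharmonic_at_glue => //; first by lra.
    + exact: harmonic_at_continuous.
    + move=> hy; rewrite /F1 /F2 hy.
      by have := dn _ nKy yz; rewrite hy => /(_ (lexx _)); rewrite /B /A; lra.
    + move=> hy; rewrite /F1 /F2 hy.
      by have := up _ nKy yz; rewrite hy => /(_ (lexx _)); rewrite /B /A; lra.
  - move=> w nUw eps eps0.
    have [Kw|nKw] := pselect (embedR K w).
      case: w Kw nUw => x b [/= Kx ->] _.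
      have xz : (x, 0) != z by apply/eqP => xz; apply: nKz; rewrite -xz.
      have e2 : 0 < eps / 2 by rewrite divr_gt0.
      have cz : \forall y \near (x, 0 : R), `|lz (x, 0) - lz y| <= eps / 2.
        have := @continuous_logdist2 R z (x, 0) xz.
        by move/cvgrPdist_le => /(_ _ e2).
      apply: filterS2 (lu _ Kx _ e2) cz => {}y a1 a2 [nKy /= /eqP yz].
      have {}a1 := a1 nKy; rewrite ler_norml in a1; rewrite ler_norml in a2.
      case/andP: a1 => a1 _; case/andP: a2 => a2 _.
      have uz : - eps <= u y - lz y by rewrite /lz in a2 *; lra.
      apply: F1E => hy.
        have : ln m <= l1 y.
          by rewrite ler_ln ?posrE ?dist2_gt0 ?yx1// hx1// ltW.
        by rewrite /F1 /C; lra.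
      have : ln m <= lz y by rewrite ler_ln ?posrE ?dist2_gt0// hz// ltW.
      have := bh _ nKy => /andP[bhy _]; have := ler_wpM2l A0 bhy.
      by rewrite /F2 /C /B; lra.
    have wz : w = z by apply: contrapT => nwz; apply: nUw.
    rewrite wz.
    pose T := expR (- Mu + ln m + C).
    have n1 : \forall y \near z, dist2 y z < Num.min T m.
      apply: (@dist2_near R z _ (Num.min T m)) => //.
      by rewrite lt_min m0 expR_gt0.
    apply: filterS n1 => {}y; rewrite lt_min => /andP[yT ym] [nKy /= /eqP yz].
    have h3 : - (1 / 3) < h y.
      by rewrite ltNge; apply/negP => /(hz _ nKy); rewrite leNgt ym.
    apply: F1E => hy; last by move: hy; rewrite ltNge (ltW h3).
    have : ln m <= l1 y by rewrite ler_ln ?posrE ?dist2_gt0 ?yx1// hx1// ltW.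
    have : lz y <= - Mu + ln m + C.
      rewrite -[leRHS]expRK ler_ln ?posrE ?expR_gt0 ?dist2_gt0//.
      exact: ltW.
    have := bu _ nKy; rewrite ler_norml => /andP[+ _].
    by rewrite /F1; lra.
  - exists 0 => {}y [nKy /= /eqP yz] _.
    have := bu _ nKy; rewrite ler_norml => /andP[ub _].
    apply: F1E => hy; rewrite ge_min; apply/orP; [left|right].
      by rewrite /F1; have := up _ nKy yz (ltW hy); lra.
    have := bh _ nKy => /andP[bhy _]; have := ler_wpM2l A0 bhy.
    by rewrite /F2; lra.
have Uy0 : U y0 by split => //; apply/eqP.
have := main _ Uy0; have := bh _ nKy0 => /andP[_ bhy]; have := ler_wpM2l A0 bhy => ab.
have B0 : 0 <= B by rewrite divr_ge0.
move=> Fy0; split => hy.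
  suff : - C <= F1 y0 by rewrite /F1 -/lz -/l1; lra.
  move: Fy0; rewrite /F; case: ifP => // _.
  by rewrite [h y0 <= _]leNgt hy/= le_min => /andP[].
suff : - C <= F2 y0 by rewrite /F2; lra.
move: Fy0; rewrite /F [_ <= h y0]leNgt hy/=; case: ifP => // _.
by rewrite le_min => /andP[].
Qed.

End LowerBound.

(** * A barrier at an end point *)

Section Barrier.
Variable R : realType.
Implicit Types (u v h k F : R * R -> R) (y z w : R * R) (f g : R -> R).

Lemma ln_sqr_endpoint (e x : R) : e ^+ 2 = 1 -> 3 / 4 <= e * x <= 1 ->
  - 2 * (1 - e * x) <= ln ((x + e) ^+ 2) - ln 4.
Proof.
move=> e1 /andP[x0 x1].
have E : (x + e) ^+ 2 = (2 * (1 + (e * x - 1) / 2)) ^+ 2.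
  have -> : 2 * (1 + (e * x - 1) / 2) = 1 + e * x by field.
  have -> : (1 + e * x) ^+ 2 = 1 + 2 * e * x + e ^+ 2 * x ^+ 2 by ring.
  have -> : (x + e) ^+ 2 = x ^+ 2 + 2 * e * x + e ^+ 2 by ring.
  by rewrite e1; ring.
rewrite E lnXn; last by rewrite mulr_gt0//; lra.
rewrite lnM ?posrE//; last by lra.
have -> : (4 : R) = 2 ^+ 2 by ring.
rewrite lnXn// !mulr2n.
have /abs_ln1D : `|(e * x - 1) / 2| <= 1 / 2 by rewrite ler_norml; lra.
rewrite ler_norml => /andP[+ _]; rewrite ler0_norm; last by lra.
lra.
Qed.

(* For [a] outside [-1, 1] close to [e] both error terms are small, so the solution with boundary
   values [ln |x - z|^2] is at [a] nearly at least [ln |a - z|^2], uniformly for [z] close to [K]. *)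
Lemma endpoint_barrier (K : set R) (e : R) :
  compact K -> K `<=` `[-1, 1] -> dirichlet_regular K ->
  e ^+ 2 = 1 -> K e -> K (- e) ->
  exists h m A, [/\ dirichlet_solution K (fun x => e * x) h, 0 < m, 0 <= A &
    forall z, ~ embedR K z -> (exists2 x, K x & dist2 z (x, 0) <= m) ->
    forall u, logdist_solution K z u ->
    forall a, ~ embedR K a -> a != z -> 3 / 4 < h a ->
    logdist2 z a - (logdist2 (- e, 0) a - ln 4) - A * (1 - h a) <= u a].
Proof.
move=> cK K11 regK e1 Ke KNe.
have cf : continuous (fun x : R => e * x) by exact: mulrl_continuous.
have [h sh] := regular_dirichlet_solution cK regK cf.
have exK x : K x -> - 1 <= e * x <= 1.
  move=> /K11; rewrite /= in_itv/= => /andP[x1 x2].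
  have : e = 1 \/ e = -1.
    move/eqP: e1; rewrite sqrf_eq1 => /orP[/eqP|/eqP]; [by left|by right].
  by case=> ->; lra.
have cpt (s : R) : compact (K `&` [set x | 0 <= s * x]).
  apply: (subclosed_compact _ cK); last by move=> x [].
  apply: closedI; first exact: compact_closed.
  have -> : [set x | 0 <= s * x] = (fun x => s * x) @^-1` [set x | 0 <= x] by [].
  by apply: closed_comp => [x _|]; [exact: mulrl_continuous|exact: closed_ge].
(* A point near K is near one of its two halves. The half with e x >= 0 is treated with [h] and the
   pole at [- e], the other one with [- h] and the pole at [e]. *)
have [m1 [C1 [m10 lb1]]] : exists m C : R, 0 < m /\ forall z, ~ embedR K z ->
    (exists2 x, (K `&` [set x | 0 <= e * x]) x & dist2 z (x, 0) <= m) ->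
    forall u, logdist_solution K z u -> forall y, ~ embedR K y -> y != z ->
    (- (2 / 3) < h y -> logdist2 z y - logdist2 (- e, 0) y - C <= u y) /\
    (h y < - (1 / 3) -> - C <= u y).
  apply: (@solution_lower_bound R K _ (fun x => e * x) h (- e)) => //.
  - by rewrite mulrN -expr2 e1.
  - by move=> x [].
have [m2 [C2 [m20 lb2]]] : exists m C : R, 0 < m /\ forall z, ~ embedR K z ->
    (exists2 x, (K `&` [set x | 0 <= (- e) * x]) x & dist2 z (x, 0) <= m) ->
    forall u, logdist_solution K z u -> forall y, ~ embedR K y -> y != z ->
    (- (2 / 3) < - h y -> logdist2 z y - logdist2 (e, 0) y - C <= u y) /\
    (- h y < - (1 / 3) -> - C <= u y).
  apply: (@solution_lower_bound R K _ (fun x => - (e * x)) (fun y => - h y) e) => //.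
  - exact: dirichlet_solutionN.
  - by rewrite -expr2 e1.
  - by move=> x [_ /=]; rewrite mulNr.
have ee : e * - e < 0 by rewrite mulrN -expr2 e1 oppr_lt0.
(* Near [- e] the solution is negative, so points with h > 0 stay at squared distance at least [m3]
   from [- e]. *)
have [m3 m30 hm3] := near_dist2 (dirichlet_solution_near_le sh KNe ee).
have [hh [Mh bh] lh] := sh.
pose m := Num.min m1 (Num.min m2 1).
have m0 : 0 < m by rewrite !lt_min m10 m20 ltr01.
have mm1 : m <= m1 by rewrite ge_min lexx.
have mm2 : m <= m2 by rewrite !ge_min lexx orbT.
have m1_1 : m <= 1 by rewrite !ge_min lexx !orbT.
pose L := ln (2 + 2 * 10 / m3).
have L0 : 0 <= L by rewrite ln_ge0//; have : 0 <= 2 * 10 / m3 :> R; [rewrite divr_ge0// ltW|lra].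
pose C := `|C1| + `|C2| + L.
have C0 : 0 <= C by rewrite !addr_ge0.
have ln4 : 0 <= ln 4 :> R by rewrite ln_ge0// ler1n.
(* On the level h = 3/4 the term A (1 - h) is at least [C + ln 4], which absorbs the crude bound
   [lb]; the summand 2 absorbs the loss 2 (1 - e x) of [ln_sqr_endpoint] on K. *)
pose A := 4 * (C + ln 4) + 2.
have A0 : 0 <= A by rewrite addr_ge0// mulr_ge0// addr_ge0.
exists h, m, A; split => // z nKz [x0 Kx0 zx0] u su a nKa az ha.
have [hu [Mu bu] lu] := su.
have z10 : dist2 z (- e, 0) <= 10.
  have := dist2_triangle z (x0, 0) (- e, 0).
  have : dist2 (x0, 0) (- e, 0) <= 4.
    rewrite /dist2/= subrr expr0n/= addr0 opprK.
    have := exK _ Kx0; have := K11 _ Kx0; rewrite /= in_itv/= => /andP[? ?] /andP[? ?].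
    have -> : (x0 + e) ^+ 2 = x0 ^+ 2 + 2 * (e * x0) + e ^+ 2 by ring.
    rewrite e1; nra.
  lra.
have far y : ~ embedR K y -> 0 < h y -> m3 <= dist2 y (- e, 0).
  move=> nKy hy; rewrite leNgt; apply/negP => /hm3 /(_ nKy).
  by rewrite ltNge (ltW hy).
have up y : ~ embedR K y -> y != z -> 0 < h y ->
    logdist2 z y - logdist2 (- e, 0) y <= L.
  by move=> nKy yz hy; apply: logdist2_diff => //; exact: far.
have lb y : ~ embedR K y -> y != z -> 2 / 3 < h y ->
    logdist2 z y - logdist2 (- e, 0) y - C <= u y.
  move=> nKy yz hy.
  have n1 := ler_norm C1; have n2 := ler_norm C2.
  have n1' := normr_ge0 C1; have n2' := normr_ge0 C2.
  have [ex|ex] := leP 0 (e * x0).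
    have [|+ _] := lb1 z nKz _ u su y nKy yz.
      by exists x0 => //; exact: le_trans mm1.
    by rewrite /C => /(_ _) h1; have := h1; clear -hy n1 n2' L0; lra.
  have [|_ +] := lb2 z nKz _ u su y nKy yz.
    by exists x0; [split => //=; rewrite mulNr oppr_ge0 ltW|exact: le_trans mm2].
  have := up _ nKy yz; rewrite /C => h1 h2.
  have {}h1 : logdist2 z y - logdist2 (- e, 0) y <= L by apply: h1; clear -hy; lra.
  have {}h2 : - C2 <= u y by apply: h2; clear -hy; lra.
  clear -h1 h2 n2 n1'; lra.
(* The comparison is confined to the part of the domain where h > 3/4; points of K with e x < 3/4
   are not limits of it. *)
pose U : set (R * R) := [set y | [/\ ~ embedR K y, y != z & 3 / 4 < h y]].
have noK y : ~ embedR K y -> \forall x \near y, ~ embedR K x.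
  by move=> nKy; exact: (open_nbhs_nbhs (conj (open_compl_embedR cK) nKy)).
have noz y : y != z -> \forall x \near y, x != z.
  move=> yz; have y0 := dist2_gt0 yz.
  have cd : (fun x : R * R => dist2 x z) @ y --> dist2 y z by exact: continuous_dist2.
  apply: filterS (cvgr_gt _ cd _ y0) => x; apply: contraTneq => ->.
  by rewrite /dist2 !subrr expr0n/= addr0 ltxx.
have oU : open U.
  rewrite openE => y [nKy yz hy]; rewrite /interior.
  have := cvgr_gt _ (harmonic_at_continuous (hh _ nKy)) _ hy => hy'.
  by near=> x; split; near: x; [exact: noK|exact: noz|exact: hy'].
pose F y := u y + - logdist2 z y + (logdist2 (- e, 0) y + - ln 4) + A * (1 + - h y).
have yNe y : ~ embedR K y -> y != (- e, 0).
  by move=> nKy; apply/eqP => ye; apply: nKy; rewrite ye.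
suff : 0 <= F a by rewrite /F; lra.
have bhN y : ~ embedR K y -> h y <= Mh.
  by move=> /bh; rewrite ler_norml => /andP[].
apply: (@min_principle R U F 0 (- Mu - L - ln 4 - A * `|Mh|) (e, 0)) => //.
- by case=> + _ _; apply.
- move=> y [nKy yz hy]; have [a1 _] := hu _ nKy; have [_ a2] := hh _ nKy.
  apply: superharmonic_atD.
    apply: superharmonic_atD.
      by apply: superharmonic_atD => //; exact: superharmonic_Nlogdist2.
    apply: superharmonic_atD; last exact: superharmonic_at_cst.
    exact/superharmonic_logdist2/yNe.
  apply: superharmonic_atZ => //; apply: superharmonic_atD => //.
  exact: superharmonic_at_cst.
- move=> w nUw eps eps0.
  have eA : 0 < eps / 4 / (A + 1) by rewrite !divr_gt0// ltr_wpDl.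
  have eAle : A * (eps / 4 / (A + 1)) <= eps / 4.
    by rewrite mulrA ler_pdivrMr ?ltr_wpDl// mulrC; nra.
  have e4 : 0 < eps / 4 by rewrite divr_gt0.
  have [Kw|nKw] := pselect (embedR K w).
    case: w Kw nUw => x b [/= Kx ->] _.
    have [ex|ex] := ltP (e * x) (3 / 4).
      have := dirichlet_solution_near_le sh Kx ex.
      apply: filterS => y hy [nKy _ h34].
      by have := lt_trans h34 (hy nKy); rewrite ltxx.
    have xz : (x, 0) != z by apply/eqP => xz; apply: nKz; rewrite -xz.
    have xe : (x, 0) != (- e, 0) :> R * R.
      apply/eqP => -[xe]; move: ex; rewrite xe.
      by have := ee; lra.
    have cz : \forall y \near (x, 0 : R), `|logdist2 z (x, 0) - logdist2 z y| <= eps / 4.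
      by have := @continuous_logdist2 R z (x, 0) xz; move/cvgrPdist_le => /(_ _ e4).
    have ce : \forall y \near (x, 0 : R),
      `|logdist2 (- e, 0) (x, 0) - logdist2 (- e, 0) y| <= eps / 4.
      by have := @continuous_logdist2 R (- e, 0) (x, 0) xe; move/cvgrPdist_le => /(_ _ e4).
    near=> y => -[nKy yz hy].
    have a1 : ~ embedR K y -> `|u y - logdist2 z (x, 0)| <= eps / 4.
      by near: y; exact: (lu _ Kx _ e4).
    have a2 : `|logdist2 z (x, 0) - logdist2 z y| <= eps / 4 by near: y; exact: cz.
    have a3 : `|logdist2 (- e, 0) (x, 0) - logdist2 (- e, 0) y| <= eps / 4.
      by near: y; exact: ce.
    have a4 : ~ embedR K y -> `|h y - e * x| <= eps / 4 / (A + 1).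
      by near: y; exact: (lh _ Kx _ eA).
    have {}a1 := a1 nKy; have {}a4 := a4 nKy.
    rewrite !ler_norml in a1 a2 a3 a4.
    case/andP: a1 => a1 _; case/andP: a2 => a2 _; case/andP: a3 => _ a3.
    case/andP: a4 => _ a4; have := ler_wpM2l A0 a4 => {}a4.
    have := exK _ Kx => /andP[_ ex1].
    have : - 2 * (1 - e * x) <= logdist2 (- e, 0) (x, 0) - ln 4.
      rewrite /logdist2 /dist2/= subrr expr0n/= addr0 opprK.
      by apply: ln_sqr_endpoint => //; rewrite ex.
    have : 0 <= (A - 2) * (1 - e * x).
      by rewrite mulr_ge0 ?subr_ge0// /A lerDr mulr_ge0// addr_ge0.
    rewrite /F; move: a4; rewrite mulrBr !mulrDr mulrBl !mulrN !mulr1.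
    clear -a1 a2 a3 eAle eps0; lra.
  have [wz|wz] := eqVneq w z.
    rewrite wz.
    pose T := expR (- Mu + (ln m3 - ln 4) - A * `|Mh|).
    have n1 : \forall y \near z, dist2 y z < T.
      by apply: (@dist2_near R z _ T) => //; rewrite expR_gt0.
    apply: filterS n1 => y yT [nKy yz hy].
    have : ln m3 <= logdist2 (- e, 0) y.
      rewrite ler_ln ?posrE ?dist2_gt0 ?yNe//; apply: far => //.
      by apply: lt_trans hy.
    have : logdist2 z y <= - Mu + (ln m3 - ln 4) - A * `|Mh|.
      rewrite -[leRHS]expRK ler_ln ?posrE ?expR_gt0 ?dist2_gt0//.
      exact: ltW.
    have := bu _ nKy; rewrite ler_norml => /andP[+ _].
    have := ler_wpM2l A0 (le_trans (bhN _ nKy) (ler_norm _)).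
    by rewrite /F mulrDr mulrN mulr1; clear -A0 eps0; lra.
  have hw : h w <= 3 / 4 by rewrite leNgt; apply/negP => hw; exact: nUw.
  have chw := harmonic_at_continuous (hh _ nKw).
  have : \forall y \near w, `|h w - h y| <= eps / 4 / (A + 1).
    by move: chw => /cvgrPdist_le /(_ _ eA).
  apply: filterS => y a4 [nKy yz hy].
  rewrite ler_norml in a4; case/andP: a4 => a4 _.
  have := lb _ nKy yz; have h23 : 2 / 3 < h y by clear -hy; lra.
  move=> /(_ h23) l1.
  have : A * (1 / 4 - eps / 4 / (A + 1)) <= A * (1 + - h y).
    by rewrite ler_wpM2l//; clear -a4 hw; lra.
  rewrite /F mulrBr {1}/A; clear -l1 eAle C0 ln4 eps0; lra.
- exists 0 => y [nKy yz hy] _.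
  have hy0 : 0 < h y by apply: lt_trans hy.
  have := up _ nKy yz hy0; have := bu _ nKy; rewrite ler_norml => /andP[+ _].
  have := ler_wpM2l A0 (le_trans (bhN _ nKy) (ler_norm _)).
  by rewrite /F mulrDr mulrN mulr1; clear -A0; lra.
Unshelve. all: by end_near. Qed.

End Barrier.

(** * Positive functionals and measures *)

Section Ramp.
Variable R : realType.
Implicit Types (f g F : R -> R) (I : (R -> R) -> R).

Definition bounded_continuous f := continuous f /\ exists B : R, forall x, `|f x| <= B.

(** A continuous substitute for the indicator of a half line: 1 up to [p], 0 from [q] on, affine in
    between (for p < q). *)
Definition ramp (p q x : R) : R := Num.max 0 (Num.min 1 ((q - x) / (q - p))).

Lemma ramp_ge0 p q x : 0 <= ramp p q x.
Proof. by rewrite le_max lexx. Qed.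

Lemma ramp_le1 p q x : ramp p q x <= 1.
Proof. by rewrite ge_max ler01 ge_min lexx. Qed.

Lemma ramp1 p q x : p < q -> x <= p -> ramp p q x = 1.
Proof.
move=> pq xp; have qp : 0 < q - p by rewrite subr_gt0.
have : 1 <= (q - x) / (q - p) by rewrite ler_pdivlMr// mul1r lerB.
by rewrite /ramp => /min_idPl ->; apply/max_idPr.
Qed.

Lemma ramp0 p q x : p < q -> q <= x -> ramp p q x = 0.
Proof.
move=> pq qx; have qp : 0 < q - p by rewrite subr_gt0.
have h : (q - x) / (q - p) <= 0 by rewrite pmulr_lle0 ?invr_gt0// subr_le0.
by rewrite /ramp; apply/max_idPl; rewrite ge_min h orbT.
Qed.

Lemma ramp_continuous p q : continuous (ramp p q).
Proof.
move=> x; apply: (@continuous_max R R (fun=> 0) _ x); first exact: cvg_cst.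
apply: (@continuous_min R R (fun=> 1) _ x); first exact: cvg_cst.
apply: cvgM; last exact: cvg_cst.
by apply: cvgB; [exact: cvg_cst|exact: cvg_id].
Qed.

Lemma bounded_continuous_ramp p q : bounded_continuous (ramp p q).
Proof.
split; first exact: ramp_continuous.
by exists 1 => x; rewrite ger0_norm ?ramp_ge0 ?ramp_le1.
Qed.

Lemma bounded_continuousZD (c : R) f g : bounded_continuous f ->
  bounded_continuous g -> bounded_continuous (fun x => f x + c * g x).
Proof.
move=> [cf [B1 b1]] [cg [B2 b2]]; split.
  move=> x; apply: cvgD; first exact: cf.
  by apply: cvgM; [exact: cvg_cst|exact: cg].
exists (B1 + `|c| * B2) => x; rewrite (le_trans (ler_normD _ _))//.
by rewrite lerD// normrM ler_wpM2l.
Qed.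

Lemma bounded_continuous_cst (c : R) : bounded_continuous (fun=> c).
Proof. by split; [move=> x; exact: cvg_cst|exists `|c|]. Qed.

Definition positive_functional I : Prop :=
  [/\ forall f g (c : R), bounded_continuous f -> bounded_continuous g ->
        I (fun x => f x + c * g x) = I f + c * I g,
      forall f g, bounded_continuous f -> bounded_continuous g ->
        (forall x, -1 <= x <= 1 -> f x <= g x) -> I f <= I g &
      I (fun=> 1) = 1].

(** Sandwiching the ramps between values of [F] avoids any discussion of the jumps of [F]. *)
Definition has_cdf I F : Prop :=
  forall s p q, s < p -> p < q -> F s <= I (ramp p q) <= F q.

Lemma positive_functional_cst I (c : R) : positive_functional I -> I (fun=> c) = c.
Proof.
move=> [lin _ one].
have b1 := bounded_continuous_cst 1.
have i0 : I (fun x => 1 + -1 * 1) = 0 by rewrite (lin _ _ (-1) b1 b1) one; ring.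
have b0 := bounded_continuousZD (-1) b1 b1.
transitivity (I (fun x => 1 + -1 * 1 + c * 1)).
  by congr I; apply/funext => x; ring.
by rewrite (lin _ _ c b0 b1) i0 one add0r mulr1.
Qed.

(* Summation by parts: the interpolant of [f] at the nodes [t i] is a combination of ramps with
   coefficients at most [L * eta], and the errors on the individual ramps telescope. *)
Lemma positive_functional_eq I J F f (L : R) :
  positive_functional I -> positive_functional J ->
  {homo F : x y / x <= y} -> (forall x, 0 <= F x <= 1) ->
  has_cdf I F -> has_cdf J F ->
  bounded_continuous f -> (forall x y, `|f x - f y| <= L * `|x - y|) ->
  I f = J f.
Proof.
move=> pI pJ ndF F01 cI cJ bf Lf.
have [linI monoI oneI] := pI; have [linJ monoJ oneJ] := pJ.
have L0 : 0 <= L.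
  by have := Lf 1 0; rewrite subr0 normr1 mulr1; apply: le_trans.
suff key (N : nat) : `|I f - J f| <= (4 * L) * (4 / N.+1%:R).
  apply/eqP; rewrite -subr_eq0 -normr_le0; apply/ler_addgt0Pr => e e0; rewrite add0r.
  have [N hN] : exists N : nat, 16 * L / e < N%:R.
    by exists (Num.truncn (16 * L / e)).+1; exact: truncnS_gt.
  apply: (le_trans (key N)).
  have N1 : 0 < N.+1%:R :> R by [].
  rewrite mulrA ler_pdivrMr// -ler_pdivrMl// mulrC.
  have -> : 4 * L * 4 / e = 16 * L / e by ring.
  by rewrite (le_trans (ltW hN))// ler_nat.
(* The mesh of [N.+1] equal intervals covering [-2, 2]. *)
pose eta : R := 4 / N.+1%:R.
have eta0 : 0 < eta by rewrite divr_gt0.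
pose t (i : nat) : R := - 2 + i%:R * eta.
have tS i : t i.+1 = t i + eta by rewrite /t -natr1; ring.
have tN : t N.+1 = 2.
  by rewrite /t /eta; field; rewrite addrC natr1.
have t0E : t 0%N = - 2 by rewrite /t mul0r addr0.
have tlt i : t i < t i.+1 by rewrite tS ltrDl.
have tle i : t 0%N <= t i by rewrite /t lerD2l mul0r mulr_ge0// ltW.
clearbody t.
pose g (n : nat) x : R := f (t 0%N) + \sum_(i < n) (f (t i.+1) - f (t i)) * (1 - ramp (t i) (t i.+1) x).
have gS n x : g n.+1 x = g n x + (f (t n.+1) - f (t n)) * (1 - ramp (t n) (t n.+1) x).
  by rewrite /g big_ord_recr/= addrA.
have g0 : g 0%N = (fun=> f (t 0%N)) by apply/funext => x; rewrite /g big_ord0 addr0.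
clearbody g.
have right n : forall x, t n <= x -> g n x = f (t n).
  elim: n => [x _|n ih x tx]; first by rewrite g0.
  have tx' : t n <= x by apply: le_trans tx; apply: ltW.
  rewrite gS (ih _ tx') (ramp0 (tlt n) tx).
  by rewrite subr0 mulr1 addrC subrK.
have close n : forall x, t 0%N <= x -> x <= t n -> `|f x - g n x| <= L * eta.
  elim: n => [x x1 x2|n ih x x1 x2].
    have -> : x = t 0%N by apply/eqP; rewrite eq_le x1 x2.
    by rewrite right// subrr normr0 mulr_ge0// ltW.
  have [xn|xn] := leP x (t n).
    by rewrite gS (ramp1 (tlt n) xn) subrr mulr0 addr0 ih.
  rewrite gS (right _ _ (ltW xn)).
  move: (ramp_ge0 (t n) (t n.+1) x) (ramp_le1 (t n) (t n.+1) x).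
  move: (ramp _ _ _) => r r0 r1.
  have -> : f x - (f (t n) + (f (t n.+1) - f (t n)) * (1 - r)) =
    r * (f x - f (t n)) + (1 - r) * (f x - f (t n.+1)) by ring.
  have b1 : `|f x - f (t n)| <= L * eta.
    by apply: (le_trans (Lf _ _)); rewrite ler_wpM2l// gtr0_norm ?subr_gt0//; rewrite tS in x2; lra.
  have b2 : `|f x - f (t n.+1)| <= L * eta.
    apply: (le_trans (Lf _ _)); rewrite ler_wpM2l// ler0_norm ?subr_le0//.
    by rewrite tS in x2 *; lra.
  apply: (le_trans (ler_normD _ _)); rewrite !normrM (ger0_norm r0).
  rewrite (ger0_norm (_ : 0 <= 1 - r)) ?subr_ge0//.
  have := ler_wpM2l r0 b1.
  have r1' : 0 <= 1 - r by rewrite subr_ge0.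
  have := ler_wpM2l r1' b2; lra.
have b1 := bounded_continuous_cst 1.
have bR n : bounded_continuous (fun x => 1 + -1 * ramp (t n) (t n.+1) x).
  by apply: bounded_continuousZD => //; exact: bounded_continuous_ramp.
have gSE n : g n.+1 = (fun x => g n x + (f (t n.+1) - f (t n)) * (1 + -1 * ramp (t n) (t n.+1) x)).
  by apply/funext => x; rewrite gS mulN1r.
have bg n : bounded_continuous (g n).
  elim: n => [|n ih]; last by rewrite gSE; exact: bounded_continuousZD.
  rewrite g0; exact: bounded_continuous_cst.
(* One ramp contributes at most F(t (n + 1)) - F(t n - eta), a difference over two meshes; this is
   why the telescoped bound carries two values of [F]. *)
have dg n : `|I (g n) - J (g n)| <= L * eta * (F (t n) + F (t n - eta)).
  elim: n => [|n ih].
    rewrite g0 !positive_functional_cst// subrr normr0 mulr_ge0//.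
      by rewrite mulr_ge0// ltW.
    by rewrite addr_ge0//; [case/andP: (F01 (t 0%N))|case/andP: (F01 (t 0%N - eta))].
  have bn := bounded_continuous_ramp (t n) (t n.+1).
  rewrite gSE linI// linJ// !(linI (fun=> 1)) ?linI// !(linJ (fun=> 1)) ?linJ//.
  rewrite oneI oneJ.
  set c := f _ - f _.
  set a := I (ramp _ _); set b := J (ramp _ _).
  have -> : I (g n) + c * (1 + -1 * a) - (J (g n) + c * (1 + -1 * b)) =
    (I (g n) - J (g n)) + c * (b - a) by ring.
  have cL : `|c| <= L * eta.
    rewrite /c; apply: (le_trans (Lf _ _)).
    by rewrite ler_wpM2l// tS addrAC subrr add0r gtr0_norm.
  have tn : t n - eta < t n by rewrite ltrBlDr ltrDl.
  have /andP[a1 a2] := cI _ _ _ tn (tlt n).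
  have /andP[b1' b2] := cJ _ _ _ tn (tlt n).
  have ba : `|b - a| <= F (t n.+1) - F (t n - eta).
    by rewrite ler_norml /a /b; lra.
  apply: (le_trans (ler_normD _ _)); rewrite normrM.
  have : `|c| * `|b - a| <= L * eta * (F (t n.+1) - F (t n - eta)) by exact: ler_pM.
  have -> : t n.+1 - eta = t n by rewrite tS addrK.
  lra.
have cl x : -1 <= x <= 1 -> `|f x - g N.+1 x| <= L * eta.
  by move=> /andP[x1 x2]; apply: close; rewrite ?tN ?t0E; lra.
have close_fun H : positive_functional H -> `|H f - H (g N.+1)| <= L * eta.
  move=> pH; have [linH monoH _] := pH.
  have := positive_functional_cst (L * eta) pH => hc.
  have hc' := positive_functional_cst (- (L * eta)) pH.
  have bd : bounded_continuous (fun x => f x + -1 * g N.+1 x) by exact: bounded_continuousZD.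
  have lin := linH _ _ (-1) bf (bg N.+1).
  have -> : H f - H (g N.+1) = H (fun x => f x + -1 * g N.+1 x) by rewrite lin mulN1r.
  rewrite ler_norml -{1}hc' -hc; apply/andP; split.
    apply: monoH => //; first exact: bounded_continuous_cst.
    by move=> x /cl; rewrite ler_norml => /andP[]; lra.
  apply: monoH => //; first exact: bounded_continuous_cst.
  by move=> x /cl; rewrite ler_norml => /andP[]; lra.
have := dg N.+1; rewrite tN.
have : L * eta * (F 2 + F (2 - eta)) <= L * eta * 2.
  rewrite ler_wpM2l//; first by rewrite mulr_ge0// ltW.
  by have := F01 2; have := F01 (2 - eta); lra.
move=> h1 h2; have := close_fun _ pI; have := close_fun _ pJ.
rewrite !ler_norml -/eta in h1 h2 *; lra.
Qed.

End Ramp.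

(** * From positive functionals to measures *)

Section LocallyNull.
Variable R : realType.

(** A Lindelöf argument: the null intervals with rational end points are countably many and cover
    [A]. *)
Lemma locally_null (mu : {measure set R -> \bar R}) (A : set R) : open A ->
  (forall x, A x -> exists2 e : R, 0 < e & mu (ball x e) = 0%E) -> mu A = 0%E.
Proof.
move=> oA null.
pose D (pq : rat * rat) := mu `]ratr pq.1, ratr pq.2[%classic = 0%E.
pose G (n : nat) : set R := if unpickle n is Some pq then
  if `[< D pq >] then `]ratr pq.1, ratr pq.2[%classic else set0 else set0.
have nG n : mu.-negligible (G n).
  rewrite /G; case: unpickle => [pq|]; last exact: negligible_set0.
  by case: asboolP => [Dpq|_]; [exact/negligibleP|exact: negligible_set0].
apply: measure_negligible; first exact: open_measurable.
apply: negligibleS (negligible_bigcup nG) => x Ax.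
have [e e0 xe] := null _ Ax.
have [p] := @rat_in_itvoo R (x - e) x ltac:(lra).
rewrite in_itv/= => /andP[p1 p2].
have [q] := @rat_in_itvoo R x (x + e) ltac:(lra).
rewrite in_itv/= => /andP[q1 q2].
have Dpq : D (p, q); last first.
  exists (pickle (p, q)); first exact: I.
  by rewrite /G pickleK asboolT//= in_itv/= p2.
rewrite /D; apply/eqP; rewrite -measure_le0 -xe le_measure ?inE//.
  by apply: open_measurable; exact: ball_open.
move=> y; rewrite /= in_itv/= => /andP[y1 y2].
by rewrite /ball /= ltr_norml; apply/andP; split; lra.
Qed.

End LocallyNull.

Section Cdf.
Variable R : realType.
Variable Lam : (R -> R) -> R.
Hypothesis pLam : positive_functional Lam.

Let vals (t : R) : set R := [set y | exists p q, [/\ t < p, p < q & y = Lam (ramp p q)]].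

(** Ramps that start strictly to the right of [t] make the infimum right continuous, as a Stieltjes
    measure requires. *)
Definition cdf (t : R) : R := inf (vals t).

Let bR p q : bounded_continuous (@ramp R p q) := bounded_continuous_ramp p q.

Let Lam0 : Lam (fun=> 0) = 0. Proof. exact: positive_functional_cst. Qed.

Let ramp_mono (f g : R -> R) : bounded_continuous f -> bounded_continuous g ->
  (forall x, -1 <= x <= 1 -> f x <= g x) -> Lam f <= Lam g.
Proof. by have [_ + _] := pLam; apply. Qed.

Let vals_neq0 t : vals t !=set0.
Proof. by exists (Lam (ramp (t + 1) (t + 2))), (t + 1), (t + 2); split => //; lra. Qed.

Let vals_ge0 t : lbound (vals t) 0.
Proof.
move=> _ [p [q [_ pq ->]]]; rewrite -Lam0; apply: ramp_mono => //.
  exact: bounded_continuous_cst.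
by move=> x _; exact: ramp_ge0.
Qed.

Let has_inf_vals t : has_inf (vals t).
Proof. by split; [exact: vals_neq0|exists 0; exact: vals_ge0]. Qed.

Lemma cdf_le s p q : s < p -> p < q -> cdf s <= Lam (ramp p q).
Proof.
move=> sp pq; apply: ge_inf; first by exists 0; exact: vals_ge0.
by exists p, q.
Qed.

Lemma has_cdf_cdf : has_cdf Lam cdf.
Proof.
move=> s p q sp pq; rewrite cdf_le//=.
apply: lb_le_inf => // _ [p' [q' [qp' pq' ->]]].
apply: ramp_mono => // x _; have [xp|xp] := leP x p'.
  by rewrite (ramp1 pq' xp) ramp_le1.
by rewrite (ramp0 pq) ?ramp_ge0// ltW// (lt_trans qp').
Qed.

Lemma cdf_homo : {homo cdf : x y / x <= y}.
Proof.
move=> x y xy; apply: lb_le_inf => // _ [p [q [yp pq ->]]].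
by apply: cdf_le => //; exact: le_lt_trans yp.
Qed.

Lemma cdf_ge0 t : 0 <= cdf t.
Proof. by apply: lb_le_inf => //; exact: vals_ge0. Qed.

Lemma cdf_eq0 t : t < -1 -> cdf t = 0.
Proof.
move=> t1; apply/eqP; rewrite eq_le cdf_ge0 andbT.
pose p := (t - 1) / 2.
have tp : t < p by rewrite /p; lra.
have p1 : p < -1 by rewrite /p; lra.
apply: (le_trans (cdf_le tp p1)); rewrite -Lam0; apply: ramp_mono => //.
  exact: bounded_continuous_cst.
by move=> x /andP[x1 _]; rewrite ramp0.
Qed.

Lemma cdf_eq1 t : 1 <= t -> cdf t = 1.
Proof.
move=> t1; suff -> : cdf t = inf [set 1] by rewrite inf1.
congr inf; apply/seteqP; split => x /=.
  move=> [p [q [tp pq ->]]]; have [_ mono one] := pLam; rewrite -one.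
  have b1 := @bounded_continuous_cst R 1.
  have E y : -1 <= y <= 1 -> ramp p q y = 1.
    by move=> /andP[_ y1]; rewrite ramp1// (le_trans y1)// (le_trans t1)// ltW.
  by apply/eqP; rewrite eq_le; apply/andP; split; apply: mono => // y /E ->.
move=> ->; exists (t + 1), (t + 2); split; [lra|lra|].
have [_ mono one] := pLam; rewrite -{1}one.
have b1 := @bounded_continuous_cst R 1.
have E y : -1 <= y <= 1 -> ramp (t + 1) (t + 2) y = 1.
  by move=> /andP[_ y1]; rewrite ramp1//; lra.
by apply/eqP; rewrite eq_le; apply/andP; split; apply: mono => // y /E ->.
Qed.

Lemma cdf_le1 t : cdf t <= 1.
Proof.
have [t1|t1] := leP 1 t; first by rewrite cdf_eq1.
by rewrite -(cdf_eq1 (lexx 1)); apply: cdf_homo; exact: ltW.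
Qed.

Lemma cdf_right_continuous x : cdf t @[t --> x^'+] --> cdf x.
Proof.
apply/cvgrPdist_le => e e0.
have [_ [p [q [xp pq ->]]] h] := inf_adherent e0 (has_inf_vals x).
near=> t.
have xt : x < t by near: t; exact: nbhs_right_gt.
have tp : t < p by near: t; exact: nbhs_right_lt.
have h1 := cdf_homo (ltW xt).
have h2 := cdf_le tp pq.
rewrite distrC ger0_norm ?subr_ge0// lerBlDl (le_trans h2)// ltW//.
Unshelve. all: by end_near. Qed.

End Cdf.

Section Riesz.
Variable R : realType.

(** The measure is the Lebesgue-Stieltjes measure of [cdf Lam]. Integration against it and [Lam]
    have the same distribution function, hence agree on Lipschitz functions; the truncated kernels
    are the only functions to which this is applied. *)
Lemma riesz_representation (K : set R) (Lam : (R -> R) -> R) :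
  compact K -> K `<=` `[-1, 1] ->
  (forall f g (c : R), bounded_continuous f -> bounded_continuous g ->
     Lam (fun x => f x + c * g x) = Lam f + c * Lam g) ->
  (forall f g, bounded_continuous f -> bounded_continuous g ->
     (forall x, K x -> f x <= g x) -> Lam f <= Lam g) ->
  Lam (fun=> 1) = 1 ->
  exists om : {measure set R -> \bar R}, is_prob_on K om /\
    forall f (L : R), bounded_continuous f ->
      (forall x y, `|f x - f y| <= L * `|x - y|) ->
      (\int[om]_x (f x)%:E = (Lam f)%:E)%E.
Proof.
move=> cK K11 lin mono one.
have pL : positive_functional Lam.
  split => // f g bf bg fg; apply: mono => // x /K11.
  by rewrite /= in_itv/=; exact: fg.
pose F := cdf Lam.
have [om [omT omoc]] : exists om : {measure set R -> \bar R}, om setT = 1%E /\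
    forall a b : R, a <= b -> om `]a, b]%classic = (F b - F a)%:E.
  have Fy : F t @[t --> +oo] --> (1 : R).
    apply: cvg_near_cst; near=> t; apply: (cdf_eq1 pL); near: t.
    by exists 1; split => // t /ltW.
  have FNy : F t @[t --> -oo] --> (0 : R).
    apply: cvg_near_cst; near=> t; apply: (cdf_eq0 pL); near: t.
    by exists (-1); split.
  pose m1 := isCumulative.Build R _ R F (cdf_homo pL) (cdf_right_continuous pL).
  pose m2 := isCumulativeBounded.Build R 0 1 F FNy Fy.
  pose Fc : cumulativeBounded (0 : R) 1 := HB.pack F m1 m2.
  pose P : {measure set (measurableTypeR R) -> \bar R} := lebesgue_stieltjes_measure Fc.
  have PT : P setT = 1%E by exact: (@probability_setT _ _ _ (lebesgue_stieltjes_measure Fc)).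
  have Poc (a b : R) : a <= b -> P `]a, b]%classic = (F b - F a)%:E.
    move=> ab; rewrite /P /lebesgue_stieltjes_measure /measure_extension.
    rewrite [LHS]measurable_mu_extE/=; last exact: is_ocitv.
    by rewrite wlength_itv_bnd.
  (* The Stieltjes measure is typed over [measurableTypeR R]; the same set function is repackaged as
     a measure on [R]. *)
  pose m3 := isMeasure.Build _ R R (P : set R -> \bar R) (measure0 P) (measure_ge0 P)
     (@measure_semi_sigma_additive _ _ _ P).
  pose om : {measure set R -> \bar R} := HB.pack (P : set R -> \bar R) m3.
  have omT : om setT = 1%E by exact: PT.
  have omoc (a b : R) : a <= b -> om `]a, b]%classic = (F b - F a)%:E by exact: Poc.
  by exists om.
have omK : om (~` K) = 0%E.
  apply: locally_null; first by apply: closed_openC; exact: compact_closed.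
  move=> x nKx; have oK : open (~` K) by apply: closed_openC; exact: compact_closed.
  have /nbhs_ballP[e /= e0 he] := open_nbhs_nbhs (conj oK nKx).
  exists (e / 2); first by rewrite divr_gt0.
  (* One ramp descends to the right of the interval, the other to its left, both within distance [e]
     of [x]. As K has no point there, the right ramp is at most the left one on K, so [F] does not
     grow over the interval. *)
  have h1 : F (x + e / 2) <= Lam (ramp (x + e * (3 / 5)) (x + e * (7 / 10))).
    by apply: cdf_le => //; lra.
  have h2 : Lam (ramp (x - e * (3 / 5)) (x - e / 2)) <= F (x - e / 2).
    by have /andP[] := @has_cdf_cdf _ _ pL (x - e) (x - e * (3 / 5)) (x - e / 2) ltac:(lra) ltac:(lra).
  have h3 : Lam (ramp (x + e * (3 / 5)) (x + e * (7 / 10))) <= Lam (ramp (x - e * (3 / 5)) (x - e / 2)).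
    apply: mono; [exact: bounded_continuous_ramp|exact: bounded_continuous_ramp|].
    move=> y Ky; have [yx|yx] := leP y (x - e * (3 / 5)).
      by rewrite (ramp1 _ yx) ?ramp_le1//; lra.
    rewrite ramp0 ?ramp_ge0//; first lra.
    rewrite leNgt; apply/negP => yx2; apply: (he y) => //=.
    by rewrite /ball /= ltr_norml; lra.
  apply/eqP; rewrite -measure_le0.
  apply: (@le_trans _ _ (om `]x - e / 2, x + e / 2]%classic)).
    apply: le_measure; rewrite ?inE//; first by apply: open_measurable; exact: ball_open.
    by move=> y; rewrite /ball /= ltr_norml in_itv/= => /andP[? ?]; lra.
  by rewrite omoc ?lee_fin; lra.
have mK : measurable K by exact: compact_measurable.
pose D : set R := `[-1, 1]%classic.
have mD : measurable D by exact: measurable_itv.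
have omDc : om (~` D) = 0%E.
  apply/eqP; rewrite -measure_le0 -omK le_measure ?inE//; try exact: measurableC.
  exact: subsetC.
have omI (A : set R) : measurable A -> om (A `&` D) = om A.
  move=> mA; have <- : om (A `&` D) + om (A `\` D) = om A.
    by rewrite addeC -measureDI.
  suff -> : om (A `\` D) = 0%E by rewrite adde0.
  apply/eqP; rewrite -measure_le0 -omDc; apply: le_measure; rewrite ?inE.
  - exact: measurableD.
  - exact: measurableC.
  - by move=> y [].
have omD : om D = 1%E by rewrite -[D]setTI omI.
pose I f := (\int[om]_(x in D) f x)%R.
have intg f : bounded_continuous f -> om.-integrable D (EFin \o f).
  move=> [cf [B fB]]; apply: measurable_bounded_integrable => //.
  - by rewrite omD ltry.
  - by apply: measurable_funTS; exact: continuous_measurable_fun.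
  - by exists B; split; [exact: num_real|move=> M BM x _; exact: le_trans (fB x) (ltW BM)].
have pI : positive_functional I.
  split.
  - move=> f g c bf bg.
    have igc : om.-integrable D (EFin \o (fun x => c * g x)).
      have b0 := bounded_continuous_cst (0 : R).
      have := intg _ (bounded_continuousZD c b0 bg).
      by apply: eq_integrable => // x _ /=; rewrite add0r.
    rewrite /I (RintegralD mD (intg _ bf) igc).
    by rewrite (RintegralZl _ mD (intg _ bg)).
  - move=> f g bf bg fg; apply: (le_Rintegral mD (intg _ bf) (intg _ bg)) => x.
    by rewrite /D /= in_itv/=; exact: fg.
  - by rewrite /I Rintegral_cst// omD mul1r.
have cI : has_cdf I F.
  move=> s p q sp pq.
  (* The left end -2 replaces minus infinity: [F] vanishes to the left of -1. *)
  have Fs (t : R) : F t = fine (om (`]-2, t] `&` D)).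
    have [t2|t2] := leP (-2) t.
      by rewrite omI// omoc// /F (@cdf_eq0 _ _ pL (-2)) ?subr0//; lra.
    rewrite set_itv_ge -?leNgt ?bnd_simp ?ltW// set0I measure0.
    by rewrite /F (cdf_eq0 pL)//; lra.
  have iE (t : R) : fine (om (`]-2, t] `&` D)) = I (\1_(`]-2, t]%classic)).
    by rewrite /I /Rintegral integral_indic.
  have ig (t : R) : om.-integrable D (EFin \o \1_(`]-2, t]%classic)).
    apply: measurable_bounded_integrable => //; first by rewrite omD ltry.
    exists 1; split; [exact: num_real|move=> M BM x _].
    by rewrite /= indicE; case: (_ \in _); rewrite ?normr1 ?normr0 ltW// (lt_trans ltr01).
  rewrite !Fs !iE /I; apply/andP; split; apply: le_Rintegral => //.
  - exact/intg/bounded_continuous_ramp.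
  - move=> x _; rewrite indicE.
    case: (boolP (x \in _)) => [|_]; last by rewrite ramp_ge0.
    rewrite inE/= in_itv/= => /andP[_ xs].
    by rewrite ramp1// (le_trans xs)// ltW.
  - exact/intg/bounded_continuous_ramp.
  - move=> x; rewrite /D /= in_itv/= => /andP[x1 _]; rewrite indicE.
    case: (boolP (x \in _)) => [_|]; first by rewrite ramp_le1.
    rewrite notin_setE/= in_itv/= => /negP; rewrite negb_and -leNgt -ltNge => /orP[|]; first lra.
    by move=> qx; rewrite (ramp0 pq (ltW qx)).
exists om; split=> // f L bf Lf.
have <- : I f = Lam f.
  apply: (positive_functional_eq pI pL _ _ cI (has_cdf_cdf pL) bf Lf).
  - exact: cdf_homo.
  - by move=> x; rewrite cdf_ge0// cdf_le1.
rewrite /I fineK; last by apply: integrable_fin_num => //; exact: intg.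
have [cf [B fB]] := bf.
have intT : om.-integrable setT (EFin \o f).
  apply: measurable_bounded_integrable => //.
  - by rewrite omT ltry.
  - exact: continuous_measurable_fun.
  - by exists B; split; [exact: num_real|move=> M BM x _; exact: le_trans (fB x) (ltW BM)].
rewrite (negligible_integral (measurableC mD) measurableT intT omDc).
by rewrite setTD setCK.
Unshelve. all: by end_near. Qed.

End Riesz.

(** * Logarithmic potentials *)

Section ProbabilityOfMeasure.
Variables (R : realType) (nu : {measure set R -> \bar R}) (nuT : nu setT = 1%E).

(** The idle [let] makes the constant depend on [nuT], so that the probability structure can be
    attached to it. *)
Definition prob_of_measure : set R -> \bar R := let _ := nuT in nu.

HB.instance Definition _ := isMeasure.Build _ R R prob_of_measure
  (measure0 nu) (measure_ge0 nu) (@measure_semi_sigma_additive _ _ _ nu).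

HB.instance Definition _ :=
  @Measure_isProbability.Build _ R R prob_of_measure nuT.

Lemma probability_of_measure :
  exists P : probability R R, (P : {measure set R -> \bar R}) = nu.
Proof. by exists prob_of_measure; exact: eq_measure. Qed.

End ProbabilityOfMeasure.

(** * The logarithmic kernel and its truncations *)

Section Kernel.
Variable R : realType.
Implicit Types (x y z : R) (n : nat).

(* The logarithmic kernel shifted by [ln 4] and cut off at 0: on [-1, 1] this only adds the
   constant [ln 4], and the kernel becomes nonnegative. *)
Definition lker_trunc n x y : R :=
  Num.max 0 (ln 4 - ln ((x - y) ^+ 2 + n.+1%:R^-1 ^+ 2) / 2).

Definition lker x y : \bar R :=
  if x == y then +oo%E else (Num.max 0 (ln 4 - ln `|x - y|))%:E.

Lemma lker_trunc_ge0 n x y : 0 <= lker_trunc n x y.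
Proof. by rewrite le_max lexx. Qed.

Lemma lker_ge0 x y : (0 <= lker x y)%E.
Proof. by rewrite /lker; case: eqP => // _; rewrite lee_fin le_max lexx. Qed.

Lemma lkerC x y : lker x y = lker y x.
Proof. by rewrite /lker eq_sym distrC. Qed.

Lemma lker_truncC n x y : lker_trunc n x y = lker_trunc n y x.
Proof. by rewrite /lker_trunc (_ : (y - x) ^+ 2 = (x - y) ^+ 2)//; ring. Qed.

Let eps_gt0 n : 0 < n.+1%:R^-1 ^+ 2 :> R.
Proof. by rewrite exprn_gt0// invr_gt0. Qed.

Let trunc_gt0 n x y : 0 < (x - y) ^+ 2 + n.+1%:R^-1 ^+ 2.
Proof. by rewrite ltr_wpDl ?sqr_ge0. Qed.

(** With e = 1 / (n + 1), moving [y] by d multiplies (x - y)^2 + e^2 by at most (1 + d / e)^2, and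
    ln (1 + d / e) <= d / e. *)
Lemma lker_trunc_lipschitz n x y y' :
  `|lker_trunc n x y - lker_trunc n x y'| <= n.+1%:R * `|y - y'|.
Proof.
suff {y y'} h (y y' : R) : lker_trunc n x y - lker_trunc n x y' <= n.+1%:R * `|y - y'|.
  rewrite ler_norml h andbT.
  by have := h y' y; rewrite distrC; lra.
pose d := `|y - y'|.
set e : R := n.+1%:R^-1; have e0 : 0 < e by rewrite invr_gt0.
have d0 : 0 <= d by exact: normr_ge0.
suff key : - ln ((x - y) ^+ 2 + e ^+ 2) / 2 <= - ln ((x - y') ^+ 2 + e ^+ 2) / 2 + d / e.
  have -> : n.+1%:R * `|y - y'| = d / e by rewrite /e invrK mulrC.
  rewrite /lker_trunc -/e lerBlDl.
  have de : 0 <= d / e by rewrite divr_ge0// ltW.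
  rewrite ge_max addrC; apply/andP; split; first by rewrite addr_ge0// le_max lexx.
  apply: (@le_trans _ _ (d / e + (ln 4 - ln ((x - y') ^+ 2 + e ^+ 2) / 2))); first by lra.
  by rewrite lerD2l le_max lexx orbT.
suff : ln ((x - y') ^+ 2 + e ^+ 2) <= ln ((x - y) ^+ 2 + e ^+ 2) + 2 * (d / e) by lra.
set s := x - y'; set r := x - y.
have B0 : 0 < r ^+ 2 + e ^+ 2 by rewrite ltr_wpDl ?sqr_ge0// exprn_gt0.
have de : 0 <= d / e by rewrite divr_ge0// ltW.
have sd : `|s - r| = d by rewrite /s /r /d; congr `|_|; ring.
have sB : s ^+ 2 + e ^+ 2 <= (r ^+ 2 + e ^+ 2) * (1 + d / e) ^+ 2.
  have hd : d = d / e * e by rewrite divfK// gt_eqF.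
  move: (d / e) hd de => k hd k0.
  have rn : s <= r + d /\ r - d <= s.
    by have := lexx `|s - r|; rewrite {2}sd ler_norml => /andP[? ?]; lra.
  have h1 : s ^+ 2 <= (`|r| + d) ^+ 2.
    have rr := ler_norm r; have rr' := ler_norm (- r); rewrite normrN in rr'.
    rewrite -subr_ge0.
    have -> : (`|r| + d) ^+ 2 - s ^+ 2 = (`|r| + d - s) * (`|r| + d + s) by ring.
    by apply: mulr_ge0; lra.
  have h2 : `|r| ^+ 2 = r ^+ 2 by rewrite real_normK// num_real.
  move: h1 h2; move: `|r| (normr_ge0 r) => a a0 h1 h2; rewrite -h2.
  have : 0 <= (a - e) ^+ 2 by exact: sqr_ge0.
  rewrite hd in h1; move=> h3.
  have : (a ^+ 2 + e ^+ 2) * (1 + k) ^+ 2 - ((a + k * e) ^+ 2 + e ^+ 2) =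
    k * (2 * (a ^+ 2 + e ^+ 2 - a * e)) + k ^+ 2 * a ^+ 2 by ring.
  have : 0 <= k * (2 * (a ^+ 2 + e ^+ 2 - a * e)).
    by apply: mulr_ge0 => //; nra.
  have : 0 <= k ^+ 2 * a ^+ 2 by rewrite mulr_ge0 ?sqr_ge0.
  lra.
have k1 : 0 < 1 + d / e by rewrite ltr_pwDl.
apply: (@le_trans _ _ (ln ((r ^+ 2 + e ^+ 2) * (1 + d / e) ^+ 2))).
  by rewrite ler_ln ?posrE// ?mulr_gt0 ?exprn_gt0// ltr_wpDl ?sqr_ge0// exprn_gt0.
rewrite lnM ?posrE ?exprn_gt0// lnXn// mulr2n.
by have := @le_ln1Dx R (d / e) ltac:(lra); lra.
Qed.

Lemma lker_trunc_ub n x y : lker_trunc n x y <= ln 4 + ln n.+1%:R.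
Proof.
have l4 : 0 <= ln 4 :> R by rewrite ln_ge0// ler1n.
have ln1 : 0 <= ln n.+1%:R :> R by rewrite ln_ge0// ler1n.
rewrite ge_max addr_ge0//= lerD2l lerNl.
have : ln (n.+1%:R^-1 ^+ 2) <= ln ((x - y) ^+ 2 + n.+1%:R^-1 ^+ 2).
  by rewrite ler_ln ?posrE// lerDr sqr_ge0.
by rewrite lnXn ?invr_gt0// lnV ?posrE// mulr2n; lra.
Qed.

Lemma lker_trunc_continuous n x : continuous (lker_trunc n x).
Proof.
move=> y; apply/cvgrPdist_lt => e e0; near=> z.
apply: (le_lt_trans (lker_trunc_lipschitz _ _ _ _)).
rewrite -ltr_pdivlMl//; near: z; apply/nbhs_ballP.
by exists (n.+1%:R^-1 * e) => //=; rewrite mulr_gt0// invr_gt0.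
Unshelve. all: by end_near. Qed.

Lemma bounded_continuous_lker_trunc n x : bounded_continuous (lker_trunc n x).
Proof.
split; first exact: lker_trunc_continuous.
exists (ln 4 + ln n.+1%:R) => y; rewrite ger0_norm ?lker_trunc_ge0//.
exact: lker_trunc_ub.
Qed.

Lemma lker_trunc_nondecreasing x y : nondecreasing_seq (fun n => lker_trunc n x y).
Proof.
move=> m n mn; rewrite /lker_trunc ge_max le_max lexx/= le_max; apply/orP; right.
rewrite lerD2l lerN2 ler_pM2r ?invr_gt0// ler_ln ?posrE// lerD2l.
by rewrite ler_pXn2r ?nnegrE ?invr_ge0// lef_pV2 ?posrE// ler_nat.
Qed.

Lemma lker_trunc_cvg x y : (lker_trunc n x y)%:E @[n --> \oo] --> lker x y.
Proof.
rewrite /lker; have [->|xy] := eqVneq x y.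
  apply/cvgeyPge => A; near=> n.
  rewrite lee_fin /lker_trunc subrr expr0n/= add0r le_max; apply/orP; right.
  rewrite lnXn ?invr_gt0// lnV ?posrE// mulr2n.
  have l4 : 0 <= ln 4 :> R by rewrite ln_ge0// ler1n.
  suff : A <= ln n.+1%:R by lra.
  rewrite -[leLHS]expRK ler_ln ?posrE ?expR_gt0//.
  rewrite (le_trans (ltW (truncnS_gt _)))// ler_nat ltnS.
  by near: n; exists (Num.truncn (expR A)).
apply: cvg_EFin; first by near=> n.
have xy0 : 0 < `|x - y| by rewrite normr_gt0 subr_eq0.
have E : ln `|x - y| = ln ((x - y) ^+ 2 + 0 ^+ 2) / 2.
  by rewrite expr0n/= addr0 -real_normK ?num_real// lnXn// mulr2n; lra.
rewrite E.
suff c0 : {for 0, continuous (fun e : R => Num.max 0 (ln 4 - ln ((x - y) ^+ 2 + e ^+ 2) / 2))}.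
  have := cvg_comp _ _ (@cvg_harmonic R) c0; apply: cvg_trans.
  by apply: near_eq_cvg; near=> n; rewrite /lker_trunc /= /harmonic.
apply: (@continuous_max R R (fun=> 0) _ 0); first exact: cvg_cst.
apply: cvgB; first exact: cvg_cst.
apply: cvgM; last exact: cvg_cst.
apply: (@continuous_cvg _ _ _ (nbhs (0 : R)) _ (fun e : R => (x - y) ^+ 2 + e ^+ 2) (@ln R)).
  by apply: continuous_ln; rewrite expr0n/= addr0 -real_normK ?num_real// exprn_gt0.
apply: cvgD; first exact: cvg_cst.
by rewrite expr2; under eq_fun do rewrite expr2; apply: cvgM; exact: cvg_id.
Unshelve. all: by end_near. Qed.

Lemma measurable_lker_trunc n :
  measurable_fun setT (fun z : R * R => lker_trunc n z.1 z.2).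
Proof.
apply: measurable_maxr; first exact: measurable_cst.
apply: measurable_funB; first exact: measurable_cst.
apply: measurable_funM; last exact: measurable_cst.
apply: (@measurableT_comp _ _ _ _ _ _ (@ln R)); first exact: measurable_ln.
apply: measurable_funD; last exact: measurable_cst.
by apply: measurable_funX; apply: measurable_funB; [exact: measurable_fst|exact: measurable_snd].
Qed.

Lemma measurable_lker : measurable_fun setT (fun z : R * R => lker z.1 z.2).
Proof.
apply: (emeasurable_fun_cvg (fun n (z : R * R) => (lker_trunc n z.1 z.2)%:E)).
  by move=> n; apply/measurable_EFinP; exact: measurable_lker_trunc.
by move=> z _; exact: lker_trunc_cvg.
Qed.

Lemma measurable_lker_section x : measurable_fun setT (lker x).
Proof.
apply: (emeasurable_fun_cvg (fun n y => (lker_trunc n x y)%:E)).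
  move=> n; apply/measurable_EFinP; apply: continuous_measurable_fun.
  exact: lker_trunc_continuous.
by move=> z _; exact: lker_trunc_cvg.
Qed.

End Kernel.

(** * Integration against a density *)

Section Density.
Local Open Scope ereal_scope.
Context d (T : measurableType d) (R : realType).
Variables (mu nu : {measure set T -> \bar R}) (w : T -> R).
Hypotheses (mw : measurable_fun setT w) (w0 : forall x, (0 <= w x)%R)
  (nuE : forall A, measurable A -> nu A = \int[mu]_(x in A) (w x)%:E).

Import HBNNSimple.

Let mwE : measurable_fun setT (fun x => (w x)%:E).
Proof. exact/measurable_EFinP. Qed.

Let integral_density_nnsfun (f : {nnsfun T >-> R}) :
  \int[nu]_x (f x)%:E = \int[mu]_x ((f x)%:E * (w x)%:E).
Proof.
under eq_integral do rewrite fimfunE -fsumEFin//.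
rewrite ge0_integral_fsum//; last 2 first.
  - by move=> r /=; apply: measurableT_comp => //; exact: measurableT_comp.
  - by move=> r t _; rewrite EFinM nnfun_muleindic_ge0.
transitivity (\int[mu]_x \sum_(r \in range f) ((r * \1_(f @^-1` [set r]) x)%:E * (w x)%:E)).
  rewrite ge0_integral_fsum//; last 2 first.
  - move=> r /=; apply: emeasurable_funM => //.
    by apply: measurableT_comp => //; exact: measurableT_comp.
  - by move=> r t _; rewrite mule_ge0 ?lee_fin// -lee_fin EFinM nnfun_muleindic_ge0.
  apply: eq_fsbigr => r /set_mem[x _ <-].
  under eq_integral do rewrite EFinM.
  under [RHS]eq_integral do rewrite EFinM -muleA.
  have mA : measurable (f @^-1` [set f x]) by [].
  rewrite ge0_integralZl//; last 2 first.
  - by apply: measurableT_comp => //; exact: measurableT_comp.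
  - by rewrite lee_fin.
  rewrite ge0_integralZl//; last 3 first.
  - apply: emeasurable_funM => //.
    by apply: measurableT_comp => //; exact: measurableT_comp.
  - by move=> y _; rewrite mule_ge0// lee_fin.
  - by rewrite lee_fin.
  rewrite integral_indic// setIT nuE//; congr (_ * _).
  rewrite [LHS]integral_mkcond; apply: eq_integral => y _.
  by rewrite patchE indicE; case: ifP => _; rewrite ?mul1e ?mul0e.
apply: eq_integral => x _; rewrite fimfunE -fsumEFin//.
rewrite ge0_mule_fsuml// => r.
by rewrite EFinM nnfun_muleindic_ge0.
Qed.

(** The density is known only through measures of sets; simple functions and monotone convergence
    carry it to integrals. *)
Lemma ge0_integral_density (f : T -> \bar R) : measurable_fun setT f ->
  (forall x, 0 <= f x) -> \int[nu]_x f x = \int[mu]_x (f x * (w x)%:E).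
Proof.
move=> mf f0; pose g := nnsfun_approx measurableT mf.
have fE x : f x = limn (fun n => (g n x)%:E).
  by apply/esym/cvg_lim => //; exact: cvg_nnsfun_approx.
have cg x : cvgn (fun n => (g n x)%:E).
  by apply/cvg_ex; exists (f x); exact: cvg_nnsfun_approx.
have mg n : measurable_fun setT (fun x => (g n x)%:E).
  exact/measurable_EFinP.
have ndg x : {homo (fun n => (g n x)%:E) : n m / (n <= m)%N >-> n <= m}.
  by move=> n m nm; rewrite lee_fin; exact/lefP/nd_nnsfun_approx.
under eq_integral do rewrite fE.
rewrite monotone_convergence//; last by move=> n x _; rewrite lee_fin.
under eq_fun do rewrite integral_density_nnsfun.
rewrite -monotone_convergence//.
- apply: eq_integral => x _; apply/cvg_lim => //; apply: cvgeZr => //.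
  exact: cvg_nnsfun_approx.
- by move=> n; exact: emeasurable_funM.
- by move=> n x _; rewrite mule_ge0// lee_fin.
- by move=> x _ n m nm; rewrite lee_wpmul2r ?lee_fin//; have := ndg x n m nm; rewrite lee_fin.
Qed.

End Density.

(** * Potentials, energies and their first variation *)

Section Potential.
Local Open Scope ereal_scope.
Variable R : realType.
Implicit Types (nu : {measure set R -> \bar R}) (P Q : probability R R) (x y : R).

Lemma ge0_le_integral_null nu (F : set R) (f g : R -> \bar R) :
  measurable F -> nu (~` F) = 0 ->
  measurable_fun setT f -> measurable_fun setT g ->
  (forall x, 0 <= f x) -> (forall x, 0 <= g x) ->
  (forall x, F x -> f x <= g x) -> \int[nu]_x f x <= \int[nu]_x g x.
Proof.
move=> mF nF mf mg f0 g0 fg; have mFc := measurableC mF.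
rewrite (ge0_negligible_integral mFc measurableT mf (fun x _ => f0 x) nF).
rewrite (ge0_negligible_integral mFc measurableT mg (fun x _ => g0 x) nF).
rewrite setTD setCK; apply: ge0_le_integral => //.
- exact: measurable_funTS.
- exact: measurable_funTS.
Qed.

Definition pot nu x : \bar R := \int[nu]_y lker x y.

(** The energy for the nonnegative kernel. For probabilities on [-1, 1] it exceeds the logarithmic
    energy by ln 4, so both have the same minimizers on K. *)
Definition pen nu : \bar R := \int[nu]_x pot nu x.

Lemma pot_ge0 nu x : 0 <= pot nu x.
Proof. by apply: integral_ge0 => y _; exact: lker_ge0. Qed.

Lemma pen_ge0 nu : 0 <= pen nu.
Proof. by apply: integral_ge0 => y _; exact: pot_ge0. Qed.

Lemma measurable_pot P : measurable_fun setT (pot P).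
Proof.
apply: (@measurable_fun_fubini_tonelli_F _ _ _ _ _ P (fun z : R * R => lker z.1 z.2)).
  exact: measurable_lker.
by move=> z; exact: lker_ge0.
Qed.

Lemma integral_pot_sym P Q : \int[Q]_x pot P x = \int[P]_x pot Q x.
Proof.
rewrite /pot (@fubini_tonelli _ _ _ _ _ Q P (fun z : R * R => lker z.1 z.2)).
- by apply: eq_integral => x _; apply: eq_integral => y _; exact: lkerC.
- exact: measurable_lker.
- by move=> z; exact: lker_ge0.
Qed.

Definition mixture (a b : {nonneg R}) P Q : {measure set R -> \bar R} :=
  measure_add (mscale a P) (mscale b Q).

Lemma integral_mixture (a b : {nonneg R}) P Q (f : R -> \bar R) :
  measurable_fun setT f -> (forall x, 0 <= f x) ->
  \int[mixture a b P Q]_x f x =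
  a%:num%:E * \int[P]_x f x + b%:num%:E * \int[Q]_x f x.
Proof.
move=> mf f0; rewrite /mixture ge0_integral_measure_add//.
by rewrite !ge0_integral_mscale.
Qed.

Lemma pen_mixture (a b : {nonneg R}) P Q :
  pen (mixture a b P Q) =
  a%:num%:E * (a%:num%:E * pen P + b%:num%:E * \int[Q]_x pot P x) +
  b%:num%:E * (a%:num%:E * \int[Q]_x pot P x + b%:num%:E * pen Q).
Proof.
have mP := measurable_pot P; have mQ := measurable_pot Q.
have e0 x : 0 <= a%:num%:E * pot P x by rewrite mule_ge0 ?lee_fin// pot_ge0.
have f0 x : 0 <= b%:num%:E * pot Q x by rewrite mule_ge0 ?lee_fin// pot_ge0.
have ma : measurable_fun setT (fun x => a%:num%:E * pot P x) by exact: emeasurable_funM.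
have mb : measurable_fun setT (fun x => b%:num%:E * pot Q x) by exact: emeasurable_funM.
have E x : pot (mixture a b P Q) x = a%:num%:E * pot P x + b%:num%:E * pot Q x.
  by apply: integral_mixture; [exact: measurable_lker_section|move=> y; exact: lker_ge0].
rewrite /pen; under eq_integral do rewrite E.
rewrite integral_mixture; first last.
- by move=> x; exact: adde_ge0.
- exact: emeasurable_funD.
have sum (m : {measure set R -> \bar R}) :
    \int[m]_x (a%:num%:E * pot P x + b%:num%:E * pot Q x) =
    a%:num%:E * \int[m]_x pot P x + b%:num%:E * \int[m]_x pot Q x.
  rewrite (ge0_integralD m measurableT (fun x _ => e0 x) ma (fun x _ => f0 x) mb).
  rewrite (ge0_integralZl m measurableT mP (fun x _ => pot_ge0 P x)) ?lee_fin//.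
  by rewrite (ge0_integralZl m measurableT mQ (fun x _ => pot_ge0 Q x)) ?lee_fin.
by rewrite !sum (integral_pot_sym Q P).
Qed.

(** With i, e the energies of P, Q and x the mutual one, the energy of (1 - t) P + t Q is i + 2 t (x
    - i) + t^2 (i - 2 x + e). If x < i, a small t > 0 would bring it below i. *)
Lemma energy_variation P Q : pen P < +oo -> pen Q < +oo ->
  (forall a b : {nonneg R}, (a%:num + b%:num = 1)%R -> pen P <= pen (mixture a b P Q)) ->
  pen P <= \int[Q]_x pot P x.
Proof.
move=> Pfin Qfin min; rewrite leNgt; apply/negP => XI.
have X0 : 0 <= \int[Q]_x pot P x by apply: integral_ge0 => x _; exact: pot_ge0.
have Xfin := lt_trans XI Pfin.
have [i iE] : exists i : R, pen P = i%:E.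
  by exists (fine (pen P)); rewrite fineK// ge0_fin_numE// pen_ge0.
have [e eE] : exists e : R, pen Q = e%:E.
  by exists (fine (pen Q)); rewrite fineK// ge0_fin_numE// pen_ge0.
have [x xE] : exists x : R, \int[Q]_x pot P x = x%:E.
  by exists (fine (\int[Q]_x pot P x)); rewrite fineK// ge0_fin_numE.
have xi : (x < i)%R by rewrite -lte_fin -xE -iE.
pose M := (`|i - 2 * x + e| + 1)%R.
have M0 : (0 < M)%R by rewrite ltr_wpDl.
pose t := Num.min (1 / 2)%R ((i - x) / M)%R.
have t0 : (0 < t)%R by rewrite lt_min divr_gt0//= divr_gt0// subr_gt0.
have t2 : (t <= 1 / 2)%R by rewrite ge_min lexx.
have tM : (t * M <= i - x)%R by rewrite -ler_pdivlMr// ge_min lexx orbT.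
have t1' : (0 <= 1 - t)%R by lra.
have := min (NngNum t1') (NngNum (ltW t0)) => /=.
rewrite subrK => /(_ erefl); rewrite pen_mixture /= iE eE xE.
do ![rewrite -EFinM|rewrite -EFinD]; rewrite lee_fin.
have := ler_norm (i - 2 * x + e).
have h : (t * (i - 2 * x + e) <= t * M)%R.
  by apply: ler_wpM2l; [exact: ltW|rewrite /M; have := ler_norm (i - 2 * x + e); lra].
have h2 : (0 < t * (i - x))%R by rewrite mulr_gt0// subr_gt0.
have h3 : (t * (t * (i - 2 * x + e)) <= t * (i - x))%R.
  by apply: ler_wpM2l; [exact: ltW|exact: le_trans tM].
lra.
Qed.

End Potential.

(** * Frostman's theorem *)

Section Frostman.
Local Open Scope ereal_scope.
Variables (R : realType) (K : set R) (P : probability R R).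
Hypotheses (cK : compact K) (K11 : K `<=` [set x | -1 <= x <= 1]%R) (PK : P (~` K) = 0)
  (Pfin : pen P < +oo)
  (Pmin : forall nu : {measure set R -> \bar R}, is_prob_on K nu -> pen P <= pen nu).

Lemma pot_variation (Q : probability R R) : Q (~` K) = 0 -> pen Q < +oo ->
  pen P <= \int[Q]_x pot P x.
Proof.
move=> QK Qfin; apply: energy_variation => // a b ab; apply: Pmin; split.
- rewrite /mixture /measure_add/= /msum !big_ord_recl big_ord0/= /mscale/= adde0.
  by rewrite !probability_setT !mule1 -EFinD ab.
- rewrite /mixture /measure_add/= /msum !big_ord_recl big_ord0/= /mscale/= adde0.
  by rewrite PK QK !mule0 adde0.
Qed.

Let mpot : measurable_fun setT (pot P) := measurable_pot P.

(** The normalized restriction of [P] to [A] is a competitor in [pot_variation]; its energy is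
    finite because its density with respect to [P] is bounded. *)
Lemma pot_restrict (A : set R) : measurable A -> 0 < P A ->
  pen P * P A <= \int[P]_(x in A) pot P x.
Proof.
move=> mA PA0.
have PAfin : P A \is a fin_num by exact: fin_num_measure.
pose p := fine (P A); have pE : P A = p%:E by rewrite fineK.
have p0 : (0 < p)%R by rewrite -lte_fin -pE.
have c0 : (0 <= p^-1)%R by rewrite invr_ge0 ltW.
pose nu : {measure set R -> \bar R} := mscale (NngNum c0) (mrestr P mA).
have nuE (B : set R) : nu B = (p^-1)%:E * P (B `&` A) by [].
have nuT : nu setT = 1 by rewrite nuE setTI pE -EFinM mulVf// gt_eqF.
have [Q QE] := probability_of_measure nuT.
pose w x : R := (p^-1 * \1_A x)%R.
have w0 x : (0 <= w x)%R by rewrite mulr_ge0// indicE.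
have mw : measurable_fun setT w.
  by apply: measurable_funM; [exact: measurable_cst|exact: measurable_indic].
have dens (B : set R) : measurable B -> Q B = \int[P]_(x in B) (w x)%:E.
  move=> mB; have -> : Q B = nu B by rewrite -QE.
  have mI : measurable_fun B (EFin \o (\1_A : R -> R)).
    by apply/measurable_EFinP/measurable_funTS; exact: measurable_indic.
  have I0 x : B x -> 0 <= (EFin \o (\1_A : R -> R)) x by rewrite /= lee_fin indicE.
  rewrite nuE /w; under eq_integral do rewrite EFinM.
  by rewrite (ge0_integralZl P mB mI I0) ?lee_fin// integral_indic// setIC.
have Qint (f : R -> \bar R) : measurable_fun setT f -> (forall x, 0 <= f x) ->
    \int[Q]_x f x = (p^-1)%:E * \int[P]_(x in A) f x.
  move=> mf f0; rewrite (ge0_integral_density mw w0 dens mf f0).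
  have mfA : measurable_fun setT (f \_ A).
    by apply/(measurable_restrictT _ mA); exact: measurable_funTS.
  have fA0 x : setT x -> 0 <= (f \_ A) x by move=> _; rewrite patchE; case: ifP.
  rewrite [in RHS]integral_mkcond -(ge0_integralZl P measurableT mfA fA0) ?lee_fin//.
  apply: eq_integral => x _; rewrite /w patchE indicE; case: ifP => _.
    by rewrite mulr1 muleC.
  by rewrite mulr0 !mule0.
have sub (f : R -> \bar R) : measurable_fun setT f -> (forall x, 0 <= f x) ->
    \int[Q]_x f x <= (p^-1)%:E * \int[P]_x f x.
  move=> mf f0; rewrite Qint// lee_wpmul2l ?lee_fin//.
  by apply: ge0_subset_integral.
have Qfin : pen Q < +oo.
  have h : pen Q <= (p^-1)%:E * ((p^-1)%:E * pen P).
    apply: (@le_trans _ _ (\int[Q]_x ((p^-1)%:E * pot P x))).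
      apply: ge0_le_integral => //.
      - by move=> x _; exact: pot_ge0.
      - exact: measurable_pot.
      - exact: emeasurable_funM.
      - move=> x _; apply: sub; first exact: measurable_lker_section.
        by move=> y; exact: lker_ge0.
    rewrite ge0_integralZl//; last by move=> x _; exact: pot_ge0.
    rewrite lee_wpmul2l ?lee_fin//; apply: sub => // x; exact: pot_ge0.
  apply: (le_lt_trans h); rewrite -(@fineK _ (pen P)); last first.
    by rewrite ge0_fin_numE// pen_ge0.
  by rewrite -!EFinM ltry.
have QK : Q (~` K) = 0.
  have -> : Q (~` K) = nu (~` K) by rewrite -QE.
  rewrite nuE; suff -> : P (~` K `&` A) = 0 by rewrite mule0.
  apply/eqP; rewrite -measure_le0 -PK le_measure ?inE//.
  - by apply: measurableI => //; apply: measurableC; exact: compact_measurable.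
  - by apply: measurableC; exact: compact_measurable.
have := pot_variation QK Qfin; rewrite Qint//; last exact: pot_ge0.
by rewrite pE => h; rewrite muleC -lee_pdivlMl.
Qed.

(** The set where the potential is at most I already contributes at least I times its mass, and the
    total is I. The remaining set B contributes at most I P(B), although the potential exceeds I on
    it, so it is null. *)
Lemma pot_le_ae : P [set x | pot P x > pen P] = 0.
Proof.
pose I := pen P; have Ifin : I \is a fin_num by rewrite ge0_fin_numE// pen_ge0.
pose B := [set x | pot P x > I].
have mB : measurable B.
  by rewrite -[B]setTI; exact: emeasurable_fun_o_infty.
pose A := ~` B; have mA : measurable A by exact: measurableC.
have split : \int[P]_(x in A) pot P x + \int[P]_(x in B) pot P x = I.
  rewrite -ge0_integral_setU//.
  - by rewrite /A setUC setUv.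
  - exact: measurable_funTS.
  - by move=> x _; exact: pot_ge0.
  - by apply/disj_setPS; rewrite /A setICl.
have hA : I * P A <= \int[P]_(x in A) pot P x.
  have [PA0|PA0] := eqVneq (P A) 0.
    by rewrite PA0 mule0; apply: integral_ge0 => x _; exact: pot_ge0.
  by apply: pot_restrict => //; rewrite lt_neqAle eq_sym PA0 measure_ge0.
have PAB : P A + P B = 1.
  have AB : A `|` B = setT by rewrite /A setUC setUv.
  have AB0 : A `&` B = set0 by rewrite /A setICl.
  rewrite -(@measureU _ _ _ P A B mA mB AB0) AB; exact: probability_setT.
have PAfin : P A \is a fin_num by exact: fin_num_measure.
have PBfin : P B \is a fin_num by exact: fin_num_measure.
have IBfin : I * P B \is a fin_num by rewrite fin_numM.
have hB : \int[P]_(x in B) pot P x <= I * P B.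
  have : I * P A + \int[P]_(x in B) pot P x <= I * P A + I * P B.
    rewrite -muleDr//; last by rewrite fin_num_adde_defr.
    by rewrite PAB mule1 -[leRHS]split; exact: leeD2r.
  by rewrite leeD2lE// fin_numM.
have eqB : \int[P]_(x in B) (pot P x - I) = 0.
  apply/eqP; rewrite eq_le; apply/andP; split; last first.
    by apply: integral_ge0 => x; rewrite /B /= => /ltW; rewrite sube_ge0 ?Ifin.
  have g0 x : B x -> 0 <= pot P x - I by move=> Bx; rewrite sube_ge0 ?Ifin// ltW.
  have mg : measurable_fun B (fun x => pot P x - I).
    by apply: emeasurable_funB; [exact: measurable_funTS|exact: measurable_cst].
  have sumE : \int[P]_(x in B) (pot P x - I) + I * P B = \int[P]_(x in B) pot P x.
    have mc : measurable_fun B (cst I) by exact: measurable_cst.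
    have c0 x : B x -> 0 <= (cst I : R -> \bar R) x by move=> _; exact: pen_ge0.
    rewrite -(integral_cst P mB) -(ge0_integralD P mB g0 mg c0 mc).
    by apply: eq_integral => x _; rewrite /= subeK.
  have : \int[P]_(x in B) (pot P x - I) + I * P B <= 0 + I * P B.
    by rewrite sumE add0e.
  by rewrite leeD2rE.
have : \int[P]_(x in B) `|pot P x - I| = 0.
  rewrite -[RHS]eqB; apply: eq_integral => x; rewrite inE => Bx.
  by rewrite gee0_abs// sube_ge0 ?Ifin// ltW.
move/ae_eq_integral_abs => /(_ mB) [].
  by apply: emeasurable_funB; [exact: measurable_funTS|exact: measurable_cst].
move=> N [mN N0 BN]; apply/eqP; rewrite -measure_le0 -N0 le_measure ?inE//.
move=> x Bx; apply: BN => /= /(_ Bx) h.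
have : 0 < pot P x - I by rewrite sube_gt0.
by rewrite h ltxx.
Qed.

(** Lower semicontinuity: the potential is the supremum of the Lipschitz potentials of the truncated
    kernels. *)
Lemma pot_le_energy_closed (c : R) : closed [set x | pot P x <= c%:E].
Proof.
pose phi n x : R := (\int[P]_y lker_trunc n x y)%R.
have int n x : P.-integrable setT (EFin \o lker_trunc n x).
  apply: measurable_bounded_integrable => //.
  - by apply: (le_lt_trans (probability_le1 P measurableT)); exact: ltry.
  - by apply: continuous_measurable_fun; exact: lker_trunc_continuous.
  - exists (ln 4 + ln n.+1%:R)%R; split; [exact: num_real|move=> M BM y _ /=].
    by rewrite ger0_norm ?lker_trunc_ge0// (le_trans (lker_trunc_ub _ _ _))// ltW.
have phiE n x : \int[P]_y (lker_trunc n x y)%:E = (phi n x)%:E.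
  by rewrite /phi /Rintegral fineK//; apply: integrable_fin_num => //; exact: int.
have cphi n : continuous (phi n).
  move=> x; apply/cvgrPdist_lt => e e0; near=> z.
  apply: (@le_lt_trans _ _ (n.+1%:R * `|x - z|)%R); last first.
    rewrite -ltr_pdivlMl//; near: z; apply/nbhs_ballP.
    by exists (n.+1%:R^-1 * e)%R => //=; rewrite mulr_gt0// invr_gt0.
  have iB : P.-integrable setT (EFin \o (fun y => lker_trunc n x y - lker_trunc n z y)%R).
    exact: (integrableB measurableT (int n x) (int n z)).
  rewrite /phi -(RintegralB measurableT (int n x) (int n z)).
  apply: (le_trans (le_normr_Rintegral measurableT iB)).
  have cE : (\int[P]_y (n.+1%:R * `|x - z|) = n.+1%:R * `|x - z|)%R.
    rewrite (Rintegral_cst P measurableT) -[RHS]mulr1; congr (_ * _)%R.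
    exact: (congr1 fine (probability_setT P)).
  rewrite -cE; apply: le_Rintegral => //.
  - have := integrable_abse iB.
    by apply: eq_integrable => // y _.
  - exact: finite_measure_integrable_cst.
  - move=> y _; rewrite (lker_truncC n x) (lker_truncC n z).
    exact: lker_trunc_lipschitz.
have potE x : pot P x = ereal_sup (range (fun n => (phi n x)%:E)).
  have -> : pot P x = limn (fun n => (phi n x)%:E).
    rewrite /pot; under eq_integral => y _.
      rewrite -(cvg_lim _ (@lker_trunc_cvg R x y))//.
      over.
    rewrite monotone_convergence//.
    - by congr (limn _); apply/funext => n; rewrite phiE.
    - move=> n; apply/measurable_EFinP; apply: continuous_measurable_fun.
      exact: lker_trunc_continuous.
    - by move=> n y _; rewrite lee_fin lker_trunc_ge0.
    - by move=> y _ n m nm; rewrite lee_fin lker_trunc_nondecreasing.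
  apply/cvg_lim => //; apply: ereal_nondecreasing_cvgn => n m nm.
  rewrite -!phiE; apply: ge0_le_integral => //.
  - by move=> y _; rewrite lee_fin lker_trunc_ge0.
  - by apply/measurable_EFinP; apply: continuous_measurable_fun; exact: lker_trunc_continuous.
  - by apply/measurable_EFinP; apply: continuous_measurable_fun; exact: lker_trunc_continuous.
  - by move=> y _; rewrite lee_fin lker_trunc_nondecreasing.
have -> : [set x | pot P x <= c%:E] = \bigcap_n [set x | (phi n x <= c)%R].
  apply/seteqP; split => x /=.
    move=> h n _; rewrite /= -lee_fin (le_trans _ h)// potE.
    by apply: ereal_sup_ubound; exists n.
  by move=> h; rewrite potE; apply: ge_ereal_sup => _ [n _ <-]; rewrite lee_fin; exact: h.
apply: closed_bigI => n _.
have -> : [set x | (phi n x <= c)%R] = phi n @^-1` [set y | (y <= c)%R] by [].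
by apply: closed_comp => [x _|]; [exact: cphi|exact: closed_le].
Unshelve. all: by end_near. Qed.

End Frostman.

(** * The upper bound at every point of [-1, 1] *)

Section FrostmanPointwise.
Variable R : realType.

Lemma lker_le (a c y : R) : a != y -> `|c - y| <= `|a - y| -> (lker a y <= lker c y)%E.
Proof.
move=> ay cy; rewrite /lker (negbTE ay); have [_|ncy] := eqVneq c y; first exact: leey.
rewrite lee_fin ge_max le_max lexx/= le_max; apply/orP; right.
by rewrite lerD2l lerN2 ler_ln ?posrE ?normr_gt0 ?subr_eq0.
Qed.

Lemma ln_concave2 (p q t : R) : 0 < p -> 0 < q -> 0 < t < 1 ->
  (1 - t) * ln p + t * ln q <= ln ((1 - t) * p + t * q).
Proof.
move=> p0 q0 /andP[t0 t1]; set m := (1 - t) * p + t * q.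
have s0 : 0 < 1 - t by rewrite subr_gt0.
have m0 : 0 < m by rewrite addr_gt0// mulr_gt0.
have key (r : R) : 0 < r -> ln r <= ln m + (r / m - 1).
  move=> r0; have rm : 0 < r / m by rewrite divr_gt0.
  have h : ln (1 + (r / m - 1)) <= r / m - 1 by apply: le_ln1Dx; lra.
  have E : 1 + (r / m - 1) = r / m by ring.
  by move: h; rewrite E ln_div ?posrE//; lra.
have := ler_wpM2l (ltW s0) (key _ p0); have := ler_wpM2l (ltW t0) (key _ q0).
have E : (1 - t) * (p / m - 1) + t * (q / m - 1) = 0.
  have -> : (1 - t) * (p / m - 1) + t * (q / m - 1) = m / m - 1 by rewrite /m; ring.
  by rewrite divff ?gt_eqF// subrr.
rewrite !mulrDr; lra.
Qed.

(** On an interval that does not contain [y] in its interior the distance to [y] is affine, so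
    concavity of ln makes the kernel convex there. *)
Lemma lker_convex (b c t y : R) : -1 <= b -> b < c -> c <= 1 -> 0 < t < 1 ->
  -1 <= y <= 1 -> y <= b \/ c <= y ->
  (lker ((1 - t) * b + t * c)%R y <= (1 - t)%:E * lker b y + t%:E * lker c y)%E.
Proof.
move=> b1 bc c1 t01 y1 ybc; set a := (1 - t) * b + t * c.
have /andP[t0 t1] := t01; have s0 : 0 < 1 - t by rewrite subr_gt0.
have ab : b < a by rewrite /a -subr_gt0 (_ : _ - _ = t * (c - b)); [rewrite mulr_gt0// subr_gt0|ring].
have ac : a < c by rewrite /a -subr_gt0 (_ : _ - _ = (1 - t) * (c - b)); [rewrite mulr_gt0// subr_gt0|ring].
have [->|yb] := eqVneq b y.
  rewrite {2}/lker eqxx gt0_muley ?lte_fin// addye ?leey//.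
  by rewrite gt_eqF// (@lt_le_trans _ _ 0%E)// mule_ge0 ?lee_fin ?(ltW t0)// lker_ge0.
have [->|yc] := eqVneq c y.
  rewrite {3}/lker eqxx gt0_muley ?lte_fin// addey ?leey//.
  by rewrite gt_eqF// (@lt_le_trans _ _ 0%E)// mule_ge0 ?lee_fin ?(ltW s0)// lker_ge0.
have ay : a != y by apply/eqP => ay; case: ybc; lra.
rewrite /lker (negbTE yb) (negbTE yc) (negbTE ay) -!EFinM -EFinD lee_fin.
have b0 : 0 < `|b - y| by rewrite normr_gt0 subr_eq0.
have c0 : 0 < `|c - y| by rewrite normr_gt0 subr_eq0.
have E : `|a - y| = (1 - t) * `|b - y| + t * `|c - y|.
  case: ybc => h.
    have yb' : y < b by rewrite lt_neqAle eq_sym yb.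
    have [p1 p2 p3] : [/\ 0 < a - y, 0 < b - y & 0 < c - y] by split; lra.
    by rewrite (gtr0_norm p1) (gtr0_norm p2) (gtr0_norm p3) /a; ring.
  have yc' : c < y by rewrite lt_neqAle yc.
  have [p1 p2 p3] : [/\ a - y < 0, b - y < 0 & c - y < 0] by split; lra.
  by rewrite (ltr0_norm p1) (ltr0_norm p2) (ltr0_norm p3) /a; ring.
have := ln_concave2 b0 c0 t01; rewrite -E => lnE.
set u := ln 4 - ln `|b - y|; set v := ln 4 - ln `|c - y|.
have uM : u <= Num.max 0 u by rewrite le_max lexx orbT.
have vM : v <= Num.max 0 v by rewrite le_max lexx orbT.
have u0 : 0 <= Num.max 0 u by rewrite le_max lexx.
have v0 : 0 <= Num.max 0 v by rewrite le_max lexx.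
rewrite ge_max; apply/andP; split.
  by rewrite addr_ge0// mulr_ge0// ltW.
have := ler_wpM2l (ltW s0) uM; have := ler_wpM2l (ltW t0) vM.
rewrite {1}/u {1}/v; lra.
Qed.

Variables (K : set R) (P : probability R R).
Hypotheses (cK : compact K) (K11 : K `<=` [set x | -1 <= x <= 1]) (PK : P (~` K) = 0%E)
  (Pfin : (pen P < +oo)%E)
  (Pmin : forall nu : {measure set R -> \bar R}, is_prob_on K nu -> (pen P <= pen nu)%E).

(** The points of K where the bound holds form a compact set F that carries [P]. A point outside F
    with neighbours b < a < c in F inherits the bound by convexity of the kernel across the gap. If
    F lies on one side of a, its nearest point is closer than a to all of F. No general maximum
    principle for potentials is needed. *)
Lemma pot_le_energy (a : R) : -1 <= a <= 1 -> (pot P a <= pen P)%E.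
Proof.
move=> a1.
pose F := K `&` [set x | (pot P x <= pen P)%E].
have clF : closed [set x | (pot P x <= pen P)%E].
  have <- : (fine (pen P))%:E = pen P by rewrite fineK// ge0_fin_numE// pen_ge0.
  exact: pot_le_energy_closed.
have cF : compact F.
  by apply: (subclosed_compact _ cK); [apply: closedI => //; exact: compact_closed|move=> x []].
have mF : measurable F by exact: compact_measurable.
have PF : P (~` F) = 0%E.
  have B0 := pot_le_ae cK PK Pfin Pmin.
  have mB : measurable [set x | (pot P x > pen P)%E].
    rewrite -[X in measurable X]setTI.
    by apply: emeasurable_fun_o_infty => //; exact: measurable_pot.
  have mKc : measurable (~` K) by apply: measurableC; exact: compact_measurable.
  apply/eqP; rewrite -measure_le0.
  apply: (@le_trans _ _ (P (~` K `|` [set x | (pot P x > pen P)%E]))).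
    apply: le_measure; rewrite ?inE; [exact: measurableC|exact: measurableU|].
    move=> x nF; have [Kx|nKx] := pselect (K x); last by left.
    by right; rewrite /= ltNge; apply/negP => h; apply: nF.
  by rewrite (measureU0 mKc mB B0); move: PK => /eqP; rewrite eq_le => /andP[].
have [Fa|nFa] := pselect (F a); first by case: Fa.
have aF y : F y -> a != y by move=> Fy; apply/eqP => ay; apply: nFa; rewrite ay.
have bound (g : R -> \bar R) : measurable_fun setT g -> (forall y, 0 <= g y)%E ->
    (forall y, F y -> lker a y <= g y)%E -> (pot P a <= \int[P]_y g y)%E.
  move=> mg g0 h; apply: (ge0_le_integral_null mF PF) => //.
  - exact: measurable_lker_section.
  - by move=> y; exact: lker_ge0.
have one c : F c -> (forall y, F y -> `|c - y| <= `|a - y|) -> (pot P a <= pen P)%E.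
  move=> Fc h; apply: (@le_trans _ _ (pot P c)); last by case: Fc.
  apply: bound.
  - exact: measurable_lker_section.
  - by move=> y; exact: lker_ge0.
  - by move=> y Fy; apply: lker_le; [exact: aF|exact: h].
pose L := F `&` [set x | x <= a].
pose U := F `&` [set x | a <= x].
have cL : compact L.
  apply: (subclosed_compact _ cF); last by move=> x [].
  by apply: closedI; [exact: compact_closed|exact: closed_le].
have cU : compact U.
  apply: (subclosed_compact _ cF); last by move=> x [].
  by apply: closedI; [exact: compact_closed|exact: closed_ge].
have cid (A : set R) : {within A, continuous (@id R)}.
  by apply: continuous_subspaceT => x; exact: cvg_id.
have [L0|L0] := pselect (L !=set0); last first.
  have Fge y : F y -> a <= y.
    by move=> Fy; rewrite leNgt; apply/negP => ya; apply: L0; exists y; split => //=; exact: ltW.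
  have [U0|U0] := pselect (U !=set0).
    have [c] := compact_EVT_min U0 cU (cid U); rewrite inE => -[Fc /= ac] cmin.
    apply: (one c Fc) => y Fy; have ay := Fge _ Fy.
    have cy : c <= y by apply: cmin; rewrite inE.
    by rewrite !ler0_norm ?subr_le0//; lra.
  have F0 : F = set0.
    by apply/seteqP; split => // y Fy; apply: U0; exists y; split => //=; exact: Fge.
  move: PF; rewrite F0 setC0 => PT.
  by have := probability_setT P; rewrite PT => /eqP; rewrite eq_sym onee_eq0.
have [b] := compact_EVT_max L0 cL (cid L); rewrite inE => -[Fb /= ba] bmax.
have [U0|U0] := pselect (U !=set0); last first.
  apply: (one b Fb) => y Fy.
  have ya : y <= a.
    by rewrite leNgt; apply/negP => ay; apply: U0; exists y; split => //=; exact: ltW.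
  have yb : y <= b by apply: bmax; rewrite inE.
  by rewrite !ger0_norm ?subr_ge0//; lra.
have [c] := compact_EVT_min U0 cU (cid U); rewrite inE => -[Fc /= ac] cmin.
have {}ba : b < a by rewrite lt_neqAle ba andbT eq_sym; exact: aF.
have {}ac : a < c by rewrite lt_neqAle ac andbT; exact: aF.
have bc : 0 < c - b by rewrite subr_gt0 (lt_trans ba).
pose t := (a - b) / (c - b).
have t01 : 0 < t < 1.
  apply/andP; split; first by rewrite divr_gt0// subr_gt0.
  by rewrite ltr_pdivrMr// mul1r; lra.
have aE : a = (1 - t) * b + t * c by rewrite /t; field; rewrite gt_eqF.
have /andP[t0 t1] := t01; have s0 : 0 < 1 - t by rewrite subr_gt0.
have [/K11 /= /andP[b1 _] Ib] := Fb; have [/K11 /= /andP[_ c1] Ic] := Fc.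
have lb y : (0 <= lker b y)%E by exact: lker_ge0.
have lc y : (0 <= lker c y)%E by exact: lker_ge0.
have mb : measurable_fun setT (fun y => (1 - t)%:E * lker b y)%E.
  by apply: emeasurable_funM => //; exact: measurable_lker_section.
have mc : measurable_fun setT (fun y => t%:E * lker c y)%E.
  by apply: emeasurable_funM => //; exact: measurable_lker_section.
have pb y : (0 <= (1 - t)%:E * lker b y)%E by rewrite mule_ge0// lee_fin ltW.
have pc y : (0 <= t%:E * lker c y)%E by rewrite mule_ge0// lee_fin ltW.
apply: (@le_trans _ _ (\int[P]_y ((1 - t)%:E * lker b y + t%:E * lker c y))%E).
  apply: bound.
  - exact: emeasurable_funD.
  - by move=> y; rewrite adde_ge0.
  - move=> y Fy; rewrite aE; apply: lker_convex => //.
    + by rewrite (lt_trans ba).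
    + by have [/K11] := Fy.
    + have [ya|ya] := leP y a; [left; apply: bmax|right; apply: cmin]; rewrite inE; split => //=.
      exact: ltW.
rewrite (ge0_integralD P measurableT (fun x _ => pb x) mb (fun x _ => pc x) mc).
rewrite (ge0_integralZl P measurableT (measurable_lker_section b) (fun x _ => lb x)) ?lee_fin ?(ltW s0)//.
rewrite (ge0_integralZl P measurableT (measurable_lker_section c) (fun x _ => lc x)) ?lee_fin ?(ltW t0)//.
apply: (@le_trans _ _ ((1 - t)%:E * pen P + t%:E * pen P)%E).
  by rewrite leeD// lee_wpmul2l ?lee_fin ?(ltW s0) ?(ltW t0).
by rewrite -ge0_muleDl ?lee_fin ?(ltW s0) ?(ltW t0)// -EFinD subrK mul1e.
Qed.

End FrostmanPointwise.

(** * Comparison with the logarithmic energy *)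

Section EnergyPen.
Local Open Scope ereal_scope.
Variable R : realType.
Implicit Types (P : probability R R) (x y : R).

(** Stated without integrability, since energies of competitors may be infinite. *)
Lemma integral_ge0_subr P (f : R -> \bar R) (c : R) : measurable_fun setT f ->
  (forall x, 0 <= f x) -> (0 <= c)%R ->
  \int[P]_x (f x - c%:E) = \int[P]_x f x - c%:E.
Proof.
move=> mf f0 c0.
have cE : \int[P]_x (cst c%:E x) = c%:E.
  by rewrite integral_cst// [X in _ * X]probability_setT mule1.
have mfc : measurable_fun setT (fun x => f x - c%:E).
  by apply: emeasurable_funB => //; exact: measurable_cst.
have [ffin|] := ltP (\int[P]_x f x) +oo.
  have fi : P.-integrable setT f.
    apply/integrableP; split => //.
    by under eq_integral => x _ do rewrite gee0_abs//.
  have ci : P.-integrable setT (EFin \o cst c) by exact: finite_measure_integrable_cst.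
  by rewrite (integralB measurableT fi ci) -[in RHS]cE.
rewrite leye_eq => /eqP foo; rewrite foo integralE.
have neg : \int[P]_x ((fun x => f x - c%:E)^\- x) \is a fin_num.
  rewrite ge0_fin_numE; last by apply: integral_ge0.
  apply: (@le_lt_trans _ _ (\int[P]_x (cst c%:E x))); last by rewrite cE ltry.
  apply: ge0_le_integral => //.
  - exact: measurable_funeneg.
  - move=> x _; rewrite funenegE ge_max lee_fin c0 andbT oppeB ?fin_num_adde_defl//.
    by rewrite -[leRHS]add0e leeD2r// oppe_le0.
have pos : \int[P]_x ((fun x => f x - c%:E)^\+ x) = +oo.
  apply/eqP; rewrite -leye_eq.
  suff : +oo <= \int[P]_x ((fun x => f x - c%:E)^\+ x) + c%:E.
    by case: (\int[P]_x _).
  rewrite -foo -[X in _ <= _ + X]cE -ge0_integralD//; last exact: measurable_funepos.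
  apply: ge0_le_integral => //.
  - by apply: emeasurable_funD; [exact: measurable_funepos|exact: measurable_cst].
  - move=> x _ /=; rewrite -leeBlDr//; apply: (le_trans _ (lexx _)).
    by rewrite funeposE le_max lexx.
by rewrite pos; case: (\int[P]_x _) neg.
Qed.

(** The finite correction for which [logkernel = lker - lfar] holds on the whole line; it differs
    from ln 4 only at distances above 4. *)
Definition lfar x y : R := (ln 4 + Num.max 0 (ln `|x - y| - ln 4))%R.

Lemma logkernelE x y : logkernel x y = lker x y - (lfar x y)%:E.
Proof.
rewrite /logkernel /lker; case: ifP => // _; rewrite -EFinB /lfar; congr EFin.
move: (ln `|x - y|)%R => l; have [h|h] := leP (ln 4 - l)%R 0%R.
  by rewrite (max_idPr _) ?subr_ge0//; lra.
by rewrite (max_idPl _) ?subr_le0//; lra.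
Qed.

Lemma lfar_near x y : (-1 <= x <= 1)%R -> (-1 <= y <= 1)%R -> lfar x y = ln 4.
Proof.
move=> hx hy; rewrite /lfar; have [->|xy] := eqVneq x y.
  rewrite subrr normr0 (ln0 (lexx 0%R)) sub0r (max_idPl _) ?addr0// oppr_le0.
  by rewrite ln_ge0// ler1n.
rewrite (max_idPl _) ?addr0// subr_le0 ler_ln ?posrE ?normr_gt0 ?subr_eq0//.
by rewrite ler_norml; lra.
Qed.

Lemma measurable_logkernel : measurable_fun setT (fun z : R * R => logkernel z.1 z.2).
Proof.
under eq_fun do rewrite logkernelE.
apply: emeasurable_funB; first exact: measurable_lker.
apply/measurable_EFinP; apply: measurable_funD; first exact: measurable_cst.
apply: measurable_maxr; first exact: measurable_cst.
apply: measurable_funB; last exact: measurable_cst.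
apply: (@measurableT_comp _ _ _ _ _ _ (@ln R)); first exact: measurable_ln.
apply: (@measurableT_comp _ _ _ _ _ _ (@Num.norm R R)); first exact: normr_measurable.
by apply: measurable_funB; [exact: measurable_fst|exact: measurable_snd].
Qed.

Lemma measurable_logkernel_section x : measurable_fun setT (logkernel x).
Proof.
apply: (@measurableT_comp _ _ _ _ _ _ (fun z : R * R => logkernel z.1 z.2) _ (fun y => (x, y))).
  exact: measurable_logkernel.
exact: measurable_pair1.
Qed.

Lemma measurable_logpotential P : measurable_fun setT (fun x => \int[P]_y logkernel x y).
Proof.
pose L := fun z : R * R => logkernel z.1 z.2.
have -> : (fun x => \int[P]_y logkernel x y) =
    (fun x => fubini_F P (L^\+) x - fubini_F P (L^\-) x).
  apply/funext => x; rewrite integralE /fubini_F; congr (_ - _).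
    by apply: eq_integral => y _; rewrite !funeposE.
  by apply: eq_integral => y _; rewrite !funenegE.
apply: emeasurable_funB.
- by apply: measurable_fun_fubini_tonelli_F;
    [apply: measurable_funepos; exact: measurable_logkernel|move=> z; exact: funepos_ge0].
- by apply: measurable_fun_fubini_tonelli_F;
    [apply: measurable_funeneg; exact: measurable_logkernel|move=> z; exact: funeneg_ge0].
Qed.

Lemma energy_pen P : P (~` [set x | -1 <= x <= 1]%R) = 0 -> energy P = pen P - (ln 4)%:E.
Proof.
move=> P11; have l4 : (0 <= ln 4 :> R)%R by rewrite ln_ge0// ler1n.
have mI : measurable [set x : R | -1 <= x <= 1]%R.
  by have := @measurable_itv R `[-1, 1]%R; congr (measurable _).
have aeI (f g : R -> \bar R) : (forall x, (-1 <= x <= 1)%R -> f x = g x) ->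
    ae_eq P setT f g.
  move=> fg; exists (~` [set x : R | -1 <= x <= 1]%R); split => //.
  - exact: measurableC.
  - by move=> x /=; apply: contra_not => h _; exact: fg.
have inner x : (-1 <= x <= 1)%R -> \int[P]_y logkernel x y = pot P x - (ln 4)%:E.
  move=> hx; rewrite /pot -integral_ge0_subr//.
  - apply: ae_eq_integral => //.
    + exact: measurable_logkernel_section.
    + by apply: emeasurable_funB; [exact: measurable_lker_section|exact: measurable_cst].
    + by apply: aeI => y hy; rewrite logkernelE lfar_near.
  - exact: measurable_lker_section.
  - by move=> y; exact: lker_ge0.
rewrite /energy /pen -integral_ge0_subr//.
- apply: ae_eq_integral => //.
  + exact: measurable_logpotential.
  + by apply: emeasurable_funB; [exact: measurable_pot|exact: measurable_cst].
  + exact: aeI.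
- exact: measurable_pot.
- by move=> x; exact: pot_ge0.
Qed.

Lemma is_prob_on_itv (K : set R) (nu : {measure set R -> \bar R}) : compact K ->
  K `<=` [set x | -1 <= x <= 1]%R -> nu (~` K) = 0 -> nu (~` [set x | -1 <= x <= 1]%R) = 0.
Proof.
move=> cK K11 nK; apply/eqP; rewrite -measure_le0 -nK le_measure ?inE//.
- apply: measurableC.
  by have := @measurable_itv R `[-1, 1]%R; congr (measurable _).
- by apply: measurableC; exact: compact_measurable.
- exact: subsetC.
Qed.

Lemma energy_penE (K : set R) (nu : {measure set R -> \bar R}) : compact K ->
  K `<=` [set x | -1 <= x <= 1]%R -> is_prob_on K nu -> energy nu = pen nu - (ln 4)%:E.
Proof.
move=> cK K11 [nT nK]; have [P PE] := probability_of_measure nT.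
by rewrite -PE in nK *; exact/energy_pen/(is_prob_on_itv cK K11 nK).
Qed.

End EnergyPen.

(** * Potentials at regular end points *)

Section Endpoint.
Variable R : realType.

Lemma pot_le_trunc (nu : {measure set R -> \bar R}) (x : R) (c : \bar R) (n0 : nat) :
  (forall n, (n0 <= n)%N -> (\int[nu]_y (lker_trunc n x y)%:E <= c)%E) ->
  (pot nu x <= c)%E.
Proof.
move=> h.
have m n : measurable_fun setT (fun y => (lker_trunc n x y)%:E).
  apply/measurable_EFinP; apply: continuous_measurable_fun.
  exact: lker_trunc_continuous.
have ge0 n y : setT y -> (0 <= (lker_trunc n x y)%:E)%E.
  by move=> _; rewrite lee_fin lker_trunc_ge0.
have nd y : setT y -> {homo (fun n => (lker_trunc n x y)%:E) : n m / (n <= m)%N >-> (n <= m)%E}.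
  by move=> _ n k nk; rewrite lee_fin lker_trunc_nondecreasing.
have -> : pot nu x = limn (fun n => \int[nu]_y (lker_trunc n x y)%:E)%E.
  rewrite -(monotone_convergence nu measurableT m ge0 nd).
  by apply: eq_integral => y _; apply/esym/cvg_lim => //; exact: lker_trunc_cvg.
apply: lime_le.
  apply: ereal_nondecreasing_is_cvgn => n k nk.
  exact: (ge0_le_integral nu measurableT (ge0 n) (m n) (m k) (fun y _ => nd y I n k nk)).
by near=> n; apply: h; near: n; exists n0.
Unshelve. all: by end_near. Qed.

(** On [-1, 1] the truncated kernel at [x0] is the logarithmic kernel of a point off the line, to
    which [endpoint_barrier] applies. The cut-off at 0 is inactive since (x0 - x)^2 + e^2 <= 5 <=
    4^2; the shift ln 4 leaves this room. *)
Lemma lker_trunc_logdist2 (n : nat) (x0 x : R) : -1 <= x0 <= 1 -> -1 <= x <= 1 ->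
  lker_trunc n x0 x = ln 4 + - (1 / 2) * logdist2 (x0, n.+1%:R^-1) (x, 0).
Proof.
move=> hx0 hx; rewrite /lker_trunc /logdist2 /dist2 /=.
have -> : (x - x0) ^+ 2 + (0 - n.+1%:R^-1) ^+ 2 = (x0 - x) ^+ 2 + n.+1%:R^-1 ^+ 2 by ring.
set e : R := n.+1%:R^-1.
have e0 : 0 < e by rewrite invr_gt0.
have e1 : e <= 1 by rewrite invf_le1// ler1n.
set B := (x0 - x) ^+ 2 + e ^+ 2.
have B0 : 0 < B by rewrite ltr_wpDl ?sqr_ge0// exprn_gt0.
have B16 : B <= 4 ^+ 2 by rewrite /B; nra.
have : ln B <= ln (4 ^+ 2) by rewrite ler_ln ?posrE// exprn_gt0.
rewrite lnXn// mulr2n => h.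
by rewrite (max_idPr _); lra.
Qed.

Lemma dirichlet_solution_cst (K : set R) (c : R) :
  dirichlet_solution K (fun=> c) (fun=> c).
Proof.
split.
- by move=> y _; split; exact: superharmonic_at_cst.
- by exists `|c|.
- by move=> x _ eps e0; apply: filterE => y _; rewrite subrr normr0 ltW.
Qed.

(** The measure represents the value at a = (e (1 + t), 0) of the solution, as a functional of its
    boundary datum. Applied to truncated kernels, [endpoint_barrier] bounds its potential uniformly
    in n. *)
Lemma approximate_harmonic_measure (K : set R) (e eps : R) :
  compact K -> K `<=` [set x | -1 <= x <= 1] -> dirichlet_regular K ->
  e ^+ 2 = 1 -> K e -> K (- e) -> 0 < eps ->
  exists (om : {measure set R -> \bar R}) (t : R), [/\ 0 < t, is_prob_on K om &
    forall x0, K x0 -> (pot om x0 <= (ln 4 - ln `|e * (1 + t) - x0| + eps)%:E)%E].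
Proof.
move=> cK K11 regK e1 Ke KNe eps0.
have K11' : K `<=` `[-1, 1]%classic by move=> x /K11; rewrite /= in_itv.
have [h [m [A [sh m0 A0 hb]]]] := endpoint_barrier cK K11' regK e1 Ke KNe.
pose a t : R * R := (e * (1 + t), 0).
have E1 : e = 1 \/ e = -1.
  by move/eqP: e1; rewrite sqrf_eq1 => /orP[/eqP|/eqP]; [left|right].
have aK t : 0 < t -> ~ embedR K (a t).
  move=> t0 [/= /K11 /= /andP[a1 a2] _]; case: E1 => E; rewrite E in a1 a2; lra.
have ha (d : R) : 0 < d -> exists2 t1 : R, 0 < t1 & forall t, 0 < t < t1 -> 1 - d <= h (a t).
  move=> d0; have [_ _ lh] := sh; have [r r0 hr] := nbhs_box (lh _ Ke _ d0).
  exists r => // t /andP[t0 tr]; have := hr (a t).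
  rewrite /= subrr normr0 => /(_ _ r0 (aK _ t0)).
  have -> : e * (1 + t) - e = e * t by ring.
  rewrite normrM (gtr0_norm t0).
  have -> : `|e| = 1 by case: E1 => ->; rewrite ?normrN normr1.
  by rewrite mul1r -expr2 e1 => /(_ tr); rewrite ler_norml => /andP[+ _]; lra.
(* 1/8 keeps h(a) above 3/4, and [eps / (A + 1)] gives A (1 - h(a)) <= eps. *)
pose d := Num.min (1 / 8) (eps / (A + 1)).
have d0 : 0 < d by rewrite lt_min divr_gt0//= divr_gt0// ltr_wpDl.
have [t1 t10 ht1] := ha _ d0.
pose t := Num.min (t1 / 2) (Num.min 1 (eps / 2)).
have t0 : 0 < t by rewrite !lt_min ltr01 !divr_gt0.
have tt1 : t < t1.
  by rewrite (le_lt_trans (_ : _ <= t1 / 2)) ?ge_min ?lexx// ltr_pdivrMr// ltr_pMr// ltr1n.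
have te : t <= eps / 2 by rewrite !ge_min lexx !orbT.
have hat : 1 - d <= h (a t) by apply: ht1; rewrite t0.
have d8 : d <= 1 / 8 by rewrite ge_min lexx.
have dA : A * d <= eps.
  apply: (@le_trans _ _ (A * (eps / (A + 1)))).
    by rewrite ler_wpM2l// ge_min lexx orbT.
  by rewrite mulrA ler_pdivrMr ?ltr_wpDl// mulrC; nra.
have h34 : 3 / 4 < h (a t) by lra.
(* A solution is chosen for each datum. Linearity and monotonicity in the datum come from
   comparison, not from the choice. *)
have [S hS] : exists S : (R -> R) -> (R * R -> R),
    forall f, continuous f -> dirichlet_solution K f (S f).
  pose T (f : R -> R) (k : R * R -> R) := continuous f -> dirichlet_solution K f k.
  suff /choice[S hS] : forall f, exists k, T f k by exists S.
  move=> f; rewrite /T.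
  have [cf|ncf] := pselect (continuous f).
    by have [k sk] := regular_dirichlet_solution cK regK cf; exists k.
  by exists (fun=> 0).
have K0 : K !=set0 by exists e.
have nKa := aK _ t0.
pose Lam f := S f (a t).
have [|||om [pom omE]] := @riesz_representation R K Lam cK K11'.
- move=> f g c [cf bf] [cg bg].
  have [cfg _] := bounded_continuousZD c (conj cf bf) (conj cg bg).
  have s1 := hS _ cfg; have s2 := dirichlet_solutionZD c (hS _ cf) (hS _ cg).
  apply/eqP; rewrite eq_le; apply/andP; split.
    exact: (dirichlet_solution_le cK K0 s1 s2).
  exact: (dirichlet_solution_le cK K0 s2 s1).
- move=> f g [cf _] [cg _] fg.
  exact: (dirichlet_solution_le cK K0 (hS _ cf) (hS _ cg) fg).
- have c1 : continuous (fun _ : R => 1 : R) by move=> x; exact: cvg_cst.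
  have s1 := hS _ c1; have s2 := @dirichlet_solution_cst K 1.
  apply/eqP; rewrite eq_le; apply/andP; split.
    exact: (dirichlet_solution_le cK K0 s1 s2).
  exact: (dirichlet_solution_le cK K0 s2 s1).
exists om, t; split => // x0 Kx0.
have [n0 hn0] : exists n0 : nat, n0.+1%:R^-1 ^+ 2 <= m.
  pose N := Num.truncn (m^-1); exists N.
  have e0 : 0 < N.+1%:R^-1 :> R by rewrite invr_gt0.
  have le1 : N.+1%:R^-1 <= 1 :> R by rewrite invf_le1// ler1n.
  apply: (@le_trans _ _ N.+1%:R^-1); first by rewrite expr2 ler_piMl// ltW.
  by rewrite -[leRHS]invrK lef_pV2 ?posrE ?invr_gt0// ltW// truncnS_gt.
apply: (@pot_le_trunc _ _ _ n0) => n nn0.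
rewrite (omE _ n.+1%:R); [|exact: bounded_continuous_lker_trunc|].
  2: by move=> x y; exact: lker_trunc_lipschitz.
pose en : R := n.+1%:R^-1.
have en0 : 0 < en by rewrite invr_gt0.
have enm : en ^+ 2 <= m.
  apply: le_trans hn0; rewrite ler_pXn2r ?nnegrE ?invr_ge0//.
  by rewrite lef_pV2 ?posrE// ler_nat.
pose z : R * R := (x0, en).
have nKz : ~ embedR K z by move=> [_ /= en00]; move: en0; rewrite en00 ltxx.
have cz : continuous (fun x : R => logdist2 z (x, 0)).
  move=> x; rewrite /logdist2.
  have p0 : 0 < dist2 (x, 0) z.
    by apply: dist2_gt0; apply/eqP => xz; move: en0; rewrite -[en]/(z.2) -xz ltxx.
  apply: (@continuous_cvg _ _ _ (nbhs x) _ (fun x : R => dist2 (x, 0) z) (@ln R)).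
    exact: continuous_ln.
  rewrite /dist2 /=; apply: cvgD; last exact: cvg_cst.
  rewrite expr2; under eq_fun do rewrite expr2.
  by apply: cvgM; (apply: cvgB; [exact: cvg_id|exact: cvg_cst]).
have su := hS _ cz.
have az : a t != z.
  by apply/eqP => xz; move: en0; rewrite -[en]/(z.2) -xz ltxx.
have near_z : exists2 x, K x & dist2 z (x, 0) <= m.
  by exists x0 => //; rewrite /dist2/= subrr expr0n/= add0r subr0.
have := hb z nKz near_z _ su (a t) nKa az h34 => ub.
have sf := hS _ (@lker_trunc_continuous _ n x0).
have s2 := dirichlet_solutionZD (- (1 / 2)) (dirichlet_solution_cst K (ln 4)) su.
have : Lam (lker_trunc n x0) <= ln 4 + - (1 / 2) * S (fun x => logdist2 z (x, 0)) (a t).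
  apply: (dirichlet_solution_le cK K0 sf s2) => // x Kx.
  by rewrite lker_trunc_logdist2//; [exact: K11|exact: K11].
move=> le1; rewrite lee_fin; apply: (le_trans le1).
have l1 : 2 * ln `|e * (1 + t) - x0| <= logdist2 z (a t).
  have n0' : 0 < `|e * (1 + t) - x0|.
    rewrite normr_gt0 subr_eq0; apply/eqP => E; apply: nKa.
    by split => //=; rewrite E.
  rewrite mulr_natl -lnXn// real_normK ?num_real// ler_ln ?posrE; last 2 first.
  - by rewrite -real_normK ?num_real// exprn_gt0.
  - exact: dist2_gt0.
  by rewrite /dist2 /= lerDl sqr_ge0.
have l2 : logdist2 (- e, 0) (a t) - ln 4 <= eps.
  have -> : logdist2 (- e, 0) (a t) = 2 * ln (2 + t).
    rewrite /logdist2 /dist2 /= subrr expr0n/= addr0 mulr_natl -lnXn; last lra.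
    congr ln.
    have -> : (e * (1 + t) - - e) ^+ 2 = e ^+ 2 * (2 + t) ^+ 2 by ring.
    by rewrite e1 mul1r.
  have -> : 2 + t = 2 * (1 + t / 2) by field.
  rewrite lnM ?posrE//; last lra.
  have -> : ln 4 = 2 * ln 2 :> R.
    by rewrite mulr_natl -lnXn//; congr ln; ring.
  have : ln (1 + t / 2) <= t / 2 by apply: le_ln1Dx; lra.
  lra.
have : A * (1 - h (a t)) <= A * d by rewrite ler_wpM2l//; lra.
lra.
Qed.

(** Harmonic measure seen from 1 + t has a bounded potential on K, because K stays at distance at
    least t from that point. *)
Lemma regular_finite_energy (K : set R) : compact K ->
  K `<=` [set x | -1 <= x <= 1] -> dirichlet_regular K -> K 1 -> K (-1) ->
  exists2 nu : {measure set R -> \bar R}, is_prob_on K nu & (pen nu < +oo)%E.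
Proof.
move=> cK K11 regK K1 KN1.
have [om [t [t0 pom hom]]] :=
  approximate_harmonic_measure cK K11 regK (expr1n _ _) K1 KN1 ltr01.
exists om => //; have [omT omK] := pom.
have [P PE] := probability_of_measure omT.
have mK : measurable K by exact: compact_measurable.
pose c := `|ln 4 - ln t + 1|.
apply: (@le_lt_trans _ _ (\int[om]_x (cst c%:E x))%E).
  rewrite -PE in omK hom *.
  apply: (ge0_le_integral_null mK omK (measurable_pot P) (measurable_cst _) (@pot_ge0 _ P)).
  - by move=> x; rewrite lee_fin normr_ge0.
  - move=> x Kx; apply: (le_trans (hom _ Kx)).
    rewrite lee_fin; apply: le_trans (ler_norm _).
    rewrite lerD2r lerD2l lerN2.
    have := K11 _ Kx => /= /andP[x1 x2].
    have p : 0 < 1 * (1 + t) - x by rewrite mul1r; lra.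
    by rewrite (gtr0_norm p) ler_ln ?posrE//; lra.
by rewrite integral_cst// omT mule1 ltry.
Qed.

(** Harmonic measure Q serves as competitor: the energy of P is at most the integral of its
    potential against Q, which by symmetry is the integral of the potential of Q against P. The
    latter potential is at most the kernel at [e] plus [eps], as points of K are no farther from e
    than from e (1 + t). *)
Lemma endpoint_pot_ge (K : set R) (P : probability R R) (e : R) : compact K ->
  K `<=` [set x | -1 <= x <= 1] -> dirichlet_regular K ->
  e ^+ 2 = 1 -> K e -> K (- e) -> P (~` K) = 0%E -> (pen P < +oo)%E ->
  (forall nu : {measure set R -> \bar R}, is_prob_on K nu -> (pen P <= pen nu)%E) ->
  (pen P <= pot P e)%E.
Proof.
move=> cK K11 regK e1 Ke KNe PK Pfin Pmin.
apply/lee_addgt0Pr => eps eps0.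
have [om [t [t0 [omT omK] hom]]] :=
  approximate_harmonic_measure cK K11 regK e1 Ke KNe eps0.
have [Q QE] := probability_of_measure omT; rewrite -QE in omK hom.
have mK : measurable K by exact: compact_measurable.
have E1 : e = 1 \/ e = -1.
  by move/eqP: e1; rewrite sqrf_eq1 => /orP[/eqP|/eqP]; [left|right].
have far x : K x ->
  0 < `|e * (1 + t) - x| /\ t <= `|e * (1 + t) - x| /\ `|e - x| <= `|e * (1 + t) - x|.
  move=> /K11 /= /andP[x1 x2]; case: E1 => ->.
    have [p1 p2] : 0 <= 1 * (1 + t) - x /\ 0 <= 1 - x by split; lra.
    by rewrite (ger0_norm p1) (ger0_norm p2); split; [lra|split; lra].
  have [p1 p2] : -1 * (1 + t) - x <= 0 /\ -1 - x <= 0 by split; lra.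
  by rewrite (ler0_norm p1) (ler0_norm p2); split; [lra|split; lra].
have Qfin : (pen Q < +oo)%E.
  pose c := `|ln 4 - ln t + eps|.
  apply: (@le_lt_trans _ _ (\int[Q]_x (cst c%:E x))%E).
    apply: (ge0_le_integral_null mK omK (measurable_pot Q) (measurable_cst _) (@pot_ge0 _ Q)).
    - by move=> x; rewrite lee_fin normr_ge0.
    - move=> x Kx; apply: (le_trans (hom _ Kx)).
      rewrite lee_fin; apply: le_trans (ler_norm _).
      have [p0 [pt _]] := far _ Kx.
      by rewrite lerD2r lerD2l lerN2 ler_ln ?posrE.
  by rewrite integral_cst// [X in (_ * X)%E]probability_setT mule1 ltry.
apply: (@le_trans _ _ (\int[Q]_x pot P x)%E).
  exact: (pot_variation PK Pfin Pmin omK Qfin).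
rewrite integral_pot_sym.
have lk x : (0 <= lker e x)%E by exact: lker_ge0.
have e0 (x : R) : (0 <= cst eps%:E x)%E by rewrite lee_fin ltW.
apply: (@le_trans _ _ (\int[P]_x (lker e x + cst eps%:E x))%E).
  have ms : measurable_fun setT (fun x => lker e x + cst eps%:E x)%E.
    by apply: emeasurable_funD => //; exact: measurable_lker_section.
  apply: (ge0_le_integral_null mK PK (measurable_pot Q) ms (@pot_ge0 _ Q)).
  - by move=> x; rewrite adde_ge0.
  - move=> x Kx; apply: (le_trans (hom _ Kx)).
    have [p0 [_ pe]] := far _ Kx.
    rewrite EFinD leeD2r// /lker; case: eqVneq => [_|ex]; first exact: leey.
    rewrite lee_fin le_max; apply/orP; right.
    by rewrite lerD2l lerN2 ler_ln ?posrE// normr_gt0 subr_eq0.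
rewrite (ge0_integralD P measurableT (fun x _ => lk x) (measurable_lker_section e) (fun x _ => e0 x))//.
by rewrite integral_cst// [X in (_ * X)%E]probability_setT mule1.
Qed.

End Endpoint.

(** * Laguerre polynomials *)

Section Laguerre.
Variable R : realType.
Implicit Types (m k : nat) (x : R).

Definition laguerre m : {poly R} :=
  \poly_(k < m.+1) ((-1) ^+ k * 'C(m, k)%:R / k`!%:R).

Lemma coef_laguerre m k : (laguerre m)`_k = (-1) ^+ k * 'C(m, k)%:R / k`!%:R.
Proof.
rewrite coef_poly; case: ifPn => //; rewrite -leqNgt => mk.
by rewrite bin_small// mulr0 mul0r.
Qed.

Lemma laguerre0 : laguerre 0 = 1.
Proof.
apply/polyP => k; rewrite coef_laguerre coef1; case: k => [|k].
  by rewrite bin0 expr0 fact0 mul1r divr1.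
by rewrite bin_small// mulr0 mul0r.
Qed.

Lemma deriv_laguerreS m : (laguerre m.+1)^`() = (laguerre m)^`() - laguerre m.
Proof.
apply/polyP => k; rewrite coefB !coef_deriv !coef_laguerre binS natrD.
have : k`!%:R != 0 :> R by rewrite pnatr_eq0 -lt0n fact_gt0.
have : k.+1%:R != 0 :> R by rewrite pnatr_eq0.
rewrite factS natrM exprS -[LHS]mulr_natr -[X in X - _]mulr_natr.
move: k.+1%:R k`!%:R ((-1) ^+ k) 'C(m, k.+1)%:R 'C(m, k)%:R => n f e u v n0 f0.
by field; rewrite ?n0 ?f0.
Qed.

Lemma laguerre_at0 m : (laguerre m).[0] = 1.
Proof. by rewrite horner_coef0 coef_laguerre bin0 expr0 fact0 mul1r divr1. Qed.

Lemma size_laguerre m : size (laguerre m) = m.+1.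
Proof.
by rewrite size_poly_eq// binn mulr1 mulf_neq0 ?signr_eq0// invr_neq0// pnatr_eq0 -lt0n fact_gt0.
Qed.

Lemma lead_coef_laguerre m : `|lead_coef (laguerre m)| = m`!%:R^-1.
Proof.
rewrite lead_coefE size_laguerre coef_laguerre binn mulr1 normrM normrX normrN normr1 expr1n mul1r.
by rewrite ger0_norm// invr_ge0.
Qed.

(** S_m = 1 + sum over 1 <= k <= m of (L_k - L_(k-1))^2, an auxiliary polynomial between L_m^2 / (m
    + 1) and exp x on the half line x >= 0. *)
Fixpoint laguerre_sqsum m : {poly R} :=
  if m is k.+1 then laguerre_sqsum k + (laguerre k.+1 - laguerre k) ^+ 2 else 1.

(** As L_k - L_(k-1) has derivative - L_(k-1), each summand contributes L_(k-1)^2 - L_k^2 and the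
    sum telescopes. Consequently exp (- x) S_m(x) is nonincreasing, with value 1 at 0. *)
Lemma deriv_laguerre_sqsum m :
  (laguerre_sqsum m)^`() - laguerre_sqsum m = - (laguerre m) ^+ 2.
Proof.
elim: m => [|m ih] /=; first by rewrite laguerre0 derivC sub0r expr1n.
rewrite derivD deriv_exp derivB deriv_laguerreS /= expr1.
have -> : (laguerre m)^`() - laguerre m - (laguerre m)^`() = - laguerre m by ring.
have -> : (laguerre_sqsum m)^`() = laguerre_sqsum m - (laguerre m) ^+ 2 by rewrite -ih; ring.
by rewrite -mulr_natl; ring.
Qed.

Lemma laguerre_sqsum_at0 m : (laguerre_sqsum m).[0] = 1.
Proof.
elim: m => [|m ih] /=; first by rewrite hornerC.
by rewrite hornerD ih horner_exp hornerD hornerN !laguerre_at0 subrr expr0n addr0.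
Qed.

(** The Cauchy-Schwarz inequality for L_m = 1 + sum of (L_k - L_(k-1)), which has m + 1 terms,
    proved by induction. *)
Lemma laguerre_sq_le_sqsum m x :
  (laguerre m).[x] ^+ 2 <= m.+1%:R * (laguerre_sqsum m).[x].
Proof.
elim: m => [|m ih]; first by rewrite laguerre0 /= hornerC mulr1 expr1n.
rewrite /= hornerD horner_exp hornerD hornerN.
move: ih; move: (laguerre m).[x] (laguerre m.+1).[x] (laguerre_sqsum m).[x] => a b s ih.
have n0 : 0 < m.+1%:R :> R by [].
rewrite -natr1; move: m.+1%:R n0 ih => n n0 ih.
have h : 0 <= (a - n * (b - a)) ^+ 2 / n by rewrite divr_ge0 ?sqr_ge0// ltW.
have h2 : a ^+ 2 / n <= s by rewrite ler_pdivrMr// mulrC.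
have E : (n + 1) * (b - a) ^+ 2 + a ^+ 2 + a ^+ 2 / n - b ^+ 2 =
   (a - n * (b - a)) ^+ 2 / n by field; rewrite gt_eqF.
have := E; rewrite mulrDr mulrDl mul1r; lra.
Qed.

Lemma laguerre_sqsum_le m x : 0 <= x -> (laguerre_sqsum m).[x] <= expR x.
Proof.
move=> x0; pose S := laguerre_sqsum m.
pose f (y : R) := expR (- y) * S.[y].
have df (y : R) : is_derive y 1 f (- (expR (- y) * (laguerre m).[y] ^+ 2)).
  have -> : - (expR (- y) * (laguerre m).[y] ^+ 2) =
      expR (- y) * S^`().[y] + S.[y] * (expR (- y) * -1).
    have -> : (laguerre m).[y] ^+ 2 = S.[y] - S^`().[y].
      have := congr1 (horner^~ y) (deriv_laguerre_sqsum m).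
      by rewrite /= hornerD !hornerN horner_exp -/S => h; rewrite -[LHS]opprK -h; ring.
    ring.
  have d1 : is_derive y 1 (fun y => expR (- y)) (expR (- y) * -1).
    have := @is_derive1_comp R expR (fun s : R => - s) y (expR (- y)) (-1).
    by apply; exact: is_deriveNid.
  have d2 : is_derive y 1 (horner S) (S^`().[y]) by exact: is_derive_poly.
  by have := is_deriveM d1 d2.
have [x00|xn0] := eqVneq x 0.
  by rewrite x00 laguerre_sqsum_at0 expR0.
have xp : 0 < x by rewrite lt_neqAle eq_sym xn0.
have cf : {within `[0, x], continuous f}.
  by apply: derivable_within_continuous => y _; apply: ex_derive; exact: df.
have [c _] := @MVT _ f (fun y => - (expR (- y) * (laguerre m).[y] ^+ 2)) 0 x xp (fun y _ => df y) cf.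
rewrite subr0 /f oppr0 expR0 mul1r laguerre_sqsum_at0 => E.
have h : expR (- x) * S.[x] <= 1.
  have : 0 <= expR (- c) * (laguerre m).[c] ^+ 2 * x.
    by rewrite mulr_ge0 ?(ltW xp)// mulr_ge0 ?sqr_ge0 ?expR_ge0.
  by move: E; lra.
have := ler_wpM2l (expR_ge0 x) h.
by rewrite mulrA -expRD subrr expR0 mul1r mulr1.
Qed.

Lemma laguerre_sq_le m x : 0 <= x -> (laguerre m).[x] ^+ 2 <= m.+1%:R * expR x.
Proof.
move=> x0; apply: (le_trans (laguerre_sq_le_sqsum _ _)).
by rewrite ler_wpM2l// laguerre_sqsum_le.
Qed.

(** The elementary half of Stirling's formula, m! <= e m (m / e)^m; the induction step is ln (n / (n
    + 1)) <= - 1 / (n + 1). *)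
Lemma ln_fact_le m : (0 < m)%N ->
  ln m`!%:R <= m%:R * ln m%:R - m%:R + 1 + ln m%:R :> R.
Proof.
elim: m => // -[|m] ih _.
  by rewrite factS fact0 muln1 ln1; lra.
have n0 : 0 < m.+1%:R :> R by [].
rewrite factS natrM lnM ?posrE// ?ltr0n ?fact_gt0//.
have {}ih := ih isT.
move: ih; have -> : m.+2%:R = m.+1%:R + 1 :> R by rewrite natr1.
move: m.+1%:R (ln m.+1`!%:R) n0 => n f n0 ih.
have n1 : 0 < n + 1 by rewrite addr_gt0.
have h : ln n - ln (n + 1) <= - (n + 1)^-1.
  rewrite -ln_div ?posrE//.
  have E : n / (n + 1) = 1 + - (n + 1)^-1 by field; rewrite gt_eqF.
  by rewrite [X in ln X]E; apply: le_ln1Dx; rewrite ltrN2 invf_lt1// ltrDr.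
have := ler_wpM2l (ltW n1) h; rewrite mulrN divff ?gt_eqF//; lra.
Qed.

End Laguerre.

(** * Lower bounds for polynomials by products over points of [-1, 1] *)

Section RootLowerBound.
Variable R : realType.
Import complex ComplexField Normc.

Lemma normc_real (x : R) : normc (real_complex R x) = `|x|.
Proof. by rewrite /= expr0n/= addr0 sqrtr_sqr. Qed.

Lemma normc_ge_Re_dist (x : R) (z : complex R) : `|x - Re z| <= normc (real_complex R x - z).
Proof.
case: z => a b /=; rewrite -sqrtr_sqr ler_sqrt; first by rewrite lerDl sqr_ge0.
by rewrite addr_ge0 ?sqr_ge0.
Qed.

Lemma clamp_dist (x y : R) : -1 <= x <= 1 ->
  `|x - Num.max (-1) (Num.min 1 y)| <= `|x - y|.
Proof.
move=> /andP[x1 x2]; have [y1|y1] := leP y 1.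
  have [//|yN] := leP (-1) y.
  by rewrite !ger0_norm; lra.
rewrite (max_idPr _); last by lra.
by rewrite !ler0_norm; lra.
Qed.

(* The roots over [R[i]] are replaced by their real parts, clamped to [-1, 1]. *)
Lemma poly_ge_prod_roots (p : {poly R}) : p != 0 ->
  exists a : seq R, [/\ size a = (size p).-1, all (fun y => -1 <= y <= 1) a &
    forall x, -1 <= x <= 1 -> `|lead_coef p| * \prod_(y <- a) `|x - y| <= `|p.[x]|].
Proof.
move=> p0.
have [r rE] := closed_field_poly_normal (map_poly (real_complex R) p).
pose cl y : R := Num.max (-1) (Num.min 1 y).
exists [seq cl (Re z) | z <- r]; split.
- rewrite size_map.
  have := congr1 (fun q : {poly complex R} => size q) rE.
  rewrite size_map_poly size_scale; last by rewrite lead_coef_eq0 map_poly_eq0.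
  by rewrite size_prod_XsubC => ->.
- apply/allP => _ /mapP[z _ ->]; rewrite /cl le_max lexx/= ge_max ge_min lexx orTb andbT.
  by lra.
- move=> x hx; rewrite big_map.
  have -> : `|p.[x]| = `|lead_coef p| * \prod_(z <- r) normc (real_complex R x - z).
    rewrite -!normc_real -horner_map rE hornerZ horner_prod normcM lead_coef_map.
    congr (_ * _); elim: r {rE} => [|z r ih]; first by rewrite !big_nil normc1.
    by rewrite !big_cons normcM ih hornerXsubC.
  rewrite ler_wpM2l//; elim: r {rE} => [|z r ih]; first by rewrite !big_nil.
  rewrite !big_cons ler_pM//; first by rewrite prodr_ge0.
  by rewrite (le_trans (clamp_dist _ hx))// normc_ge_Re_dist.
Qed.

End RootLowerBound.

(** * Nonnegative polynomials on K *)

Section PolyIntegral.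
Variables (R : realType) (K : set R) (P : probability R R) (i : R).
Hypotheses (cK : compact K) (K11 : K `<=` [set x | -1 <= x <= 1]) (PK : P (~` K) = 0%E)
  (poti : forall a : R, -1 <= a <= 1 -> (pot P a <= i%:E)%E).

Lemma lker_sum_ge (a : seq R) (x : R) : x \notin a ->
  ((\sum_(y <- a) (ln 4 - ln `|x - y|))%:E <= \sum_(y <- a) lker y x)%E.
Proof.
elim: a => [|y a ih]; first by rewrite !big_nil.
rewrite inE negb_or => /andP[xy xa]; rewrite !big_cons EFinD leeD// ?ih//.
by rewrite /lker eq_sym (negbTE xy) lee_fin le_max distrC lexx orbT.
Qed.

Lemma lker_sum_eqy (a : seq R) (x : R) : x \in a -> (\sum_(y <- a) lker y x = +oo)%E.
Proof.
elim: a => // y a ih; rewrite inE big_cons => /orP[/eqP <-|xa].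
  rewrite {1}/lker eqxx addye// gt_eqF// (@lt_le_trans _ _ 0%E)//.
  by apply: sume_ge0 => z _; exact: lker_ge0.
by rewrite ih// addey// gt_eqF// (@lt_le_trans _ _ 0%E)// lker_ge0.
Qed.

Lemma ln_prod_dist (a : seq R) (x : R) : x \notin a ->
  0 < \prod_(y <- a) `|x - y| /\
  ln (\prod_(y <- a) `|x - y|) = \sum_(y <- a) ln `|x - y|.
Proof.
elim: a => [|y a ih]; first by rewrite !big_nil ln1.
rewrite inE negb_or => /andP[xy /ih[p0 pE]]; rewrite !big_cons.
have xy0 : 0 < `|x - y| by rewrite normr_gt0 subr_eq0.
by split; [exact: mulr_gt0|rewrite lnM ?posrE// pE].
Qed.

Variables (Q : {poly R}) (N : nat) (c : R).
Hypotheses (sQ : size Q = N.+1) (N0 : (0 < N)%N) (lQ : `|lead_coef Q| = 1)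
  (Q0 : forall x, K x -> 0 <= Q.[x]) (c0 : 0 < c)
  (Qc : (\int[P]_x `|Q.[x]|%:E <= c%:E)%E).

(** The inequality for ln |L_m(s Q)| is integrated with the kernel terms moved to the right, so that
    all integrands are nonnegative: at one of the points of [a] the right-hand side is plus
    infinity, and integrability of ln |L_m(s Q)| never arises. Since [a] lies in [-1, 1], Frostman's
    bound applies to each term. *)
Lemma laguerre_energy_bound (m : nat) (s : R) : 0 < s ->
  m%:R * ln s - ln m`!%:R + (m * N)%:R * ln 4 - ln m.+1%:R / 2 <=
  s / 2 * c + (m * N)%:R * i.
Proof.
move=> s0; set kappa := (X in X <= _).
have sN : size (s *: Q) = N.+1 by rewrite size_scale ?gt_eqF.
pose p := laguerre R m \Po (s *: Q).
have sp : (size p).-1 = (m * N)%N.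
  by rewrite /p size_comp_poly size_laguerre sN.
have lp : `|lead_coef p| = s ^+ m / m`!%:R.
  rewrite /p lead_coef_comp ?sN// normrM lead_coef_laguerre size_laguerre /= normrX.
  by rewrite lead_coefZ normrM lQ mulr1 gtr0_norm// mulrC.
have f0 : 0 < m`!%:R :> R by rewrite ltr0n fact_gt0.
have lp0 : 0 < `|lead_coef p| by rewrite lp divr_gt0// exprn_gt0.
have pn0 : p != 0 by rewrite -lead_coef_eq0 -normr_gt0.
have [a [sa a11 aE]] := poly_ge_prod_roots pn0.
have lk x : (forall y, 0 <= lker y x)%E by move=> y; exact: lker_ge0.
have pointwise x : K x ->
    (kappa%:E <= (s / 2)%:E * `|Q.[x]|%:E + \sum_(y <- a) lker y x)%E.
  move=> Kx; have x11 := K11 Kx.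
  have [xa|xa] := boolP (x \in a).
    by rewrite (lker_sum_eqy xa) addey ?leey// -EFinM.
  apply: le_trans (leeD2l _ (lker_sum_ge xa)); rewrite -EFinM -EFinD lee_fin.
  have [pr0 prE] := ln_prod_dist xa.
  have h1 := aE _ x11.
  have px : p.[x] = (laguerre R m).[s * Q.[x]] by rewrite /p horner_comp hornerZ.
  have p0 : 0 < `|p.[x]| by apply: lt_le_trans h1; exact: mulr_gt0.
  have h2 : ln (`|lead_coef p| * \prod_(y <- a) `|x - y|) <= ln `|p.[x]|.
    by rewrite ler_ln ?posrE// mulr_gt0.
  have h3 : 2 * ln `|p.[x]| <= ln m.+1%:R + s * Q.[x].
    rewrite mulr_natl -lnXn// real_normK ?num_real//.
    rewrite -[X in _ <= _ + X]expRK -lnM ?posrE ?expR_gt0// ler_ln ?posrE.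
    - by rewrite px laguerre_sq_le// mulr_ge0 ?Q0// ltW.
    - by rewrite -real_normK ?num_real// exprn_gt0.
    - by rewrite mulr_gt0 ?expR_gt0.
  rewrite lnM ?posrE// prE lp ln_div ?posrE ?exprn_gt0// lnXn// in h2.
  rewrite ger0_norm ?Q0// sumrB big_const_seq count_predT sa sp iter_addr_0.
  rewrite -(mulr_natl (ln s)) in h2.
  rewrite -(mulr_natl (ln 4)) /kappa.
  move: (ln m`!%:R) (\sum_(y <- a) _) (ln m.+1%:R) h2 h3 => F S T h2 h3; lra.
have mQ : measurable_fun setT (fun x => `|Q.[x]|%:E).
  apply/measurable_EFinP; apply: (@measurableT_comp _ _ _ _ _ _ (@Num.norm R R)).
    exact: normr_measurable.
  by apply: continuous_measurable_fun; exact: continuous_horner.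
have mS : measurable_fun setT (fun x => \sum_(y <- a) lker y x)%E.
  by apply: emeasurable_sum => y; exact: measurable_lker_section.
have q0 x : (0 <= (s / 2)%:E * `|Q.[x]|%:E)%E.
  by rewrite mule_ge0// lee_fin ?divr_ge0// ltW.
have S0 x : (0 <= \sum_(y <- a) lker y x)%E by apply: sume_ge0 => y _; exact: lker_ge0.
(* For kappa <= 0 the claim is trivial; otherwise the constant kappa is itself a nonnegative
   integrand. *)
have [k0|k0] := leP kappa 0.
  have i0 : 0 <= i.
    by rewrite -lee_fin; apply: (le_trans (pot_ge0 P 0)); apply: poti; lra.
  by apply: (le_trans k0); rewrite addr_ge0 ?mulr_ge0// ?invr_ge0 ltW.
have mK : measurable K by exact: compact_measurable.
have mqs : measurable_fun setT (fun x => (s / 2)%:E * `|Q.[x]|%:E)%E by exact: emeasurable_funM.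
have : (\int[P]_x cst kappa%:E x <= \int[P]_x ((s / 2)%:E * `|Q.[x]|%:E + \sum_(y <- a) lker y x))%E.
  apply: (ge0_le_integral_null mK PK (measurable_cst _)).
  - exact: emeasurable_funD.
  - by move=> x; rewrite lee_fin ltW.
  - by move=> x; rewrite adde_ge0.
  - exact: pointwise.
rewrite integral_cst// [X in (_ * X)%E]probability_setT mule1.
rewrite (ge0_integralD P measurableT (fun x _ => q0 x) mqs (fun x _ => S0 x) mS).
rewrite (ge0_integralZl P measurableT mQ) => [||]; last 2 first.
- by move=> x _; rewrite lee_fin.
- by rewrite lee_fin divr_ge0// ltW.
rewrite (ge0_integral_sum P measurableT) => [||]; last 2 first.
- by move=> y; exact: measurable_lker_section.
- by move=> y x _; exact: lker_ge0.
move=> h; rewrite -lee_fin; apply: (le_trans h).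
rewrite EFinD leeD//.
  by rewrite [leRHS]EFinM lee_wpmul2l// lee_fin divr_ge0// ltW.
rewrite -sp -sa; elim: a a11 {sa aE pointwise mS S0 h} => [|y a ih] /=.
  by rewrite big_nil mul0r.
move=> /andP[y1 /ih h]; rewrite big_cons -add1n natrD mulrDl mul1r EFinD leeD//.
exact: poti.
Qed.

(** At s = 2 m / c the term s c / 2 = m cancels against the linear term of Stirling's bound, and
    what remains is m rho = O(ln m). *)
Lemma nonneg_poly_integral_ge : 2 * expR (- (N%:R * (i - ln 4))) <= c.
Proof.
pose rho := ln (2 / c) + N%:R * (ln 4 - i).
have c2 : 0 < 2 / c by rewrite divr_gt0.
suff rho0 : rho <= 0.
  have : ln (2 / c) <= N%:R * (i - ln 4) by move: rho0; rewrite /rho; lra.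
  rewrite -ler_expR lnK ?posrE// ler_pdivrMr// => h.
  by rewrite expRN ler_pdivrMr ?expR_gt0// mulrC.
rewrite leNgt; apply/negP => rho0.
have step (m : nat) : (0 < m)%N -> m%:R * rho <= 1 + 2 * ln m.+1%:R.
  move=> m0; have m0' : 0 < m%:R :> R by rewrite ltr0n.
  have s0 : 0 < m%:R * (2 / c) by rewrite mulr_gt0.
  have := laguerre_energy_bound m s0; rewrite lnM ?posrE// natrM.
  have -> : m%:R * (2 / c) / 2 * c = m%:R by field; rewrite gt_eqF.
  have := ln_fact_le R m0.
  have : ln m%:R <= ln m.+1%:R :> R by rewrite ler_ln ?posrE// ler_nat.
  have : 0 <= ln m.+1%:R :> R by rewrite ln_ge0// ler1n.
  rewrite /rho; lra.
(* Taking m + 1 = k^2 makes the crude bound ln k < k sufficient: (k - 1) rho > 4 gives (k^2 - 1) rho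
   > 4 (k + 1), against the upper bound 1 + 4 ln k. *)
pose k := (Num.truncn (4 / rho)).+2.
have k4 : 4 / rho < k%:R - 1.
  have -> : k%:R = (Num.truncn (4 / rho)).+1%:R + 1 :> R by rewrite natr1.
  by rewrite addrK truncnS_gt.
have k1 : (1 < k)%N by [].
have kk : (1 < k ^ 2)%N by rewrite -{1}(exp1n 2) ltn_exp2r.
have [m mE] : exists m, (k ^ 2)%N = m.+1 by exists (k ^ 2).-1; rewrite prednK// ltnW.
have m0 : (0 < m)%N by rewrite mE in kk.
have mR : m%:R = k%:R ^+ 2 - 1 :> R by rewrite -natrX mE -natr1 addrK.
have := step m m0; rewrite -mE mR natrX lnXn ?ltr0n// mulr2n.
have := @ln_sublinear R k%:R; rewrite ltr0n => /(_ isT).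
have r4 : 4 < (k%:R - 1) * rho by rewrite -ltr_pdivrMr.
have : 2 <= k%:R :> R by rewrite ler_nat.
move: k%:R (ln k%:R) r4 => x l r4 x2 lx; nra.
Qed.

End PolyIntegral.

(** * Jacobi weights *)

Section Weight.
Variables (R : realType) (alpha beta : nat).

Definition jacobi_weight : {poly R} := (1 - 'X) ^+ alpha * (1 + 'X) ^+ beta.

Lemma horner_jacobi_weight x :
  jacobi_weight.[x] = (1 - x) ^+ alpha * (1 + x) ^+ beta.
Proof. by rewrite hornerM !horner_exp hornerD hornerN hornerD hornerX hornerC. Qed.

Lemma jacobi_weight_ge0 x : -1 <= x <= 1 -> 0 <= jacobi_weight.[x].
Proof.
by move=> /andP[x1 x2]; rewrite horner_jacobi_weight mulr_ge0// exprn_ge0//; lra.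
Qed.

Lemma jacobi_weight_gt0 x : -1 < x < 1 -> 0 < jacobi_weight.[x].
Proof.
by move=> /andP[x1 x2]; rewrite horner_jacobi_weight mulr_gt0// exprn_gt0//; lra.
Qed.

Lemma jacobi_weight_le x : -1 <= x <= 1 -> jacobi_weight.[x] <= 2 ^+ (alpha + beta).
Proof.
move=> /andP[x1 x2]; rewrite horner_jacobi_weight exprD ler_pM ?exprn_ge0//; [lra|lra| |].
- by rewrite lerXn2r// ?nnegrE; lra.
- by rewrite lerXn2r// ?nnegrE; lra.
Qed.

Let onemX : (1 - 'X : {poly R}) = - ('X - 1%:P). Proof. by rewrite opprB. Qed.
Let onepX : (1 + 'X : {poly R}) = 'X - (-1)%:P.
Proof. by rewrite polyCN opprK addrC. Qed.

Let lcW : `|lead_coef jacobi_weight| = 1.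
Proof.
rewrite lead_coefM normrM !lead_coef_exp !normrX onemX lead_coefN normrN onepX.
by rewrite !lead_coefXsubC normr1 !expr1n mulr1.
Qed.

Lemma jacobi_weight_neq0 : jacobi_weight != 0.
Proof. by rewrite -lead_coef_eq0 -normr_eq0 lcW oner_eq0. Qed.

Lemma size_jacobi_weight : size jacobi_weight = (alpha + beta).+1.
Proof.
have sN : (size (1 - 'X : {poly R})).-1 = 1%N by rewrite onemX size_polyN size_XsubC.
have sD : (size (1 + 'X : {poly R})).-1 = 1%N by rewrite onepX size_XsubC.
have n0 := jacobi_weight_neq0; move: (n0); rewrite /jacobi_weight mulf_eq0 negb_or => /andP[a0 b0].
rewrite size_mul// (polySpred a0) (polySpred b0) !size_exp sN sD !mul1n.
by rewrite addnS.
Qed.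

Lemma monic_sq_weight (p : {poly R}) (n : nat) : p \is monic -> size p = n.+1 ->
  size (p ^+ 2 * jacobi_weight) = (n * 2 + (alpha + beta)).+1 /\
  `|lead_coef (p ^+ 2 * jacobi_weight)| = 1.
Proof.
move=> mp sp; have pn0 : p ^+ 2 != 0 by rewrite expf_neq0// monic_neq0.
split; last first.
  by rewrite lead_coefM normrM lcW mulr1 lead_coef_exp (monicP mp) expr1n normr1.
rewrite size_mul ?jacobi_weight_neq0// size_jacobi_weight.
by rewrite (polySpred pn0) size_exp sp /= addnS.
Qed.

End Weight.

(** * Null sets and supports *)

Section NullSets.
Local Open Scope ereal_scope.
Variable R : realType.

(** The kernel is infinite on the diagonal, so an atom at [e] would make the potential infinite
    there. *)
Lemma pot_fin_null (P : probability R R) (e : R) : pot P e < +oo -> P [set e] = 0.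
Proof.
move=> pfin; apply/eqP; apply/negPn/negP => Pe0.
have Pe : 0 < P [set e] by rewrite lt_neqAle eq_sym Pe0 measure_ge0.
have : \int[P]_(y in [set e]) lker e y <= pot P e.
  apply: ge0_subset_integral => //; last by move=> y _; exact: lker_ge0.
  exact: measurable_lker_section.
have -> : \int[P]_(y in [set e]) lker e y = +oo.
  rewrite (eq_integral (cst +oo)); last first.
    by move=> y; rewrite inE /= => ->; rewrite /lker eqxx.
  by rewrite integral_cst// gt0_mulye.
by rewrite leNgt pfin.
Qed.

Lemma open_compl_support (mu : {measure set R -> \bar R}) : open (~` Defs.support mu).
Proof.
rewrite openE => x nsx.
have [e e0 xe] : exists2 e : R, (0 < e)%R & mu (ball x e) = 0.
  apply: contrapT => h; apply: nsx => e e0; rewrite lt_neqAle measure_ge0 andbT eq_sym.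
  by apply/eqP => me; apply: h; exists e.
have e2 : (0 < e / 2)%R by rewrite divr_gt0.
apply/nbhs_ballP; exists (e / 2)%R => // y xy sy.
have := sy (e / 2)%R e2; suff -> : mu (ball y (e / 2)%R) = 0 by rewrite ltxx.
apply/eqP; rewrite -measure_le0 -xe; apply: le_measure; rewrite ?inE.
- by apply: open_measurable; exact: ball_open.
- by apply: open_measurable; exact: ball_open.
- by move=> z yz; have := ball_triangle xy yz; rewrite -splitr.
Qed.

Lemma compl_support_null (mu : {measure set R -> \bar R}) x :
  ~ Defs.support mu x -> exists2 e : R, (0 < e)%R & mu (ball x e) = 0.
Proof.
move=> nsx; apply: contrapT => h; apply: nsx => e e0.
rewrite lt_neqAle measure_ge0 andbT eq_sym.
by apply/eqP => me; apply: h; exists e.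
Qed.

Lemma measurable_eln (f : R -> R) : measurable_fun setT f ->
  measurable_fun setT (fun x => eln (f x)).
Proof.
move=> mf; apply: measurable_fun_ifT.
- by apply: measurable_fun_ltr => //; exact: measurable_cst.
- by apply/measurable_EFinP; apply: (@measurableT_comp _ _ _ _ _ _ (@ln R));
    first exact: measurable_ln.
- exact: measurable_cst.
Qed.

End NullSets.

(** * Minimal norm, support and Szegő constant of the weighted equilibrium measure *)

Section Assembly.
Variables (R : realType) (K : set R) (P : probability R R) (i : R).
Variables (alpha beta : nat) (mu : {measure set R -> \bar R}).
Local Notation W := (jacobi_weight R alpha beta).
Hypotheses (cK : compact K) (K11 : K `<=` [set x | -1 <= x <= 1]) (PK : P (~` K) = 0%E).
Hypotheses (poti : forall a : R, -1 <= a <= 1 -> (pot P a <= i%:E)%E)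
  (pot1 : pot P 1 = i%:E) (potN1 : pot P (-1) = i%:E).
Hypothesis muE : forall A, measurable A -> mu A = (\int[P]_(x in A) W.[x]%:E)%E.

Let mK : measurable K. Proof. exact: compact_measurable. Qed.

(** The weight may be negative off [-1, 1]; truncation gives a density that is nonnegative
    everywhere and agrees with it on K. *)
Let w x : R := Num.max 0 W.[x].

Let w0 x : 0 <= w x. Proof. by rewrite le_max lexx. Qed.

Let cW : continuous (horner W). Proof. exact: continuous_horner. Qed.

Let mW : measurable_fun setT (horner W). Proof. exact: continuous_measurable_fun. Qed.

Let mw : measurable_fun setT w.
Proof. by apply: measurable_maxr => //; exact: measurable_cst. Qed.

Let wK x : K x -> w x = W.[x].
Proof. by move=> /K11 /jacobi_weight_ge0 h; rewrite /w (max_idPr (h _ _)). Qed.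

Let ae_K (T : Type) (f g : R -> T) (E : set R) : (forall x, K x -> f x = g x) -> ae_eq P E f g.
Proof.
move=> fg; exists (~` K); split => //; first exact: measurableC.
by move=> x /=; apply: contra_not => Kx _; exact: fg.
Qed.

Lemma mu_density A : measurable A -> mu A = (\int[P]_(x in A) (w x)%:E)%E.
Proof.
move=> mA; rewrite muE//; apply: ae_eq_integral => //.
- by apply/measurable_EFinP/measurable_funTS.
- by apply/measurable_EFinP/measurable_funTS.
- by apply: ae_K => x Kx; rewrite wK.
Qed.

Let horner_sqW (p : {poly R}) x : (p ^+ 2 * W).[x] = p.[x] ^+ 2 * W.[x].
Proof. by rewrite hornerM horner_exp. Qed.

Let integral_sq (p : {poly R}) :
  (\int[mu]_x (p.[x] ^+ 2)%:E = \int[P]_x `|(p ^+ 2 * W).[x]|%:E)%E.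
Proof.
have mp : measurable_fun setT (fun x => p.[x] ^+ 2).
  apply: measurable_funX; apply: continuous_measurable_fun; exact: continuous_horner.
rewrite (ge0_integral_density mw w0 mu_density); last 2 first.
- exact/measurable_EFinP.
- by move=> x; rewrite lee_fin sqr_ge0.
apply: ae_eq_integral => //.
- by apply: emeasurable_funM; exact/measurable_EFinP.
- apply/measurable_EFinP; apply: (@measurableT_comp _ _ _ _ _ _ (@Num.norm R R)).
    exact: normr_measurable.
  by apply: continuous_measurable_fun; exact: continuous_horner.
- apply: ae_K => x Kx; rewrite -EFinM wK// horner_sqW ger0_norm//.
  by rewrite mulr_ge0 ?sqr_ge0// jacobi_weight_ge0//; exact: K11.
Qed.

Lemma L2min_sq_ge (n : nat) : (0 < alpha + beta)%N ->
  ((2 * expR (- ((n * 2 + (alpha + beta))%:R * (i - ln 4))))%:E <= L2min_sq mu n)%E.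
Proof.
move=> ab0; apply: le_ereal_inf_tmp => _ [p [mp sp] <-]; rewrite integral_sq.
have [sQ lQ] := monic_sq_weight alpha beta mp sp.
set J := (\int[P]_x _)%E.
have J0 : (0 <= J)%E by apply: integral_ge0 => x _; rewrite lee_fin.
have [Jfin|] := ltP J +oo%E; last by rewrite leye_eq => /eqP ->; exact: leey.
have JE : J = (fine J)%:E by rewrite fineK// ge0_fin_numE.
(* Adding [eps] supplies a strictly positive upper bound of the integral, by which the estimate can
   divide. *)
rewrite JE lee_fin; apply/ler_addgt0Pr => eps eps0.
apply: (@nonneg_poly_integral_ge R K P i cK K11 PK poti (p ^+ 2 * W)) => //.
- by rewrite addn_gt0 ab0 orbT.
- move=> x Kx; rewrite horner_sqW mulr_ge0 ?sqr_ge0// jacobi_weight_ge0//.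
  exact: K11.
- by rewrite ltr_wpDl// fine_ge0.
- by rewrite -/J JE lee_fin lerDl ltW.
Qed.

(** Needed because [fine] in [widom2] would turn an infinite minimum into 0. *)
Lemma L2min_sq_fin (n : nat) : (L2min_sq mu n < +oo)%E.
Proof.
apply: (@le_lt_trans _ _ (\int[mu]_x (('X^n : {poly R}).[x] ^+ 2)%:E)%E).
  apply: ereal_inf_lbound; exists 'X^n => //; split; first exact: monicXn.
  by rewrite size_polyXn.
rewrite integral_sq.
apply: (@le_lt_trans _ _ (\int[P]_x cst (2 ^+ (alpha + beta))%:E x)%E).
  apply: (ge0_le_integral_null mK PK).
  - apply/measurable_EFinP; apply: (@measurableT_comp _ _ _ _ _ _ (@Num.norm R R)).
      exact: normr_measurable.
    by apply: continuous_measurable_fun; exact: continuous_horner.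
  - exact: measurable_cst.
  - by move=> x; rewrite lee_fin.
  - by move=> x; rewrite lee_fin exprn_ge0.
  - move=> x /K11 /= /andP[x1 x2]; rewrite lee_fin horner_sqW hornerXn.
    have xn : `|x| <= 1 by rewrite ler_norml x1.
    have x11 : -1 <= x <= 1 by rewrite x1.
    rewrite normrM !normrX (ger0_norm (jacobi_weight_ge0 _ _ x11)) -[leRHS]mul1r.
    by rewrite ler_pM ?jacobi_weight_ge0 ?jacobi_weight_le// ?exprn_ge0// !exprn_ile1// exprn_ge0.
by rewrite integral_cst// [X in (_ * X)%E]probability_setT mule1 ltry.
Qed.

Lemma P_endpoints : P ([set 1] `|` [set -1]) = 0%E.
Proof.
have h1 : P [set 1] = 0%E by apply: pot_fin_null; rewrite pot1 ltry.
have h2 : P [set -1] = 0%E by apply: pot_fin_null; rewrite potN1 ltry.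
by rewrite measureU0.
Qed.

Let interior x : K x -> ~ ([set 1] `|` [set -1]) x -> -1 < x < 1.
Proof.
move=> /K11 /= /andP[x1 x2] h; rewrite !lt_neqAle x1 x2 !andbT.
by apply/andP; split; apply/eqP => xe; apply: h; [right|left].
Qed.

(** On K the weight vanishes at most at +-1, and these points are null because the potential is
    finite there. A ball that is null for [mu] is therefore null for [P], and the support of [mu]
    carries [P]. *)
Lemma compl_support_P_null : P (~` Defs.support mu) = 0%E.
Proof.
apply: locally_null; first exact: open_compl_support.
move=> x /compl_support_null[e e0 mue]; exists e => //.
have mB : measurable (ball x e) by apply: open_measurable; exact: ball_open.
move: mue; rewrite mu_density// => mue.
have : (\int[P]_(x0 in ball x e) `|(w x0)%:E| = 0)%E.
  by rewrite -mue; apply: eq_integral => y _; rewrite gee0_abs// lee_fin.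
move/(ae_eq_integral_abs _ mB) => [].
  by apply/measurable_EFinP/measurable_funTS.
move=> N [mN N0 BN].
have mE : measurable ([set 1] `|` [set -1] : set R) by exact: measurableU.
apply/eqP; rewrite -measure_le0.
apply: (@le_trans _ _ (P (N `|` (~` K `|` ([set 1] `|` [set -1]))))).
  apply: le_measure; rewrite ?inE//.
    by apply: measurableU => //; apply: measurableU => //; exact: measurableC.
  move=> y By; have [Ny|nNy] := pselect (N y); [by left|right].
  have [Ky|nKy] := pselect (K y); [right|by left].
  apply: contrapT => nE; apply: nNy; apply: BN => /= /(_ By) /eqP.
  by rewrite eqe wK// gt_eqF// jacobi_weight_gt0// interior.
rewrite measureU0 ?N0//; first by apply: measurableU => //; exact: measurableC.
rewrite measureU0//; [exact: measurableC|exact: P_endpoints].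
Qed.

Lemma support_sub : Defs.support mu `<=` K.
Proof.
move=> x sx; apply: contrapT => nKx.
have oK : open (~` K) by apply: closed_openC; exact: compact_closed.
have /nbhs_ballP[e /= e0 he] := open_nbhs_nbhs (conj oK nKx).
have mB : measurable (ball x e) by apply: open_measurable; exact: ball_open.
have PB : P (ball x e) = 0%E.
  apply/eqP; rewrite -measure_le0 -PK le_measure ?inE//; exact: measurableC.
have := sx e e0; rewrite mu_density//.
rewrite (ge0_negligible_integral mB mB _ _ PB).
- by rewrite setDv integral_set0 ltxx.
- by apply/measurable_EFinP/measurable_funTS.
- by move=> y _; rewrite lee_fin.
Qed.

(** In any Lebesgue decomposition f equals the weight [P]-almost everywhere, because the singular
    part lives on a [P]-null set. The logarithm of the weight is minus a combination of kernels at
    +-1, up to a constant, so its integral is given by the two end point potentials. *)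
Lemma szego_eq (S : R) : szego P mu S -> S = expR ((alpha + beta)%:R * (ln 4 - i)).
Proof.
move=> [f [mus [mf f0 [N mN [PN musN]] muf ->]]].
have wfin : P.-integrable setT (EFin \o w).
  apply/integrableP; split; first exact/measurable_EFinP.
  under eq_integral => x _ do rewrite gee0_abs ?lee_fin//.
  apply: (@le_lt_trans _ _ (\int[P]_x cst (2 ^+ (alpha + beta))%:E x)%E).
    apply: (ge0_le_integral_null mK PK).
    - exact/measurable_EFinP.
    - exact: measurable_cst.
    - by move=> x; rewrite lee_fin.
    - by move=> x; rewrite lee_fin exprn_ge0.
    - by move=> x Kx; rewrite lee_fin wK// jacobi_weight_le//; exact: K11.
  by rewrite integral_cst// [X in (_ * X)%E]probability_setT mule1 ltry.
have fw : ae_eq P setT (EFin \o w) (EFin \o f).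
  apply: integral_ae_eq => //; first exact/measurable_EFinP.
  move=> E _ mE.
  have mEN : measurable (E `\` N) by exact: measurableD.
  have musEN : mus (E `\` N) = 0%E.
    apply/eqP; rewrite -measure_le0 -musN le_measure ?inE//; first exact: measurableC.
  rewrite (ge0_negligible_integral mN mE _ _ PN); last 2 first.
  - by apply/measurable_EFinP/measurable_funTS.
  - by move=> x _; rewrite lee_fin.
  rewrite [RHS](ge0_negligible_integral mN mE _ _ PN); last 2 first.
  - by apply/measurable_EFinP/measurable_funTS.
  - by move=> x _; rewrite lee_fin.
  by have := muf _ mEN; rewrite musEN adde0 mu_density.
pose c : R := (alpha + beta)%:R * ln 4.
(* [c - g] is the logarithm of the weight on K away from +-1: there the distances to +-1 are at most
   2 and the cut-off of the kernel at 0 is inactive. *)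
pose g x : \bar R := (alpha%:R%:E * lker 1 x + beta%:R%:E * lker (-1) x)%E.
have m1 (e : R) (k : nat) : measurable_fun setT (fun x => k%:R%:E * lker e x)%E.
  by apply: emeasurable_funM => //; exact: measurable_lker_section.
have mg : measurable_fun setT g by exact: emeasurable_funD.
have l0 (e x : R) : (0 <= lker e x)%E by exact: lker_ge0.
have k0 (k : nat) (e x : R) : (0 <= k%:R%:E * lker e x)%E by rewrite mule_ge0// lee_fin.
have g0 x : (0 <= g x)%E by exact: adde_ge0.
have gint : (\int[P]_x g x = ((alpha + beta)%:R * i)%:E)%E.
  rewrite (ge0_integralD P measurableT (fun x _ => k0 alpha 1 x) (m1 1 alpha)
    (fun x _ => k0 beta (-1) x) (m1 (-1) beta)).
  rewrite (ge0_integralZl P measurableT (measurable_lker_section 1) (fun x _ => l0 1 x)) ?lee_fin//.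
  rewrite (ge0_integralZl P measurableT (measurable_lker_section (-1))
    (fun x _ => l0 (-1) x)) ?lee_fin//.
  by rewrite -/(pot P 1) -/(pot P (-1)) pot1 potN1 -!EFinM -EFinD natrD mulrDl.
have gi : P.-integrable setT g.
  apply/integrableP; split => //.
  by under eq_integral => x _ do rewrite gee0_abs//; rewrite gint ltry.
have ci : P.-integrable setT (EFin \o cst c) by exact: finite_measure_integrable_cst.
have -> : (\int[P]_x eln (f x) = \int[P]_x ((EFin \o cst c) x - g x))%E.
  apply: ae_eq_integral => //.
  - exact: measurable_eln.
  - by apply: emeasurable_funB => //; apply/measurable_EFinP; exact: measurable_cst.
  - have [N1 [mN1 N10 fwN]] := fw.
    have mE : measurable ([set 1] `|` [set -1] : set R) by exact: measurableU.
    exists (N1 `|` (~` K `|` ([set 1] `|` [set -1]))); split.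
    + by apply: measurableU => //; apply: measurableU => //; exact: measurableC.
    + rewrite measureU0 ?N10//; first by apply: measurableU => //; exact: measurableC.
      by rewrite measureU0//; [exact: measurableC|exact: P_endpoints].
    + move=> x /=; apply: contra_notP => /not_orP[nN1 /not_orP[/contrapT Kx nE]] _.
      have -> : f x = w x.
        apply: contrapT => fx; apply: nN1; apply: fwN => /= /(_ I) [].
        by move=> h; apply: fx.
      have /andP[x1 x2] := interior Kx nE.
      have W0 := jacobi_weight_gt0 alpha beta (interior Kx nE).
      rewrite wK// /eln W0 /g /lker.
      have -> : (1 == x) = false by rewrite gt_eqF.
      have -> : (-1 == x) = false by rewrite lt_eqF.
      rewrite -!EFinM -EFinD /=; congr EFin.
      have y1 : 0 < 1 - x by rewrite subr_gt0.
      have y2 : 0 < 1 + x by lra.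
      have l4 (y : R) : 0 < y -> y <= 4 -> Num.max 0 (ln 4 - ln y) = ln 4 - ln y.
        by move=> y0 y4; apply/max_idPr; rewrite subr_ge0 ler_ln ?posrE.
      have -> : `|-1 - x| = 1 + x by rewrite ltr0_norm; lra.
      rewrite gtr0_norm// !l4//; [|lra..].
      rewrite horner_jacobi_weight lnM ?posrE ?exprn_gt0// !lnXn// -!(mulr_natl (ln _)) /c natrD.
      ring.
rewrite (integralB measurableT ci gi) gint.
rewrite [X in (X - _)%E](integral_cst P measurableT c%:E)//.
rewrite [X in (_ * X)%E]probability_setT mule1 -EFinB /= /c.
by congr expR; ring.
Qed.

End Assembly.

Theorem theorem2 (R : realType) (K : set R)
  (muK mu : {measure set R -> \bar R}) (alpha beta : nat) (S : R) :
  compact K -> dirichlet_regular K ->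
  K `<=` `[-1, 1] -> K 1 -> K (-1) ->
  equilibrium_measure K muK ->
  (1 <= alpha + beta)%N ->
  (forall A, measurable A ->
     mu A = (\int[muK]_(x in A) ((1 - x) ^+ alpha * (1 + x) ^+ beta)%:E)%E) ->
  szego muK mu S ->
  forall n : nat, (0 < n)%N -> 2 * S <= widom2 mu n ^+ 2.
Proof.
move=> cK regK Kitv K1 KN1 [[muKT muKK] eqK] ab1 muE0 szS n n0.
have K11 : K `<=` [set x | -1 <= x <= 1] by move=> x /Kitv /=; rewrite in_itv.
have [P PE] := probability_of_measure muKT.
rewrite -PE in muKT muKK eqK muE0 szS; move: {PE}(muKK) => PK.
have penE nu : is_prob_on K nu -> energy nu = (pen nu - (ln 4)%:E)%E.
  by move=> h; rewrite (energy_penE cK K11 h).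
have robin_le (E : set R) nu : is_prob_on E nu -> (robin E <= energy nu)%E.
  by move=> h; apply: ereal_inf_lbound; exists nu.
have Pprob : is_prob_on K P by [].
have Pmin (nu : {measure set R -> \bar R}) : is_prob_on K nu -> (pen P <= pen nu)%E.
  by move=> h; rewrite -(@leeD2rE _ (- ln 4)%:E)// -!penE// eqK; exact: robin_le.
have [nu nuK nufin] := regular_finite_energy cK K11 regK K1 KN1.
have Pfin : (pen P < +oo)%E by exact: (le_lt_trans (Pmin nu nuK)).
pose i : R := fine (pen P).
have iE : pen P = i%:E by rewrite fineK// ge0_fin_numE// pen_ge0.
have poti (a : R) : -1 <= a <= 1 -> (pot P a <= i%:E)%E.
  by rewrite -iE; exact: (pot_le_energy cK K11 PK Pfin Pmin).
have pot1 : pot P 1 = i%:E.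
  apply/eqP; rewrite eq_le poti/=; last by apply/andP; split; lra.
  by rewrite -iE; apply: (endpoint_pot_ge cK) => //; rewrite expr1n.
have potN1 : pot P (-1) = i%:E.
  apply/eqP; rewrite eq_le poti/=; last by apply/andP; split; lra.
  by rewrite -iE; apply: (endpoint_pot_ge cK) => //; rewrite ?opprK// sqrrN expr1n.
have muE A : measurable A ->
    mu A = (\int[P]_(x in A) (jacobi_weight R alpha beta).[x]%:E)%E.
  by move=> mA; rewrite muE0//; apply: eq_integral => x _; rewrite horner_jacobi_weight.
have -> : S = expR ((alpha + beta)%:R * (ln 4 - i)).
  exact: (szego_eq cK K11 PK pot1 potN1 muE szS).
(* The support may be smaller than K, but it has the same capacity: it carries the minimizer [P],
   and every probability on it is one on K. *)
have robinE : robin (Defs.support mu) = (i - ln 4)%:E.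
  rewrite EFinB -iE -(penE _ Pprob); apply/eqP; rewrite eq_le robin_le/=; last first.
    by split => //; exact: (compl_support_P_null cK K11 PK pot1 potN1 muE).
  rewrite eqK; apply: le_ereal_inf => _ [nu' [nu'T nu'K] <-]; exists nu' => //; split => //.
  have sK := support_sub cK K11 PK muE.
  apply/eqP; rewrite -measure_le0 -nu'K le_measure ?inE//.
  - by apply: measurableC; exact: compact_measurable.
  - by apply: open_measurable; exact: open_compl_support.
  - exact: subsetC.
have capE : capacity (Defs.support mu) = expR (ln 4 - i).
  by rewrite /capacity robinE /= opprB.
have L2 := L2min_sq_ge cK K11 PK poti muE n ab1.
have L2fin := L2min_sq_fin cK K11 PK muE n.
have L20 : (0 <= L2min_sq mu n)%E.
  by apply: le_trans L2; rewrite lee_fin mulr_ge0// expR_ge0.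
rewrite /widom2 capE expr_div_n sqr_sqrtr ?fine_ge0// ler_pdivlMr ?exprn_gt0 ?expR_gt0//.
rewrite -lee_fin fineK ?ge0_fin_numE//; apply: le_trans L2; rewrite lee_fin.
rewrite -!expRM_natl -mulrA -expRD ler_pM2l// ler_expR.
lra.
Qed.
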